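(* Let $m\ge 1$ and let $\{J_1,\dots,J_n\}$ be a set of two-stage jobs, $J_k=(r_k,t_k)$ with nonnegative integers $r_k,t_k$. Let $T_{\min}$ be the smaller and $T_{\max}$ the larger of the two values $\sum_{k=1}^n r_k$ and $\sum_{k=1}^n t_k$. Then a schedule of these jobs on $m$ identical two-stage flowshops with minimum makespan can be constructed in time $O\big(nm^2 (T_{\min}^{2m-1}/m! + T_{\min} T_{\max}^{m-1})\big)$ and space $O\big(nm (T_{\min}^{2m-1}/m! + T_{\min} T_{\max}^{m-1})\big)$.
   Context: A two-stage flowshop consists of an $R$-processor and a $T$-processor, which can run in parallel. A two-stage job $J_k=(r_k,t_k)$ consists of an $R$-operation of length $r_k$ and a $T$-operation of length $t_k$. A schedule of a job set on $m$ flowshops consists of two parts. First, it assigns each job to one flowshop. Second, for each flowshop it fixes non-preemptive start times for the operations of the jobs assigned to it, subject to three rules: - the $R$-operation of a job runs on that flowshop's $R$-processor; - the $T$-operation of a job runs on the same flowshop's $T$-processor; - each processor handles at most one operation at a time, and a job's $T$-operation cannot start before its $R$-operation has completed. All flowshops are available at time $0$ and there are no precedence constraints among jobs. The completion time of a flowshop is the time at which its last $T$-operation finishes. The makespan of a schedule is the largest completion time over all flowshops.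
   Formalization: In the time and space bounds n, T_min and T_max are replaced by max(1,n), max(1,T_min) and max(1,T_max), because for T_min=0 the printed bound is 0, which no algorithm can meet; for T_min≥1 the bounds are exactly as stated. *)

(* Defs.v *)
From mathcomp Require Import all_boot all_order all_algebra.
Set Implicit Arguments.
Unset Strict Implicit.
Unset Printing Implicit Defensive.
Import Order.TTheory GRing.Theory Num.Theory.

(* A word RAM, presented as a structured language: a fixed number of registers
   (those named in the program) and a memory with indirect addressing. The
   parameter [W] of [exec] is the word limit: a computation whose arithmetic
   leaves [0, W) has no execution. Without such a limit unit-cost
   multiplication would let a single cell hold an unbounded amount of data. *)

Record state := State { reg : nat -> nat; cell : nat -> nat }.

Definition set_reg (s : state) (x v : nat) : state :=
  State [eta reg s with x |-> v] (cell s).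
Definition set_mem (s : state) (a v : nat) : state :=
  State (reg s) [eta cell s with a |-> v].

Inductive binop := Add | Sub | Mul | Div | Mod.

Definition eval_binop (o : binop) : nat -> nat -> nat :=
  match o with
  | Add => addn | Sub => subn | Mul => muln | Div => divn | Mod => modn
  end.

(* All arguments except [v] are register names: [Fetch x y] is x := M[y],
   [Store x y] is M[x] := y. *)
Inductive cmd :=
| Skip
| Const (x v : nat)
| Op (o : binop) (x y z : nat)
| Fetch (x y : nat)
| Store (x y : nat)
| Seq (c1 c2 : cmd)
| If (x : nat) (c1 c2 : cmd)
| While (x : nat) (c : cmd).

(* [exec W c s s' tm sp]: from [s], [c] halts in [s'] after [tm] elementary
   steps, all its memory accesses being at addresses below [sp]. The registers,
   constantly many for a given program, are not counted in [sp]. *)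
Inductive exec (W : nat) : cmd -> state -> state -> nat -> nat -> Prop :=
| exec_skip s : exec W Skip s s 1 0
| exec_const x v s :
    v < W -> exec W (Const x v) s (set_reg s x v) 1 0
| exec_op o x y z s :
    eval_binop o (reg s y) (reg s z) < W ->
    exec W (Op o x y z) s
      (set_reg s x (eval_binop o (reg s y) (reg s z))) 1 0
| exec_fetch x y s :
    exec W (Fetch x y) s (set_reg s x (cell s (reg s y))) 1 (reg s y).+1
| exec_store x y s :
    exec W (Store x y) s (set_mem s (reg s x) (reg s y)) 1 (reg s x).+1
| exec_seq c1 c2 s1 s2 s3 t1 t2 a1 a2 :
    exec W c1 s1 s2 t1 a1 -> exec W c2 s2 s3 t2 a2 ->
    exec W (Seq c1 c2) s1 s3 (t1 + t2) (maxn a1 a2)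
| exec_if x c1 c2 s s' tm a :
    exec W (if reg s x != 0 then c1 else c2) s s' tm a ->
    exec W (If x c1 c2) s s' tm.+1 a
| exec_while_stop x c s :
    reg s x = 0 -> exec W (While x c) s s 1 0
| exec_while_loop x c s1 s2 s3 t1 t2 a1 a2 :
    reg s1 x != 0 ->
    exec W c s1 s2 t1 a1 -> exec W (While x c) s2 s3 t2 a2 ->
    exec W (While x c) s1 s3 (t1 + t2).+1 (maxn a1 a2).

(* Memory starts with a finite input word and is zero elsewhere. *)
Definition init_state (input : seq nat) : state :=
  State (fun _ => 0) (nth 0 input).

Local Open Scope ring_scope.

Record schedule (R : realFieldType) (n m : nat) := Schedule {
  shop : 'I_n -> 'I_m;
  startR : 'I_n -> R;
  startT : 'I_n -> R
}.

(* An operation of length [len] started at [s] occupies [s, s + len); one of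
   length zero never occupies its processor. *)
Definition running (R : realFieldType) (s : R) (len : nat) (x : R) : bool :=
  s <= x < s + len%:R.

Definition feasible (R : realFieldType) (n m : nat) (r t : 'I_n -> nat)
    (S : schedule R n m) : Prop :=
  [/\ forall k, 0 <= startR S k,
      forall k, startR S k + (r k)%:R <= startT S k,
      forall j k x, j != k -> shop S j = shop S k ->
        ~~ (running (startR S j) (r j) x && running (startR S k) (r k) x)
    & forall j k x, j != k -> shop S j = shop S k ->
        ~~ (running (startT S j) (t j) x && running (startT S k) (t k) x)].

(* A flowshop without jobs completes at time 0. *)
Definition completion (R : realFieldType) (n m : nat) (t : 'I_n -> nat)
    (S : schedule R n m) (i : 'I_m) : R :=
  \big[Num.max/0]_(k | shop S k == i) (startT S k + (t k)%:R).

Definition makespan (R : realFieldType) (n m : nat) (t : 'I_n -> nat)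
    (S : schedule R n m) : R :=
  \big[Num.max/0]_(i < m) completion t S i.

Definition optimal (R : realFieldType) (n m : nat) (r t : 'I_n -> nat)
    (S : schedule R n m) : Prop :=
  feasible r t S /\
  forall S' : schedule R n m, feasible r t S' -> makespan t S <= makespan t S'.

(* Input word: m, n, r_0, t_0, r_1, t_1, ... *)
Definition encode_input (n m : nat) (r t : 'I_n -> nat) : seq nat :=
  m :: n :: flatten [seq [:: r k; t k] | k <- enum 'I_n].

(* Output: cells 3k, 3k+1, 3k+2 hold the flowshop and the two start times of
   job k. *)
Definition encodes_schedule (R : realFieldType) (n m : nat) (M : nat -> nat)
    (S : schedule R n m) : Prop :=
  forall k : 'I_n,
    [/\ M (3 * k)%N = shop S k,
        (M (3 * k + 1)%N)%:R = startR S k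
      & (M (3 * k + 2)%N)%:R = startT S k].

Definition Tmin n (r t : 'I_n -> nat) : nat :=
  minn (\sum_(k < n) r k)%N (\sum_(k < n) t k)%N.
Definition Tmax n (r t : 'I_n -> nat) : nat :=
  maxn (\sum_(k < n) r k)%N (\sum_(k < n) t k)%N.

(* Meant for a = Tmin, b = Tmax. Zero totals are read as 1, because at a = 0 the
   plain formula is 0, which no algorithm meets; nothing changes for a >= 1. *)
Definition cost_factor (m a b : nat) : rat :=
  let a' := (maxn 1 a)%:R in
  let b' := (maxn 1 b)%:R in
  a' ^+ (2 * m).-1 / (m`!)%:R + a' * b' ^+ m.-1.

Definition time_bound (n m a b : nat) : rat :=
  (maxn 1 n)%:R * m%:R ^+ 2 * cost_factor m a b.
Definition space_bound (n m a b : nat) : rat :=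
  (maxn 1 n)%:R * m%:R * cost_factor m a b.

(* A word limit polynomial in [word_base] means words of O(log word_base) bits,
   enough for the data and for every address the algorithm can reach. *)
Definition word_base (n m a b : nat) : rat :=
  2 + b%:R + time_bound n m a b.

(* Main.v *)
(* Exchanging r and t amounts to reversing time, so the total length a of the
   R-operations may be assumed to be at most the total length b of the
   T-operations. Cutting an arbitrary schedule at a suitable time c shows that
   on each flowshop Johnson's order is optimal for the jobs assigned to it;
   hence only the assignment has to be found. Distribute the jobs in Johnson's
   order and describe flowshop i by the completion times (rho_i, tau_i) of its
   two processors. With R-operations of total length P behind us and L = a - P
   still to come, a shop with rho_i + L <= tau_i never makes its T-processor
   wait again, and its rho_i is replaced by 0. In a state with j nonzero rho_i
   these form a composition of a number at most P and each tau_i - rho_i takes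
   at most L values, which gives about (PL)^j / j! choices, with PL <= a^2 / 4;
   the other tau_i contribute powers of b, and since the total work on the
   T-processors and their idle time confine the sum of all tau_i to a window of
   length P, one of these powers is saved (if all rho_i are nonzero, their sum
   being P saves one). So m! times the number of states of a layer is at most a
   constant times a^(2m-1) + m! a b^(m-1); radix sorting the codes of the
   successors of a layer removes the duplicates in time m per successor. *)

Require Import Defs.
From mathcomp Require Import all_boot all_order all_algebra.
From mathcomp Require Import zify lra.
Set Implicit Arguments.
Unset Strict Implicit.
Unset Printing Implicit Defensive.

(** * Execution rules for the RAM *)

(** The bound has to hold with one constant for all [m], and this shapes the counting. Saving a
    power of the lengths costs a factor [(m + 1) * (a + 1)], since one must record which shop was
    left out and one number for it; passing from [(m - 1)!] to [m!] costs another [m]. The factors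
    in [m] are paid by a spare [2 ^ (m - 1)]. For [b >= 32] it comes out of the binomial
    coefficients that count the shops with forgotten [rho]. For [2 <= b < 32] the count is at most a
    polynomial in [m], and [b ^ (m - 1)] contains the [2 ^ (m - 1)]. For [b <= 1] nothing pays for
    it, and for [m = 1] the bound does not even allow one pass over the bucket heads, whose number
    grows with [b]. In these two cases no dynamic program is run: all jobs go to one shop in
    Johnson's order. *)

Lemma reg_set_reg s x v y : reg (set_reg s x v) y = if y == x then v else reg s y.
Proof. by []. Qed.

Lemma cell_set_mem s x v y : cell (set_mem s x v) y = if y == x then v else cell s y.
Proof. by []. Qed.

Definition bounded (W : nat) (s : state) : Prop :=
  (forall x, reg s x < W) /\ (forall x, cell s x < W).

(** A total-correctness triple: the execution must exist, so termination and the absence of overflow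
    are part of it. Boundedness of the whole state is carried along because [Fetch] brings in values
    that are below [W] only if every cell is. *)
Definition wp (W A : nat) (c : cmd) (s : state) (T : nat) (Q : state -> Prop) : Prop :=
  bounded W s ->
  exists s' tm sp, [/\ exec W c s s' tm sp, bounded W s', tm <= T, sp <= A & Q s'].

Section Rules.
Variables W A : nat.
Implicit Types (c : cmd) (s : state) (Q : state -> Prop).

Lemma bounded_set_reg s x v : bounded W s -> v < W -> bounded W (set_reg s x v).
Proof. by move=> [h1 h2] hv; split=> // y; rewrite reg_set_reg; case: eqP. Qed.

Lemma bounded_set_mem s x v : bounded W s -> v < W -> bounded W (set_mem s x v).
Proof. by move=> [h1 h2] hv; split=> // y; rewrite cell_set_mem; case: eqP. Qed.

Lemma wp_bounded c s T Q : (bounded W s -> wp W A c s T Q) -> wp W A c s T Q.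
Proof. by move=> h hs; apply: h. Qed.

Lemma wp_le c s T T' Q : T' <= T -> wp W A c s T' Q -> wp W A c s T Q.
Proof.
move=> hT h /h [s' [tm [sp [h1 h2 h3 h4 h5]]]].
by exists s', tm, sp; split=> //; apply: leq_trans hT.
Qed.

Lemma wp_conseq c s T Q Q' :
  (forall s', Q' s' -> Q s') -> wp W A c s T Q' -> wp W A c s T Q.
Proof.
move=> hQ h /h [s' [tm [sp [h1 h2 h3 h4 h5]]]].
by exists s', tm, sp; split=> //; apply: hQ.
Qed.

Lemma wp_seq c1 c2 s T1 T2 T Q : T1 + T2 <= T ->
  wp W A c1 s T1 (fun s' => wp W A c2 s' T2 Q) -> wp W A (Seq c1 c2) s T Q.
Proof.
move=> hT h /h [s1 [t1 [a1 [h1 b1 ht1 ha1 h2]]]].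
have [s2 [t2 [a2 [h3 b2 ht2 ha2 hQ]]]] := h2 b1.
exists s2, (t1 + t2), (maxn a1 a2); split=> //.
- exact: exec_seq h1 h3.
- by apply: leq_trans hT; apply: leq_add.
- by rewrite geq_max ha1.
Qed.

(* Loop-free code only; Sub, Div, Mod never overflow since the state is bounded. *)
Fixpoint sl c Q s : Prop :=
  match c with
  | Skip => Q s
  | Const x v => v < W /\ Q (set_reg s x v)
  | Op o x y z =>
      match o with
      | Add => reg s y + reg s z < W
      | Mul => reg s y * reg s z < W
      | _ => True
      end /\ Q (set_reg s x (eval_binop o (reg s y) (reg s z)))
  | Fetch x y => reg s y < A /\ Q (set_reg s x (cell s (reg s y)))
  | Store x y => reg s x < A /\ Q (set_mem s (reg s x) (reg s y))
  | Seq c1 c2 => sl c1 (sl c2 Q) s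
  | If x c1 c2 => (reg s x != 0 -> sl c1 Q s) /\ (reg s x = 0 -> sl c2 Q s)
  | While _ _ => False
  end.

Fixpoint cost c : nat :=
  match c with
  | Seq c1 c2 => cost c1 + cost c2
  | If _ c1 c2 => (maxn (cost c1) (cost c2)).+1
  | _ => 1
  end.

Lemma wp_sl c s T Q : cost c <= T -> sl c Q s -> wp W A c s T Q.
Proof.
move=> hT h; apply: (wp_le hT) => {T hT}.
elim: c s Q h => [|x v|o x y z|x y|x y|c1 IH1 c2 IH2|x c1 IH1 c2 IH2|//] s Q /=.
- by move=> h bs; exists s, 1, 0; split=> //; constructor.
- move=> [hv h] bs; exists (set_reg s x v), 1, 0; split=> //; first by constructor.
  exact: bounded_set_reg.
- move=> [hv h] bs.
  have hW : eval_binop o (reg s y) (reg s z) < W.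
    have hy := (proj1 bs) y.
    case: o hv {h} => //= _; first by apply: leq_ltn_trans hy; apply: leq_subr.
      by apply: leq_ltn_trans hy; apply: leq_div.
    by apply: leq_ltn_trans hy; apply: leq_mod.
  eexists _, 1, 0; split; [exact: exec_op|exact: bounded_set_reg| by []| by []|by []].
- move=> [hv h] bs; eexists _, 1, _; split; [exact: exec_fetch| | by []|by []|by []].
  by apply: bounded_set_reg => //; apply: (proj2 bs).
- move=> [hv h] bs; eexists _, 1, _; split; [exact: exec_store| | by []|by []|by []].
  by apply: bounded_set_mem => //; apply: (proj1 bs).
- move=> h; apply: (wp_seq (T1 := cost c1) (T2 := cost c2)) => //.
  by apply: wp_conseq (IH1 _ _ h) => s'; apply: IH2.
- move=> [h1 h2] bs; case: (eqVneq (reg s x) 0) => hx.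
    have [s' [tm [sp [e1 e2 e3 e4 e5]]]] := IH2 _ _ (h2 hx) bs.
    exists s', tm.+1, sp; split=> //; first by constructor; rewrite hx.
    by rewrite ltnS leq_max e3 orbT.
  have [s' [tm [sp [e1 e2 e3 e4 e5]]]] := IH1 _ _ (h1 hx) bs.
  exists s', tm.+1, sp; split=> //; first by constructor; rewrite hx.
  by rewrite ltnS leq_max e3.
Qed.

Lemma wp_if x c1 c2 s T Q :
  (reg s x != 0 -> wp W A c1 s T Q) -> (reg s x = 0 -> wp W A c2 s T Q) ->
  wp W A (If x c1 c2) s T.+1 Q.
Proof.
move=> h1 h2 bs; case: (eqVneq (reg s x) 0) => hx.
  have [s' [tm [sp [e1 e2 e3 e4 e5]]]] := h2 hx bs.
  by exists s', tm.+1, sp; split=> //; constructor; rewrite hx.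
have [s' [tm [sp [e1 e2 e3 e4 e5]]]] := h1 hx bs.
by exists s', tm.+1, sp; split=> //; constructor; rewrite hx.
Qed.

(* [I T s]: from [s] the loop can be finished within time [T]. *)
Lemma wp_while (I : nat -> state -> Prop) x c s T Q :
  (forall T s, I T s -> reg s x = 0 -> 0 < T /\ Q s) ->
  (forall T s, I T s -> reg s x != 0 ->
     exists t T', t + T' < T /\ wp W A c s t (I T')) ->
  I T s -> wp W A (While x c) s T Q.
Proof.
move=> h0 h1; elim/ltn_ind: T s => T IH s hI bs.
case: (eqVneq (reg s x) 0) => hx.
  have [hT hQ] := h0 _ _ hI hx.
  by exists s, 1, 0; split=> //; constructor.
have [t [T' [hT hw]]] := h1 _ _ hI hx.
have [s1 [t1 [a1 [e1 b1 l1 p1 hI1]]]] := hw bs.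
have hT' : T' < T by apply: leq_ltn_trans hT; apply: leq_addl.
have [s2 [t2 [a2 [e2 b2 l2 p2 hQ]]]] := IH _ hT' _ hI1 b1.
exists s2, (t1 + t2).+1, (maxn a1 a2); split=> //.
- exact: exec_while_loop hx e1 e2.
- by apply: leq_trans hT; rewrite ltnS leq_add.
- by rewrite geq_max p1.
Qed.

End Rules.

Notation "c1 ;; c2" := (Seq c1 c2) (at level 90, right associativity).

(* Register 1 holds the constant 1; [z] holds what remains of the count in [y]. *)
Definition For (x y z : nat) (c : cmd) : cmd :=
  Const x 0;; Op Defs.Sub z y x;; While z (c;; Op Add x x 1;; Op Defs.Sub z y x).

(** The loop control of [For] itself changes [x] and [z], so the invariant of the next round has to
    be stated for the state after both updates. *)
Definition next_iter s x y z : state :=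
  let s1 := set_reg s x (reg s x).+1 in set_reg s1 z (reg s1 y - reg s1 x).

Section ForRule.
Variables W A : nat.

(* The potential [phi] pays for the bodies of the remaining iterations. *)
Lemma wp_for_gen (I : nat -> nat -> state -> Prop) n phi x y z c s T Q :
  uniq [:: 1; x; y; z] -> reg s y = n -> reg s 1 = 1 ->
  (forall k phi s, k < n -> I k phi s -> reg s x = k -> reg s y = n -> reg s 1 = 1 ->
    exists t phi', t + phi' <= phi /\
    wp W A c s t (fun s' => [/\ reg s' x = k, reg s' y = n, reg s' 1 = 1
       & I k.+1 phi' (next_iter s' x y z)])) ->
  I 0 phi (set_reg (set_reg s x 0) z n) ->
  (forall phi s', I n phi s' -> Q s') ->
  phi + 4 * n + 3 <= T ->
  wp W A (For x y z c) s T Q.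
Proof.
rewrite /= !inE !negb_or => /andP [] /and3P [x1 y1 z1] /andP [] /andP [xy xz] /andP [yz _].
move=> hy h1 hb hI hQ hT; apply: wp_bounded => bs.
have e1 := (negbTE xy, negbTE xz, negbTE yz, negbTE x1, negbTE z1, negbTE y1).
have e2 := (eq_sym y x, eq_sym z x, eq_sym z y).
have hnW : n < W by rewrite -hy; apply: (proj1 bs).
apply: (wp_seq (T1 := 1) (T2 := phi + 4 * n + 2)); first by lia.
apply: wp_sl => //=; split; first by lia.
apply: (wp_seq (T1 := 1) (T2 := phi + 4 * n + 1)); first by lia.
apply: wp_sl => //=; split=> //.
rewrite eqxx e2 e1 hy subn0.
apply: (@wp_while _ _ (fun T s => exists k phi', [/\ k <= n, T = phi' + 4 * (n - k) + 1,
   [/\ reg s x = k, reg s y = n, reg s z = n - k & reg s 1 = 1] & I k phi' s])).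
- move=> T' s' [k [phi' [hk -> [g1 g2 g3 g4] hI']]] hz; split; first by lia.
  have e : k = n by lia.
  by rewrite e in hI'; exact: (hQ _ _ hI').
- move=> T' s' [k [phi' [hk -> [g1 g2 g3 g4] hI']]] hz.
  have hkn : k < n by lia.
  have [t [phi2 [ht hw]]] := hb _ _ _ hkn hI' g1 g2 g4.
  exists (t + 2), (phi2 + 4 * (n - k.+1) + 1); split; first by lia.
  apply: (wp_seq (T1 := t) (T2 := 2)) => //.
  apply: wp_conseq hw => s2 [f1 f2 f3 hI2].
  apply: wp_sl => //=; split; first by rewrite f1 f3; lia.
  split=> //; exists k.+1, phi2; split=> //.
    by rewrite !(eqxx, e2, e1) f1 f2 f3 addn1.
  by move: hI2; rewrite /next_iter /= f1 f3 addn1.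
- by exists 0, phi; rewrite /= !(eqxx, e2, e1) subn0; split.
Qed.

Lemma wp_for (I : nat -> state -> Prop) n Tb x y z c s T Q :
  uniq [:: 1; x; y; z] -> reg s y = n -> reg s 1 = 1 ->
  (forall k s, k < n -> I k s -> reg s x = k -> reg s y = n -> reg s 1 = 1 ->
    wp W A c s Tb (fun s' => [/\ reg s' x = k, reg s' y = n, reg s' 1 = 1
       & I k.+1 (next_iter s' x y z)])) ->
  I 0 (set_reg (set_reg s x 0) z n) ->
  (forall s', I n s' -> Q s') ->
  n * (Tb + 4) + 3 <= T ->
  wp W A (For x y z c) s T Q.
Proof.
move=> hu hy h1 hb hI hQ hT.
apply: (@wp_for_gen (fun k phi s => phi = (n - k) * Tb /\ I k s) n (n * Tb)) => //.
- move=> k phi s' hk [-> hI'] e1 e2 e3; exists Tb, ((n - k.+1) * Tb); split.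
    by rewrite -mulSn subnSK.
  by apply: wp_conseq (hb _ _ hk hI' e1 e2 e3) => s2 [].
- by rewrite subn0.
- by move=> phi s' [_]; apply: hQ.
- by lia.
Qed.

End ForRule.

(** * Radix sort of linked lists *)

(** A linked list in memory: the link of a node is the cell at the address of the node, and address
    0 is the null pointer. *)
Fixpoint chain (h : nat -> nat) (p : nat) (l : seq nat) : Prop :=
  if l is x :: l' then [/\ p = x, x != 0 & chain h (h x) l'] else p = 0.

Arguments chain h p !l /.

Ltac side := repeat (split; [first [by [] | by lia]|]).

Lemma chain_eq h h' p l :
  {in l, h =1 h'} -> chain h p l -> chain h' p l.
Proof.
elim: l p => //= x l IH p hh [-> hx hc]; split=> //.
rewrite -hh ?inE ?eqxx //; apply: IH => // y hy; apply: hh.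
by rewrite inE hy orbT.
Qed.

Lemma chain_notin h p l x v : x \notin l -> chain h p l ->
  chain (fun y => if y == x then v else h y) p l.
Proof.
move=> hx; apply: chain_eq => y hy; case: eqP => // e.
by rewrite -e hy in hx.
Qed.

Lemma chain_cons h p l x : x != 0 -> x \notin l -> chain h p l ->
  chain (fun y => if y == x then p else h y) x (x :: l).
Proof. by move=> x0 hx hc; split=> //; rewrite eqxx; apply: chain_notin. Qed.

Lemma chain_zero h p l : chain h p l -> (p == 0) = (l == [::]).
Proof. by case: l => [|x l] /=; [move->|case=> -> /negbTE ->]. Qed.

Ltac skip_reg := repeat (case: eqP => [?|_]; [first [by subst | by lia]|]).

(** One stable bucket pass: [filter] preserves the order inside each bucket. *)
Definition bsort (d : nat -> nat) (M : nat) (l : seq nat) : seq nat :=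
  flatten [seq [seq x <- l | d x == v] | v <- iota 0 M].

(* Register conventions: 0 holds 0; 1-4 hold 1-4; 5 m; 6 n; 7, 8, 9 the addresses of
   the job records (r, t, k-th job of the order and its shop), of the shop records
   and of the bucket heads; 10, 11 the smaller and the larger total; 12 nonzero if r
   and t were exchanged; 13 M, the base of the state codes; 14 M^2; 15 2m; 19 the
   makespan. During the dynamic program, 20 is the first free address, 21 the
   current layer, 22 the R-length still to come and 24 the list under construction.
   The 4-cell nodes of a layer are (next, code, parent, shop of the last job). *)
Definition distribute : cmd :=
  While 24 (
    Fetch 41 24;;
    Op Add 42 24 1;; Fetch 42 42;; Op Div 42 42 40;; Op Mod 42 42 13;;
    Op Add 42 42 9;; Fetch 43 42;;
    Store 24 43;; Store 42 24;; Op Add 24 41 0).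

Definition collect : cmd :=
  For 44 13 45 (
    (Op Defs.Sub 46 13 1;; Op Defs.Sub 46 46 44;; Op Add 46 46 9;;
    Fetch 47 46;; Store 46 0);;
    While 47 (
      Fetch 48 47;; Store 47 24;; Op Add 24 47 0;; Op Add 47 48 0)).

(* Nodes are 4-cell records at [nb + 4 * j], below [A] and above the bucket heads. *)
Definition isnode (nb A x : nat) : Prop := exists2 j, x = nb + 4 * j & x + 4 <= A.

Section Pass.
Variables W A hb M nb pow : nat.
Hypothesis hM : 0 < M.
Hypothesis hnb : hb + M <= nb.
Hypothesis nb0 : 0 < nb.
Hypothesis hAW : A < W.
Hypothesis hnA : nb <= A.

Let hd x := hb <= x < hb + M.

Definition regs_ok s := [/\ reg s 0 = 0, reg s 1 = 1, reg s 9 = hb & reg s 13 = M].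

(** Nodes are prepended to their buckets, which reverses each bucket; [collect] reverses it back. *)
Lemma distribute_spec s0 l :
  let d x := (cell s0 (x + 1) %/ pow) %% M in
  regs_ok s0 -> reg s0 40 = pow -> uniq l -> (forall x, x \in l -> isnode nb A x) ->
  chain (cell s0) (reg s0 24) l ->
  (forall v, v < M -> cell s0 (hb + v) = 0) ->
  wp W A distribute s0 (11 * size l + 1) (fun s =>
    [/\ forall x, x < 41 -> x != 24 -> reg s x = reg s0 x,
      forall v, v < M -> chain (cell s) (cell s (hb + v)) (rev [seq x <- l | d x == v]),
      forall x, x \notin l -> ~ hd x -> cell s x = cell s0 x &
      reg s 24 = 0]).
Proof.
move=> d [r0 r1 r9 r13] r40 ul nl cl h0; rewrite /distribute.
pose I T s := exists l1 l2,
  [/\ l = l1 ++ l2, T = 11 * size l2 + 1,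
     chain (cell s) (reg s 24) l2,
     forall x, x < 41 -> x != 24 -> reg s x = reg s0 x
   & (forall v, v < M -> chain (cell s) (cell s (hb + v)) (rev [seq x <- l1 | d x == v])) /\
     (forall x, x \notin l -> ~ hd x -> cell s x = cell s0 x)].
apply: (@wp_while _ _ I).
- move=> T s [l1 [l2 [e -> hc hr [hv hx]]]] h24; split; first by lia.
  have := chain_zero hc; rewrite h24 eqxx => /esym/eqP e2; subst l2.
  by rewrite cats0 in e; subst l1; split.
- move=> T s [l1 [l2 [e -> hc hr [hv hx]]]] h24.
  have := chain_zero hc; rewrite (negbTE h24); case: l2 e hc => // x l2 e [ex x0 hc] _.
  have xl : x \in l by rewrite e mem_cat inE eqxx orbT.
  have [j ej jA] := nl _ xl.
  have hdx : (cell s (x + 1) %/ pow) %% M = d x.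
    rewrite /d hx //; last by rewrite /hd; lia.
    by apply/negP => /nl [j' e' _]; lia.
  have hdM : d x < M by rewrite ltn_mod.
  exists 10, (11 * size l2 + 1); split; first by rewrite /=; lia.
  apply: wp_bounded => bs; apply: wp_sl => //=.
  have R r : r < 41 -> r != 24 -> reg s r = reg s0 r by apply: hr.
  rewrite (R 0) // (R 1) // (R 9) // (R 13) // (R 40) // r0 r1 r9 r13 r40 ex hdx (addnC _ hb).
  have q1 : (hb + d x == x) = false by apply/eqP; lia.
  have q2 : (x == hb + d x) = false by apply/eqP; lia.
  have bx := (proj2 bs) x.
  side.
  have xl1 : x \notin l1.
    by move: ul; rewrite e uniq_catC /= mem_cat; case/andP => /norP [].
  have xl2 : x \notin l2.
    by move: ul; rewrite e cat_uniq /=; case/and3P => _ _ /andP [].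
  exists (rcons l1 x), l2; split => //=.
  - by rewrite cat_rcons.
  - rewrite addn0; apply: chain_eq hc => y yl2 /=.
    have [j' e' _] : isnode nb A y by apply: nl; rewrite e mem_cat inE yl2 !orbT.
    have [?|_] := eqP; first by lia.
    by have [ey|//] := eqP; rewrite -ey yl2 in xl2.
  - by move=> y hy hy'; skip_reg; rewrite R.
  - split.
    + move=> v hvM; rewrite filter_rcons.
      have hl : forall y, y \in rev [seq x <- l1 | d x == v] -> y <> hb + d x /\ y <> x.
        move=> y; rewrite mem_rev mem_filter => /andP [_ yl1].
        have [j' e' _] : isnode nb A y by apply: nl; rewrite e mem_cat yl1.
        by split; [lia|move=> ey; rewrite -ey yl1 in xl1].
      case: (eqVneq (d x) v) => hdv.
        subst v; rewrite rev_rcons eqxx /= q2 eqxx; split=> //.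
        apply: chain_eq (hv _ hdM) => y /hl [y1 y2] /=.
        by do 2 (case: eqP => // _).
      have -> : (hb + v == hb + d x) = false by apply/eqP; lia.
      have -> : (hb + v == x) = false by apply/eqP; lia.
      apply: chain_eq (hv _ hvM) => y /hl [y1 y2] /=.
      by do 2 (case: eqP => // _).
    + move=> y yl hdy; have [ey|_] := eqP; first by exfalso; apply: hdy; rewrite /hd; lia.
      by have [ey|_] := eqP; [rewrite ey xl in yl|apply: hx].
- exists [::], l; split=> //; split=> // v hvM; apply: h0 => //.
Qed.

(** Buckets are emptied from the highest digit down and their nodes prepended to the output. This
    undoes the reversal made by [distribute], so that the whole pass is stable. The heads are left
    at 0, ready for the next pass. *)
Lemma collect_spec s0 l (d : nat -> nat) :
  let F v := [seq x <- l | d x == v] in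
  regs_ok s0 -> reg s0 24 = 0 -> uniq l -> (forall x, x \in l -> isnode nb A x) ->
  (forall v, v < M -> chain (cell s0) (cell s0 (hb + v)) (rev (F v))) ->
  wp W A collect s0 (6 * size (bsort d M l) + 12 * M + 3) (fun s =>
    [/\ forall x, x < 41 -> x != 24 -> reg s x = reg s0 x,
      chain (cell s) (reg s 24) (bsort d M l),
      forall v, v < M -> cell s (hb + v) = 0 &
      forall x, x \notin l -> ~ hd x -> cell s x = cell s0 x]).
Proof.
move=> F [r0 r1 r9 r13] r24 ul nl hF; rewrite /collect.
pose out c := flatten [seq F v | v <- iota (M - c) c].
have Fl v x : x \in F v -> x \in l by rewrite mem_filter => /andP [].
pose J c s := [/\ chain (cell s) (reg s 24) (out c),
  forall v, v < M - c -> chain (cell s) (cell s (hb + v)) (rev (F v)),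
  forall v, M - c <= v < M -> cell s (hb + v) = 0,
  forall x, x < 41 -> x != 24 -> reg s x = reg s0 x &
  forall x, x \notin l -> ~ hd x -> cell s x = cell s0 x].
(* The nodes still in buckets serve as the potential: the inner loops together take time linear in
   the length of the list, however the nodes are spread over the buckets. *)
pose rest c := flatten [seq F v | v <- iota 0 (M - c)].
apply: (@wp_for_gen _ _ (fun c phi s => phi = 6 * size (rest c) + 8 * (M - c) /\ J c s) M
   (6 * size (bsort d M l) + 8 * M)) => //.
- move=> c phi s hc [-> [h1 h2 h3 h4 h5]] k1 k2 k3.
  set v := M - c.+1.
  have hrest : rest c = rest c.+1 ++ F v.
    rewrite /rest /v (_ : M - c = (M - c.+1).+1); last by lia.
    by rewrite -addn1 iotaD map_cat flatten_cat /= cats0.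
  have hout : out c.+1 = F v ++ out c.
    by rewrite /out /v /= (_ : (M - c.+1).+1 = M - c) //; lia.
  exists (6 * size (F v) + 8), (6 * size (rest c.+1) + 8 * (M - c.+1)); split.
    by rewrite hrest size_cat; lia.
  have hvM : v < M by lia.
  have R r : r < 41 -> r != 24 -> reg s r = reg s0 r by apply: h4.
  apply: (wp_seq (T1 := 5) (T2 := 6 * size (F v) + 1)) => //; first by lia.
  apply: wp_bounded => bs; apply: wp_sl => //=.
  rewrite (R 0) // (R 9) // (R 13) // r0 r9 r13.
  side.
  have -> : M - reg s 1 - reg s 44 = v by lia.
  rewrite (addnC v) => {bs}.
  pose I2 T s' := exists l1 l2, [/\ rev (F v) = l1 ++ l2, T = 6 * size l2 + 1,
    chain (cell s') (reg s' 47) l2 /\ chain (cell s') (reg s' 24) (rev l1 ++ out c),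
    (forall u, u < v -> chain (cell s') (cell s' (hb + u)) (rev (F u))) /\
    (forall u, v <= u < M -> cell s' (hb + u) = 0) &
    (forall x, x < 46 -> x != 24 -> reg s' x = reg s x) /\
    (forall x, x \notin l -> ~ hd x -> cell s' x = cell s x)].
  have Fnode u x : x \in F u -> isnode nb A x by move=> /Fl; apply: nl.
  have outv x : x \in out c -> x \in l /\ v < d x.
    case/flattenP => s' /mapP [u]; rewrite mem_iota => hu -> hxu; split; first exact: Fl hxu.
    by move: hxu; rewrite mem_filter => /andP [/eqP -> _]; lia.
  apply: (@wp_while _ _ I2).
  - move=> T s' [l1 [l2 [e -> [hc2 hc1] [hu1 hu2] [hr hx]]]] h47; split; first by lia.
    have := chain_zero hc2; rewrite h47 eqxx => /esym/eqP e2; subst l2.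
    have e1 : F v = rev l1 by rewrite cats0 in e; rewrite -e revK.
    rewrite !hr //; split=> //; split=> //; split=> //=.
    + by rewrite hout e1.
    + by move=> x hx1 hx2; skip_reg; rewrite hr ?R //; lia.
    + by move=> x hx1 hx2; rewrite hx // h5.
  - move=> T s' [l1 [l2 [e -> [hc2 hc1] [hu1 hu2] [hr hx]]]] h47.
    have := chain_zero hc2; rewrite (negbTE h47); case: l2 e hc2 => // x l2 e [ex x0 hc2] _.
    have xF : x \in F v by rewrite -mem_rev e mem_cat inE eqxx orbT.
    have [j ej jA] := Fnode _ _ xF.
    have dx : d x = v by move: xF; rewrite mem_filter => /andP [/eqP].
    have uF : uniq (l1 ++ x :: l2) by rewrite -e rev_uniq filter_uniq.
    have xl2 : x \notin l2.
      by move: uF; rewrite cat_uniq /=; case/and3P => _ _ /andP [].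
    have xl1 : x \notin rev l1 ++ out c.
      rewrite mem_cat mem_rev negb_or; apply/andP; split.
        by move: uF; rewrite uniq_catC /= mem_cat; case/andP => /norP [].
      by apply/negP => /outv []; lia.
    exists 4, (6 * size l2 + 1); split; first by rewrite /=; lia.
    apply: wp_bounded => bs; apply: wp_sl => //=.
    have b1 := (proj2 bs) x; have b2 := (proj1 bs) 47.
    rewrite (hr 0) // (R 0) // r0 ex !addn0.
    side.
    exists (rcons l1 x), l2; split=> //.
    + by rewrite cat_rcons.
    + split=> /=; first exact: chain_notin.
      by rewrite rev_rcons /=; split=> //; rewrite eqxx; apply: chain_notin.
    + split=> u hu /=.
        have -> : (hb + u == x) = false by apply/eqP; lia.
        apply: chain_notin; last exact: hu1.
        by rewrite mem_rev mem_filter dx; case: eqP => // ?; lia.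
      have -> : (hb + u == x) = false by apply/eqP; lia.
      exact: hu2.
    + split=> y hy1 hy2; first by rewrite /=; skip_reg; apply: hr.
      rewrite /=; case: eqP => [ey|_]; last exact: hx.
      by rewrite ey (Fl _ _ xF) in hy1.
  - have hvl u x : u < M -> x \in rev (F u) -> x <> hb + v.
      by rewrite mem_rev => hu /Fnode [j' e' _] ?; lia.
    exists [::], (rev (F v)); split=> //.
    + by rewrite size_rev.
    + split=> /=.
        by apply: chain_eq (h2 v _) => [x /hvl xx|]; [rewrite /=; case: eqP; lia|lia].
      apply: chain_eq h1 => x /outv [xl _] /=; case: eqP => // ?.
      by have [j' e' _] := nl _ xl; lia.
    + split=> u hu /=.
        have -> : (hb + u == hb + v) = false by apply/eqP; lia.
        by apply: chain_eq (h2 u _) => [x /hvl xx|]; [rewrite /=; case: eqP; lia|lia].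
      by case: eqP => // ?; apply: h3; lia.
    + split=> y hy1 hy2; first by rewrite /=; skip_reg.
      by rewrite /=; case: eqP => // ?; exfalso; apply: hy2; rewrite /hd; lia.
- split; first by rewrite /rest subn0.
  split=> //=.
  + by move=> v hv; apply: hF; lia.
  + by move=> v; lia.
  + by move=> x h1 h2; skip_reg.
- move=> phi s [_ [h1 h2 h3 h4 h5]]; split=> //.
    by move: h1; rewrite /out subnn.
  by move=> v hv; apply: h3; lia.
- by lia.
Qed.
End Pass.

Lemma perm_bsort d M l : (forall x, x \in l -> d x < M) -> perm_eq (bsort d M l) l.
Proof.
move=> hd; apply/permP => p; rewrite /bsort count_flatten -map_comp.
under eq_map => v do rewrite /= count_filter.
elim: l hd => [|x l IH] hd /=; first by elim: (iota 0 M).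
rewrite -IH => [|y yl]; last by apply: hd; rewrite inE yl orbT.
have : x \in x :: l by rewrite inE eqxx.
move/hd; rewrite -[d x < M]/(0 <= d x < 0 + M) -mem_iota.
have := iota_uniq 0 M; elim: (iota 0 M) => // v s IHs /= /andP [vs us].
rewrite inE => /orP [/eqP e|hs].
  rewrite -e eqxx /= addnA andbT; congr (_ + _).
  congr sumn; apply/eq_in_map => u us'.
  by case: eqP => [e'|_]; [rewrite -e e' us' in vs|rewrite andbF].
rewrite IHs // addnCA; congr (_ + _).
by case: eqP => [e|_]; [rewrite -e hs in vs|rewrite andbF].
Qed.

(** Stability in relational form: [r] is the order by the digits already treated, [r'] the order
    that compares the new digit first. *)
Lemma pairwise_bsort (r r' : rel nat) d M l :
  (forall x y, d x < d y -> r' x y) -> (forall x y, d x = d y -> r x y -> r' x y) ->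
  pairwise r l -> pairwise r' (bsort d M l).
Proof.
move=> h1 h2 hl; rewrite /bsort.
have : pairwise ltn (iota 0 M) by rewrite -sorted_pairwise ?iota_ltn_sorted //; apply: ltn_trans.
elim: (iota 0 M) => //= v s IH /andP [hv hs]; rewrite pairwise_cat IH // andbT.
apply/andP; split.
  apply/allrelP => x y; rewrite mem_filter => /andP [/eqP dx _].
  case/flattenP => _ /mapP [u us ->]; rewrite mem_filter => /andP [/eqP dy _].
  by apply: h1; rewrite dx dy; apply: (allP hv).
have := pairwise_filter (fun x => d x == v) hl.
move: (filter_all (fun x => d x == v) l).
elim: [seq _ <- _ | _] => //= x t IHt /andP [/eqP dx dt] /andP [hx ht].
rewrite IHt // andbT; apply/allP => y yt.
by apply: h2; [rewrite dx; apply/esym/eqP/(allP dt)|apply: (allP hx)].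
Qed.

Definition pass : cmd := distribute;; collect.
Definition radix : cmd := Const 40 1;; For 38 15 39 (pass;; Op Mul 40 40 13).

Section Radix.
Variables W A hb M nb : nat.
Hypothesis hM : 0 < M.
Hypothesis hnb : hb + M <= nb.
Hypothesis nb0 : 0 < nb.
Hypothesis hAW : A < W.
Hypothesis hnA : nb <= A.

Lemma pass_spec s0 l pow :
  let d x := (cell s0 (x + 1) %/ pow) %% M in
  regs_ok hb M s0 -> reg s0 40 = pow -> uniq l -> (forall x, x \in l -> isnode nb A x) ->
  chain (cell s0) (reg s0 24) l ->
  (forall v, v < M -> cell s0 (hb + v) = 0) ->
  wp W A pass s0 (17 * size l + 12 * M + 4) (fun s =>
    [/\ forall x, x < 41 -> x != 24 -> reg s x = reg s0 x,
      chain (cell s) (reg s 24) (bsort d M l) &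
      forall x, x \notin l -> cell s x = cell s0 x]).
Proof.
move=> d ok r40 ul nl cl h0.
have dM x : x \in l -> d x < M by rewrite ltn_mod.
have hs := perm_size (perm_bsort dM).
apply: (wp_seq (T1 := 11 * size l + 1) (T2 := 6 * size (bsort d M l) + 12 * M + 3)).
  by rewrite hs; lia.
have H1 := distribute_spec hM hnb nb0 hAW hnA ok r40 ul nl cl h0.
apply: wp_conseq H1 => s1 [h1 h2 h3 h4].
have ok1 : regs_ok hb M s1 by case: ok => o1 o2 o3 o4; split; rewrite h1.
have H2 := collect_spec hM hnb nb0 hAW hnA ok1 h4 ul nl h2.
apply: wp_conseq H2 => s2 [g1 g2 g3 g4]; split=> //; first by move=> x x1 x2; rewrite g1 // h1.
move=> x xl; case: (boolP ((hb <= x) && (x < hb + M))) => [/andP [x1 x2]|/negP hx].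
  by rewrite -(subnKC x1) g3 ?h0 //; lia.
by rewrite g4 // h3.
Qed.

Lemma sorted_digit_step (k : nat -> nat) l j :
  let d x := (k x %/ M ^ j) %% M in
  pairwise (fun x y => k x %% M ^ j <= k y %% M ^ j) l ->
  pairwise (fun x y => k x %% M ^ j.+1 <= k y %% M ^ j.+1) (bsort d M l).
Proof.
move=> d; have e x : k x %% M ^ j.+1 = d x * M ^ j + k x %% M ^ j.
  have hp : 0 < M ^ j by rewrite expn_gt0 hM.
  rewrite /d {1}(divn_eq (k x) (M ^ j)) {1}(divn_eq (k x %/ M ^ j) M).
  rewrite mulnDl -mulnA -expnS -addnA modnMDl modn_small // expnS.
  have h1 := ltn_pmod (k x) hp; have h2 := ltn_pmod (k x %/ M ^ j) hM.
  by nia.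
apply: pairwise_bsort => [x y dxy|x y dxy]; rewrite !e; last by rewrite dxy leq_add2l.
have hp : 0 < M ^ j by rewrite expn_gt0 hM.
have h1 := ltn_pmod (k x) hp; nia.
Qed.

(** After [j] passes the list is sorted by the keys modulo [M ^ j]. The passes change only link
    cells and bucket heads, so the keys may be read in the initial state throughout. *)
Lemma radix_spec s0 l np :
  let key x := cell s0 (x + 1) in
  regs_ok hb M s0 -> reg s0 15 = np -> uniq l -> (forall x, x \in l -> isnode nb A x) ->
  chain (cell s0) (reg s0 24) l ->
  (forall v, v < M -> cell s0 (hb + v) = 0) ->
  (forall x, x \in l -> key x < M ^ np) -> M ^ np < W ->
  wp W A radix s0 (np * (17 * size l + 12 * M + 9) + 4) (fun s =>
    (forall x, x < 38 -> x != 24 -> reg s x = reg s0 x) /\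
    exists l', [/\ chain (cell s) (reg s 24) l', perm_eq l' l,
      pairwise (fun x y => key x <= key y) l' &
      forall x, x \notin l -> cell s x = cell s0 x]).
Proof.
move=> key [r0 r1 r9 r13] r15 ul nl cl h0 hk hW.
apply: (wp_seq (T1 := 1) (T2 := np * (17 * size l + 12 * M + 9) + 3)); first by lia.
have W1 : 1 < W by lia.
apply: wp_sl => //=; split=> //.
pose I j s := [/\ forall x, x < 38 -> x != 24 -> reg s x = reg s0 x,
   reg s 40 = M ^ j & exists l', [/\ chain (cell s) (reg s 24) l', perm_eq l' l,
      pairwise (fun x y => key x %% M ^ j <= key y %% M ^ j) l' &
      forall x, x \notin l -> cell s x = cell s0 x]].
apply: (@wp_for _ _ I np (17 * size l + 12 * M + 5)) => //.
- move=> j s hj [h1 h2 [l' [g1 g2 g3 g4]]] e1 e2 e3.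
  apply: (wp_seq (T1 := 17 * size l' + 12 * M + 4) (T2 := 1)).
    by rewrite (perm_size g2); lia.
  have hM2 v : v < M -> cell s (hb + v) = 0.
    by move=> hv; rewrite g4 ?h0 //; apply/negP => /nl [j' ? ?]; lia.
  have ok : regs_ok hb M s by split; rewrite h1.
  have ul' : uniq l' by rewrite (perm_uniq g2).
  have nl' x : x \in l' -> isnode nb A x by rewrite (perm_mem g2); apply: nl.
  have H := pass_spec ok h2 ul' nl' g1 hM2.
  apply: wp_conseq H => s1 [k1 k2 k3].
  apply: wp_sl => //=.
  have hkey x : x \in l -> cell s (x + 1) = key x.
    move=> /nl [i ei hi]; apply: g4; apply/negP => /nl [i' ? ?]; lia.
  rewrite (k1 40) // (k1 13) // h2 (h1 13) // r13 -expnSr; split.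
    by apply: leq_ltn_trans hW; rewrite leq_pexp2l.
  rewrite (k1 38) // (k1 15) // (k1 1) // e1 e2 e3.
  split=> //; split=> /=.
  + by move=> x hx1 hx2; skip_reg; rewrite k1 ?h1 //; lia.
  + by [].
  set d := fun x => _ in k2.
  have dM x : x \in l' -> d x < M by move=> _; rewrite ltn_mod.
  exists (bsort d M l'); split.
  + by [].
  + by apply: perm_trans g2; apply: perm_bsort.
  + have -> : bsort d M l' = bsort (fun x => (key x %/ M ^ j) %% M) M l'.
      rewrite /bsort; congr flatten; apply: eq_map => v.
      by apply: eq_in_filter => x; rewrite /d (perm_mem g2) => /hkey ->.
    exact: sorted_digit_step.
  + by move=> x xl; rewrite k3 ?g4 // (perm_mem g2).
- split=> /=; [by move=> x hx1 hx2; skip_reg|by []|].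
  exists l; split=> //=.
  by apply/(pairwiseP 0) => x y _ _ _; rewrite expn0 !modn1.
- move=> s [h1 h2 [l' [g1 g2 g3 g4]]]; split=> //; exists l'; split=> //.
  apply: (sub_in_pairwise (P := mem l')) g3; last exact: allss.
  by move=> x y; rewrite !(perm_mem g2) => hx hy; rewrite !modn_small //; apply: hk.
- by rewrite -addnA.
Qed.
End Radix.

(** * Removing duplicates from a sorted list *)

Definition dedupe : cmd :=
  Const 21 0;;
  While 24 (
    Fetch 41 24;; Const 42 1;;
    If 21 (Op Add 43 21 1;; Fetch 43 43;; Op Add 44 24 1;; Fetch 44 44;;
           Op Defs.Sub 42 44 43) Skip;;
    If 42 (Store 24 21;; Op Add 21 24 0) Skip;;
    Op Add 24 41 0).

Section Dedupe.
Variables W A nb : nat.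
Hypothesis nb0 : 0 < nb.
Hypothesis hAW : A < W.
Hypothesis hnA : nb <= A.

(** Equal keys are adjacent in the sorted list, so it suffices to compare with the node kept last:
    the truncated difference of the keys is nonzero exactly for a new key. The kept nodes are
    prepended, hence strictly decreasing in their keys, which gives uniqueness. *)
Lemma dedupe_spec s0 l :
  let key x := cell s0 (x + 1) in
  reg s0 0 = 0 -> reg s0 1 = 1 -> uniq l -> (forall x, x \in l -> isnode nb A x) ->
  chain (cell s0) (reg s0 24) l ->
  pairwise (fun x y => key x <= key y) l ->
  wp W A dedupe s0 (13 * size l + 2) (fun s =>
    (forall x, x < 38 -> x != 24 -> x != 21 -> reg s x = reg s0 x) /\
    exists l', [/\ chain (cell s) (reg s 21) l', {subset l' <= l},
      uniq [seq key x | x <- l'], (forall x, x \in l -> exists2 y, y \in l' & key y = key x) &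
      forall x, x \notin l -> cell s x = cell s0 x]).
Proof.
move=> key r0 r1 ul nl cl sl; apply: wp_bounded => bs0.
have W1 : 1 < W by have := proj1 bs0 1; rewrite r1.
apply: (wp_seq (T1 := 1) (T2 := 13 * size l + 1)); first by lia.
apply: wp_sl => //=; split; first by lia.
pose I T s := exists l1 l2 acc, [/\ l = l1 ++ l2, T = 13 * size l2 + 1,
  chain (cell s) (reg s 24) l2 /\ chain (cell s) (reg s 21) acc,
  [/\ {subset acc <= l1}, pairwise (fun x y => key y < key x) acc &
     forall x, x \in l1 -> exists2 y, y \in acc & key y = key x] &
  (forall x, x < 38 -> x != 24 -> x != 21 -> reg s x = reg s0 x) /\
  (forall x, x \notin l -> cell s x = cell s0 x)].
apply: (@wp_while _ _ I).
- move=> T s [l1 [l2 [acc [e -> [c2 c1] [h1 h2 h3] [hr hx]]]]] h24; split; first by lia.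
  have := chain_zero c2; rewrite h24 eqxx => /esym/eqP e2; subst l2.
  rewrite cats0 in e; subst l1; split=> //; exists acc; split=> //.
  rewrite uniq_pairwise pairwise_map.
  by apply: sub_pairwise h2 => x y /=; rewrite ltn_neqAle eq_sym => /andP [].
- move=> T s [l1 [l2 [acc [e -> [c2 c1] [h1 h2 h3] [hr hx]]]]] h24.
  have := chain_zero c2; rewrite (negbTE h24); case: l2 e c2 => // x l2 e [ex x0 c2] _.
  have xl : x \in l by rewrite e mem_cat inE eqxx orbT.
  have hkey y : y \in l -> cell s (y + 1) = key y.
    by move=> /nl [i ei hi]; apply: hx; apply/negP => /nl [i' ? ?]; lia.
  have [j ej jA] := nl _ xl.
  have l1l y : y \in l1 -> y \in l by rewrite e mem_cat => ->.
  have xl1 : x \notin l1.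
    by move: ul; rewrite e uniq_catC /= mem_cat; case/andP => /norP [].
  have xl2 : x \notin l2.
    by move: ul; rewrite e cat_uniq /=; case/and3P => _ _ /andP [].
  have xacc : x \notin acc by apply/negP => /h1; rewrite (negbTE xl1).
  have hle y : y \in acc -> key y <= key x.
    move=> /h1 yl1; move: sl; rewrite e pairwise_cat => /and3P [/allrelP sl _ _].
    by apply: sl => //; rewrite inE eqxx.
  exists 12, (13 * size l2 + 1); split; first by rewrite /=; lia.
  have drop s' : (forall y, y < 38 -> y != 24 -> reg s' y = reg s y) ->
      reg s' 24 = cell s x -> cell s' = cell s ->
      (exists2 y, y \in acc & key y = key x) -> I (13 * size l2 + 1) s'.
    move=> k1 k2 k3 k4; exists (rcons l1 x), l2, acc; split=> //; first by rewrite cat_rcons.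
    + by rewrite k2 k3 k1.
    + split=> // y; rewrite ?mem_rcons ?inE => hy; first by rewrite h1 ?orbT.
      by case/orP: hy => [/eqP ->|/h3].
    + by split=> [y y1 y2 y3|y y1]; [rewrite k1 // hr|rewrite k3 hx].
  have push s' : (forall y, y < 38 -> y != 24 -> y != 21 -> reg s' y = reg s y) ->
      reg s' 24 = cell s x -> reg s' 21 = x ->
      cell s' =1 (fun y => if y == x then reg s 21 else cell s y) ->
      (forall y, y \in acc -> key y < key x) -> I (13 * size l2 + 1) s'.
    move=> k1 k2 k3 k4 k5; exists (rcons l1 x), l2, (x :: acc); split=> //.
    + by rewrite cat_rcons.
    + rewrite k2 k3; split; first by apply/(chain_eq (fun y _ => esym (k4 y)))/chain_notin.
      by apply/(chain_eq (fun y _ => esym (k4 y)))/chain_cons.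
    + split=> [y|/=|y]; rewrite ?mem_rcons ?inE.
      * by case/orP => [->//|/h1 ->]; rewrite orbT.
      * by rewrite h2 andbT; apply/allP => y /k5.
      * case/orP => [/eqP ->|/h3 [z z1 z2]]; first by exists x; rewrite ?inE ?eqxx.
        by exists z => //; rewrite inE z1 orbT.
    + split=> [y y1 y2 y3|y y1]; first by rewrite k1 // hr.
      by rewrite k4; case: eqP => [ey|_]; [rewrite ey xl in y1|apply: hx].
  apply: wp_bounded => bs; apply: wp_sl => //=.
  rewrite ex (hr 0) // (hr 1) // r0 r1 !addn0.
  have b1 := proj2 bs x; have b2 := proj1 bs 21.
  split; first by lia.
  split=> //; split=> h21.
    have := chain_zero c1; rewrite (negbTE h21); case: acc c1 h1 h2 h3 xacc hle drop push => // y acc.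
    move=> [ey y0 c1] h1 h2 h3 xacc hle drop push _.
    have yl : y \in l by apply/l1l/h1; rewrite inE eqxx.
    have [j' ej' jA'] := nl _ yl.
    rewrite ey !hkey //.
    split; first by clear -jA' jA nb0 ej hAW; lia.
    side.
    split=> hk.
      side; apply: push => //=.
      * by move=> z z1 z2 z3; skip_reg.
      * by move=> z; rewrite ey.
      * move=> z; rewrite inE => /orP [/eqP ->|zacc]; first by lia.
        move: h2 => /= /andP [/allP/(_ _ zacc) hz _].
        by apply: leq_trans hz _; apply: hle; rewrite inE eqxx.
    side; apply: drop => //=; first by move=> z z1 z2; skip_reg.
    exists y; rewrite ?inE ?eqxx //.
    by have := hle y; rewrite inE eqxx; lia.
  have := chain_zero c1; rewrite h21 eqxx => /esym/eqP ea; subst acc.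
  split=> // _; side; apply: push => //=.
  + by move=> z z1 z2 z3; skip_reg.
  + by move=> z; rewrite h21.
- exists [::], l, [::]; split=> //=.
  by split=> // x hx1 hx2 hx3; skip_reg.
Qed.
End Dedupe.

(** * Expansion of a layer of states *)

Definition step (r t : nat) (p : nat * nat) : nat * nat :=
  (p.1 + r, maxn p.2 (p.1 + r) + t).

(* [L] is the total length of the R-operations still to come: once
   [p.1 + L <= p.2] the T-processor never idles again and [p.1] is irrelevant. *)
Definition canon (L : nat) (p : nat * nat) : nat * nat :=
  if p.1 + L <= p.2 then (0, p.2) else p.

Definition trans (L r t i : nat) (v : nat -> nat * nat) (i' : nat) : nat * nat :=
  canon L (if i' == i then step r t (v i') else v i').

Definition enc (M : nat) (p : nat * nat) : nat := p.1 + p.2 * M.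

(** A number with [m] digits to the base [M * M], each a pair to the base [M]; this is why the radix
    sort takes [2 * m] passes to the base [M]. *)
Definition code (M m : nat) (v : nat -> nat * nat) : nat :=
  \sum_(i < m) enc M (v i) * (M * M) ^ i.

Definition small (M m : nat) (v : nat -> nat * nat) : Prop :=
  forall i, i < m -> (v i).1 < M /\ (v i).2 < M.

Lemma enc_lt M p : p.1 < M -> p.2 < M -> enc M p < M * M.
Proof. rewrite /enc; nia. Qed.

Lemma sum_digit B m (u : nat -> nat) c : (forall i, i < m -> u i < B) -> c < m ->
  ((\sum_(i < m) u i * B ^ i) %/ B ^ c) %% B = u c.
Proof.
move=> hu hc; have B0 : 0 < B by have := hu _ hc; lia.
have e n (w : nat -> nat) : \sum_(i < n.+1) w i * B ^ i = (\sum_(i < n) w i.+1 * B ^ i) * B + w 0.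
  rewrite big_ord_recl expn0 muln1 addnC big_distrl; congr (_ + _).
  by apply: eq_bigr => i _; rewrite /= expnSr mulnA.
elim: c m u hu hc => [|c IH] [//|m] u hu hc; rewrite e.
  by rewrite expn0 divn1 modnMDl modn_small // hu.
rewrite expnS divnMA divnMDl // (divn_small (hu 0 _)) // addn0.
by apply: (IH m (fun i => u i.+1)) => // i hi; apply: hu.
Qed.

Lemma sum_digit_lt B m (u : nat -> nat) : (forall i, i < m -> u i < B) ->
  \sum_(i < m) u i * B ^ i < B ^ m.
Proof.
elim: m => [|m IH] hu; first by rewrite big_ord0.
rewrite big_ord_recr /= expnS.
have h1 := IH (fun i hi => hu i (ltnW hi)); have h2 := hu m (ltnSn m).
apply: (@leq_trans ((u m).+1 * B ^ m)); last by rewrite leq_mul2r h2 orbT.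
by rewrite mulSn ltn_add2r.
Qed.

Lemma code_digit M m v i : small M m v -> i < m ->
  (code M m v %/ (M * M) ^ i) %% (M * M) = enc M (v i).
Proof.
move=> hv hi; apply: (@sum_digit _ _ (fun i => enc M (v i))) => // j /hv [h1 h2].
exact: enc_lt.
Qed.

Lemma code_lt M m v : small M m v -> code M m v < (M * M) ^ m.
Proof.
move=> hv; apply: (@sum_digit_lt _ _ (fun i => enc M (v i))) => j /hv [h1 h2].
exact: enc_lt.
Qed.

Lemma enc_mod M p : p.1 < M -> enc M p %% M = p.1.
Proof. by move=> h; rewrite /enc addnC modnMDl modn_small. Qed.

Lemma enc_div M p : p.1 < M -> enc M p %/ M = p.2.
Proof. by move=> h; rewrite /enc addnC divnMDl ?divn_small ?addn0 //; lia. Qed.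

(** One sweep over the digits reads the old code in register 52 and builds the new one in register
    50, with the current weight in register 51. Truncated subtraction supplies the tests: [x = y] if
    [(x - y) + (y - x)] is zero, [x <= y] if [x - y] is zero, and [y + (x - y)] is the maximum. *)
Definition cand : cmd :=
  (Const 50 0;; Const 51 1;; Op Add 52 30 50);;
  For 53 5 54 (
    (Op Mod 55 52 14;; Op Div 52 52 14;; Op Mod 56 55 13;; Op Div 57 55 13);;
    (Op Defs.Sub 58 31 53;; Op Defs.Sub 59 53 31;; Op Add 58 58 59;;
     If 58 Skip (Op Add 56 56 32;; Op Defs.Sub 58 56 57;; Op Add 57 57 58;;
                 Op Add 57 57 33));;
    (Op Add 58 56 22;; Op Defs.Sub 58 58 57;;
     If 58 Skip (Const 56 0));;
    (Op Mul 58 57 13;; Op Add 58 58 56;; Op Mul 58 58 51;; Op Add 50 50 58;;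
     Op Mul 51 51 14)).

Section Cand.
Variables W A M m L r t i : nat.
Hypothesis hM : 1 < M.
Hypothesis hW : (M * M) ^ m < W.
Hypothesis hW2 : 4 * M < W.

Lemma cand_spec s0 v :
  small M m v -> small M m (trans L r t i v) -> i < m ->
  r < M -> t < M -> L < M -> (v i).1 + r < M -> maxn (v i).2 ((v i).1 + r) + t < M ->
  [/\ reg s0 1 = 1, reg s0 5 = m, reg s0 13 = M & reg s0 14 = M * M] ->
  reg s0 30 = code M m v ->
  [/\ reg s0 31 = i, reg s0 32 = r, reg s0 33 = t & reg s0 22 = L] ->
  wp W A cand s0 (m * 30 + 6) (fun s =>
    [/\ forall x, x < 50 -> reg s x = reg s0 x, cell s = cell s0 &
      reg s 50 = code M m (trans L r t i v)]).
Proof.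
move=> hv hv' im rM tM LM h1M h2M [r1 r5 r13 r14] r30 [r31 r32 r33 r22].
apply: wp_bounded => bs0.
have W1 : 1 < W by have := proj1 bs0 1; rewrite r1.
apply: (wp_seq (T1 := 3) (T2 := m * 30 + 3)); first by lia.
apply: wp_sl => //=.
have b30 := proj1 bs0 30.
side.
pose I k s := [/\ (forall x, x < 50 -> reg s x = reg s0 x) /\ cell s = cell s0,
  reg s 50 = code M k (trans L r t i v), reg s 51 = (M * M) ^ k &
  reg s 52 = code M m v %/ (M * M) ^ k].
apply: (@wp_for _ _ I m 23) => //.
- move=> k s hk [[hr hcell] e50 e51 e52] e53 _ _.
  have [v1 v2] := hv _ hk; have [v1' v2'] := hv' _ hk.
  have hlt := enc_lt v1' v2'.
  have hp : 0 < (M * M) ^ k by rewrite expn_gt0; apply/orP; left; nia.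
  have hpk : (M * M) ^ k.+1 <= (M * M) ^ m by rewrite leq_pexp2l //; nia.
  have hacc : code M k (trans L r t i v) < (M * M) ^ k.
    by apply: code_lt => j hj; apply: hv'; lia.
  (* Registers 56 and 57 hold a pair [p]. The same assertion is used for the pair read from the
     code, for the pair after the possible [step], and for the pair after [canon]. *)
  pose K p s' := [/\ (forall x, x < 55 -> x != 52 -> reg s' x = reg s x) /\ cell s' = cell s,
    reg s' 52 = code M m v %/ (M * M) ^ k.+1, reg s' 56 = p.1 & reg s' 57 = p.2].
  apply: (wp_seq (T1 := 4) (T2 := 19)) => //.
  apply: (wp_conseq (Q' := K (v k))); last first.
    apply: wp_sl => //=; do 4 (split=> //).
    rewrite (hr 14) // (hr 13) // e52 r13 r14 code_digit // enc_mod // enc_div //.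
    split=> //=; first by split=> // x x1 x2; skip_reg.
    by rewrite -divnMA -expnSr.
  move=> s1 [[k1 kc] k2 k3 k4].
  apply: (wp_seq (T1 := 8) (T2 := 11)) => //.
  apply: (wp_conseq (Q' := K (if k == i then step r t (v k) else v k))); last first.
    apply: wp_bounded => bs; apply: wp_sl => //=.
    rewrite (k1 31) // (k1 53) // (k1 32) // (k1 33) // (hr 31) // (hr 32) // (hr 33) // e53.
    rewrite k3 k4 r31 r32 r33.
    have bi := proj1 bs0 31; rewrite r31 in bi.
    split=> //; split=> //; split; first by have := proj1 bs 53; rewrite k1 // e53; clear -bi; lia.
    split=> hik.
      have ki : k <> i.
        by move=> e; rewrite e subnn in hik.
      rewrite (introF eqP ki).
      by split=> //=; split=> // x x1 x2; skip_reg; apply: k1.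
    have ki : k = i by clear -hik; lia.
    rewrite ki eqxx.
    have e : (v i).2 + ((v i).1 + r - (v i).2) = maxn (v i).2 ((v i).1 + r) by clear; lia.
    rewrite e.
    split; first by clear -h1M hW2; lia.
    split=> //.
    split; first by clear -h2M hW2; lia.
    split; first by clear -h2M hW2; lia.
    by split=> //=; split=> // x x1 x2; skip_reg; apply: k1.
  move=> {k1 kc k2 k3 k4} s2 [[k1 kc] k2 k3 k4].
  apply: (wp_seq (T1 := 4) (T2 := 7)) => //.
  apply: (wp_conseq (Q' := K (trans L r t i v k))); last first.
    set p := if k == i then _ else _ in k3 k4.
    have [p1 p2] : p.1 < M /\ p.2 < M.
      by rewrite /p; case: eqP => // ->; rewrite /step /=; split=> //.
    apply: wp_sl => //=.
    rewrite (k1 22) // (hr 22) // r22 k3 k4.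
    split; first by clear -p1 p2 LM hW2; lia.
    split=> //; split=> hc.
      have -> : trans L r t i v k = p by rewrite /trans /canon -/p ifN //; clear -hc; lia.
      by split=> //=; split=> // x x1 x2; skip_reg; apply: k1.
    have -> : trans L r t i v k = (0, p.2) by rewrite /trans /canon -/p ifT //; clear -hc; lia.
    split; first by clear -hW2 LM; lia.
    by split=> //=; split=> // x x1 x2; skip_reg; exact: k1.
  move=> {k1 kc k2 k3 k4} s3 [[k1 kc] k2 k3 k4].
  apply: wp_sl => //=.
  rewrite (k1 13) // (k1 14) // (k1 51) // (k1 50) // (hr 13) // (hr 14) // r13 r14 e51 e50 k3 k4.
  rewrite (addnC (_ * M)) -/(enc M _).
  have hmul : enc M (trans L r t i v k) * (M * M) ^ k + (M * M) ^ k <= (M * M) ^ k.+1.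
    by rewrite addnC -mulSn expnS leq_mul2r hlt orbT.
  have hMM : enc M (trans L r t i v k) < W.
    apply: leq_trans (leq_trans hpk (ltnW hW)); rewrite expnS; apply: leq_trans hlt _.
    by rewrite leq_pmulr.
  split; first by apply: leq_ltn_trans hMM; rewrite /enc leq_addl.
  split=> //; split; first by clear -hmul hpk hW hp; lia.
  split; first by clear -hmul hpk hW hp hacc; lia.
  split; first by rewrite -expnSr; apply: leq_ltn_trans hpk hW.
  rewrite (k1 53) // (k1 5) // (k1 1) // (hr 5) // (hr 1) // e53 r5 r1.
  split=> //; split=> //=.
  + by split=> [x x1|]; [skip_reg; rewrite k1 ?hr //; clear -x1; lia|rewrite kc].
  + by rewrite /code big_ord_recr.
  + by rewrite expnSr.
- split=> //=.
  + by split=> // x x1; skip_reg.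
  + by rewrite /code big_ord0.
  + by rewrite expn0 divn1 addn0.
- by move=> s [[h1 h1'] h2 h3 h4].
- by lia.
Qed.
End Cand.

Definition expand : cmd :=
  (Const 24 0;; Op Add 25 21 24);;
  While 25 (
    (Op Add 30 25 1;; Fetch 30 30);;
    For 31 5 34 (
      cand;;
      (Store 20 24;; Op Add 36 20 1;; Store 36 50;; Op Add 36 36 1;; Store 36 25;;
       Op Add 36 36 1;; Store 36 31;; Op Add 24 20 0;; Op Add 20 20 4));;
    Fetch 25 25).

(** Addresses decrease along the list because each new node is taken from the free end and
    prepended. *)
Fixpoint node_seq (fr n : nat) : seq nat :=
  if n is n'.+1 then (fr + 4 * n') :: node_seq fr n' else [::].

Lemma mem_node_seq fr n x : x \in node_seq fr n -> exists2 k, k < n & x = fr + 4 * k.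
Proof.
elim: n => //= n IH; rewrite inE => /orP [/eqP ->|/IH [k hk ->]]; first by exists n.
by exists k => //; lia.
Qed.

Lemma mem_node_seqI fr n k : k < n -> fr + 4 * k \in node_seq fr n.
Proof.
elim: n => //= n IH; rewrite inE ltnS leq_eqVlt => /orP [/eqP ->|/IH ->]; rewrite ?eqxx //.
by rewrite orbT.
Qed.

Lemma uniq_node_seq fr n : uniq (node_seq fr n).
Proof.
by elim: n => //= n ->; rewrite andbT; apply/negP => /mem_node_seq [k hk]; lia.
Qed.

Lemma size_node_seq fr n : size (node_seq fr n) = n.
Proof. by elim: n => //= n ->. Qed.

Section Expand.
Variables W A M m L r t fr : nat.
Variable V : nat -> nat -> nat * nat.
Hypothesis hM : 1 < M.
Hypothesis hW : (M * M) ^ m < W.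
Hypothesis hW2 : 4 * M < W.
Hypothesis hAW : A < W.
Hypotheses (rM : r < M) (tM : t < M) (LM : L < M).
Hypothesis hm : 0 < m.
Hypothesis fr0 : 0 < fr.

Definition children (ps : seq (nat * nat)) (s : state) : Prop :=
  forall k, k < size ps -> let q := nth (0, 0) ps k in let x := fr + 4 * k in
    [/\ cell s (x + 1) = code M m (trans L r t q.2 (V q.1)),
        cell s (x + 2) = q.1 & cell s (x + 3) = q.2].

Definition expanded (s0 : state) (ps : seq (nat * nat)) (s : state) : Prop :=
  [/\ reg s 20 = fr + 4 * size ps, chain (cell s) (reg s 24) (node_seq fr (size ps)),
      children ps s, forall x, x < fr -> cell s x = cell s0 x &
      forall x, x < 30 -> x != 20 -> x != 24 -> x != 25 -> reg s x = reg s0 x].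

Lemma push_child s0 ps s p i :
  expanded s0 ps s -> reg s 1 = 1 -> reg s 4 = 4 -> reg s 0 = 0 ->
  reg s 25 = p -> reg s 31 = i -> reg s 50 = code M m (trans L r t i (V p)) ->
  reg s 20 + 4 <= A ->
  wp W A (Store 20 24;; Op Add 36 20 1;; Store 36 50;; Op Add 36 36 1;; Store 36 25;;
       Op Add 36 36 1;; Store 36 31;; Op Add 24 20 0;; Op Add 20 20 4) s 9
    (fun s' => expanded s0 (rcons ps (p, i)) s' /\
       forall x, x < 36 -> x != 20 -> x != 24 -> reg s' x = reg s x).
Proof.
move=> [e20 ch cs hx hr] r1 r4 r0 r25 r31 r50; rewrite e20 => hA.
have [f fE] : exists f, f = fr + 4 * size ps by eexists.
rewrite -fE in e20 hA.
have f2 : f + 1 + 1 = f + 2 by rewrite -addnA.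
have f3 : f + 2 + 1 = f + 3 by rewrite -addnA.
apply: wp_sl => //=; rewrite r1 r4 e20 r25 r31 r50 r0 f2 f3 !addn0 /=.
do 9 (split; first by clear -hA hAW; lia).
split; last by move=> x x1 x2 x3; skip_reg.
set s' := set_reg _ _ _.
have hc x : cell s' x = if x == f + 3 then i else if x == f + 2 then p else
    if x == f + 1 then code M m (trans L r t i (V p)) else if x == f then reg s 24
    else cell s x by [].
have q20 : reg s' 20 = f + 4 by [].
have q24 : reg s' 24 = f by [].
have qr x : x < 30 -> x != 20 -> x != 24 -> x != 25 -> reg s' x = reg s x.
  by move=> x1 x2 x3 _ /=; skip_reg.
clearbody s'.
have old x : x < f -> cell s' x = cell s x.
  by move=> hxf; rewrite hc; skip_reg.
split.
- by rewrite size_rcons q20; lia.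
- rewrite size_rcons q24 /= -fE; split=> //; first by clear -fr0 fE; lia.
  rewrite hc eqxx; do 3 (case: eqP => [?|_]; [by lia|]).
  by apply: chain_eq ch => x /mem_node_seq [k hk ex]; rewrite old //; rewrite ex; lia.
- move=> k; rewrite size_rcons ltnS leq_eqVlt => /orP [/eqP ->|hk] /=.
    rewrite nth_rcons ltnn eqxx -fE /= !hc !eqxx.
    by split=> //; skip_reg.
  rewrite nth_rcons hk !old; [exact: cs|..]; lia.
- by move=> x hxf; rewrite old ?hx //; lia.
- by move=> x x1 x2 x3 x4; rewrite qr ?hr.
Qed.

Lemma expand_spec s0 l :
  let key x := cell s0 (x + 1) in
  [/\ reg s0 0 = 0, reg s0 1 = 1, reg s0 4 = 4 & reg s0 5 = m] ->
  [/\ reg s0 13 = M, reg s0 14 = M * M, reg s0 20 = fr & reg s0 22 = L] ->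
  [/\ reg s0 32 = r & reg s0 33 = t] ->
  chain (cell s0) (reg s0 21) l ->
  (forall x, x \in l -> x + 4 <= fr /\ key x = code M m (V x)) ->
  (forall x, x \in l -> small M m (V x) /\ forall i, i < m ->
    [/\ small M m (trans L r t i (V x)), (V x i).1 + r < M &
       maxn (V x i).2 ((V x i).1 + r) + t < M]) ->
  fr + 4 * (size l * m) <= A ->
  wp W A expand s0 (size l * (m * (m * 30 + 20) + 20) + 3) (fun s =>
    expanded s0 [seq (p, i) | p <- l, i <- iota 0 m] s).
Proof.
move=> key [r0 r1 r4 r5] [r13 r14 r20 r22] [r32 r33] cl hk hv hA.
apply: wp_bounded => bs0.
apply: (wp_seq (T1 := 2) (T2 := size l * (m * (m * 30 + 20) + 20) + 1)); first by clear; lia.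
apply: wp_sl => //=.
have b21 := proj1 bs0 21; have W1 : 1 < W by have := proj1 bs0 1; rewrite r1.
rewrite addn0; split; first by clear -W1; lia.
split=> //.
pose G (l1 : seq nat) := [seq (p, i) | p <- l1, i <- iota 0 m].
have sizeG l1 : size (G l1) = size l1 * m by rewrite size_allpairs size_iota.
pose J ps s := expanded s0 ps s /\ (forall x, 30 < x -> x < 34 -> x != 31 -> reg s x = reg s0 x).
pose I T s := exists l1 l2, [/\ l = l1 ++ l2, T = size l2 * (m * (m * 30 + 20) + 20) + 1,
   chain (cell s) (reg s 25) l2 & J (G l1) s].
apply: (@wp_while _ _ I).
- move=> T s [l1 [l2 [e -> c2 [h1 h2]]]] h25; split; first by clear; lia.
  have := chain_zero c2; rewrite h25 eqxx => /esym/eqP e2; subst l2.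
  by rewrite cats0 in e; subst l1.
- move=> T s [l1 [l2 [e -> c2 [h1 h2]]]] h25.
  have := chain_zero c2; rewrite (negbTE h25); case: l2 e c2 => // p l2 e [ep p0 c2] _.
  have pl : p \in l by rewrite e mem_cat inE eqxx orbT.
  have [hpf hpk] := hk _ pl.
  have [hVp hVt] := hv _ pl.
  have hszl : size l1 * m + m <= size l * m.
    by rewrite e size_cat /= -mulSnr leq_mul2r; apply/orP; right; clear; lia.
  exists (m * (m * 30 + 20) + 10), (size l2 * (m * (m * 30 + 20) + 20) + 1); split; first by rewrite /= mulSn; clear; lia.
  have [e20 ch cs hx hr] := h1.
  apply: (wp_seq (T1 := 2) (T2 := m * (m * 30 + 20) + 8)); first by clear; lia.
  apply: wp_sl => //=.
  rewrite (hr 1) // r1 ep (hx (p + 1)); last by clear -hpf; lia.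
  rewrite -/(key p) hpk.
  split; first by clear -hpf hA hAW; lia.
  split; first by clear -hpf hA; lia.
  apply: (wp_seq (T1 := m * (m * 30 + 20) + 7) (T2 := 1)); first by clear; lia.
  pose K i s' := [/\ J (G l1 ++ [seq (p, i') | i' <- iota 0 i]) s', reg s' 25 = p &
     reg s' 30 = code M m (V p)].
  apply: (@wp_for _ _ K m (m * 30 + 15)) => //.
  + by rewrite /= hr.
  + by rewrite /= hr.
  + move=> i s' hi [[h1' h2'] q25 q30] e31 e5 e1.
    set ps := _ ++ _ in h1'.
    have szps : size ps = size l1 * m + i by rewrite size_cat sizeG size_map size_iota.
    have [e20' ch' cs' hx' hr'] := h1'.
    have [ht1 ht2 ht3] := hVt _ hi.
    apply: (wp_seq (T1 := m * 30 + 6) (T2 := 9)); first by clear; lia.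
    have R1 : [/\ reg s' 1 = 1, reg s' 5 = m, reg s' 13 = M & reg s' 14 = M * M].
      by rewrite (hr' 13) // (hr' 14).
    have R2 : [/\ reg s' 31 = i, reg s' 32 = r, reg s' 33 = t & reg s' 22 = L].
      by rewrite (hr' 22) // (h2' 32) // (h2' 33).
    have C := cand_spec A hM hW hW2 hVp ht1 hi rM tM LM ht2 ht3 R1 q30 R2.
    apply: wp_conseq C.
    move=> s1 [g1 g2 g3].
    have h1s : expanded s0 ps s1.
      split=> //; first by rewrite g1.
      - by rewrite g2 g1.
      - by move=> k hk'; rewrite g2; apply: cs'.
      - by rewrite g2.
      - by move=> x x1 x2 x3 x4; rewrite g1 ?hr' //; clear -x1; lia.
    have P := push_child (p := p) (i := i) h1s.
    apply: wp_conseq (P _ _ _ _ _ g3 _); try by rewrite g1 // ?hr'.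
      move=> s2 [p1 p2].
      have {}p2 x : x < 36 -> x != 20 -> x != 24 -> reg s2 x = reg s' x.
        by move=> x1 x2 x3; rewrite p2 // g1 //; clear -x1; lia.
      have eps : G l1 ++ [seq (p, i') | i' <- iota 0 i.+1] = rcons ps (p, i).
        by rewrite -addn1 iotaD map_cat catA cats1 add0n.
      rewrite !p2 //; split=> //; split; rewrite /= ?p2 //.
      rewrite -[_ ++ _]/(G l1 ++ [seq (p, i') | i' <- iota 0 i.+1]) eps.
      split; last by move=> x x1 x2 x3 /=; skip_reg; rewrite p2 ?h2' //; clear -x2 x1; lia.
      have [u1 u2 u3 u4 u5] := p1.
      split=> //= x x1 x2 x3 x4; skip_reg; exact: u5.
    rewrite g1 // e20' szps; move: hi hA hszl; clear; lia.
  + split=> //=; rewrite cats0; split.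
      by split=> //= x x1 x2 x3 x4; skip_reg; exact: hr.
    by move=> x x1 x2 x3 /=; skip_reg; apply: h2.
  + move=> s' [[h1' h2'] q25 q30].
    have [e20' ch' cs' hx' hr'] := h1'.
    apply: wp_sl => //=; rewrite q25 hx'; last by clear -hpf; lia.
    split; first by clear -hpf hA hAW; lia.
    exists (rcons l1 p), l2; split=> //; first by rewrite cat_rcons.
      rewrite /=; move: c2; rewrite hx; last by clear -hpf; lia.
      apply: chain_eq => x xl2 /=; rewrite hx ?hx' //.
        by have [] := hk x (_ : x \in l); [rewrite e mem_cat inE xl2 !orbT|clear; lia].
      by have [] := hk x (_ : x \in l); [rewrite e mem_cat inE xl2 !orbT|clear; lia].
    split; last by move=> x x1 x2 x3 /=; skip_reg; apply: h2'.
    have -> : G (rcons l1 p) = G l1 ++ [seq (p, i') | i' <- iota 0 m].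
      by rewrite /G map_rcons -cats1 flatten_cat /= cats0.
    by split=> //= x x1 x2 x3 x4; skip_reg; exact: hr'.
  + by apply: leq_add => //; rewrite leq_mul2l -addnA leq_add2l orbT.
- exists [::], l; split=> //=.
  split; last by move=> x x1 x2 x3 /=; skip_reg.
  split=> //=; first by rewrite r20 addn0.
  by move=> x x1 x2 x3 x4; skip_reg.
Qed.
End Expand.

(** * The dynamic program *)

Definition psum (u : nat -> nat) (k : nat) : nat := \sum_(c < k) u c.

Lemma psumS u k : psum u k.+1 = psum u k + u k.
Proof. by rewrite /psum big_ord_recr. Qed.

Lemma psum_le u k k' : k <= k' -> psum u k <= psum u k'.
Proof. by move/subnK => <-; elim: (k' - k) => //= d IH; rewrite addSn psumS; lia. Qed.

(* State of the shops after the first [k] jobs of the order are distributed by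
   [f], canonicalised after each job; [a] is the total length of all R-operations. *)
Fixpoint cstate (a : nat) (jr jt f : nat -> nat) (k : nat) : nat -> nat * nat :=
  if k is k'.+1 then
    trans (a - psum jr k) (jr k') (jt k') (f k') (cstate a jr jt f k')
  else fun=> (0, 0).

Section CState.
Variables (a : nat) (jr jt : nat -> nat).
Local Notation cs := (cstate a jr jt).

Lemma eq_cstate f g k : (forall c, c < k -> f c = g c) -> cs f k =1 cs g k.
Proof.
elim: k => //= k IH h i; rewrite /trans h // IH // => c hc; apply: h; lia.
Qed.

Lemma canon_fst L p : (canon L p).1 <= p.1.
Proof. by rewrite /canon; case: ifP. Qed.

Lemma canon_snd L p : (canon L p).2 = p.2.
Proof. by rewrite /canon; case: ifP. Qed.

Lemma cstate_le f k i :
  (cs f k i).1 <= psum jr k /\ (cs f k i).2 <= psum jr k + psum jt k.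
Proof.
elim: k => //= k [IH1 IH2]; rewrite /trans !psumS.
set p := if _ then _ else _.
have := canon_fst (a - (psum jr k + jr k)) p; rewrite canon_snd /p.
by case: eqP => _ /=; lia.
Qed.

Lemma cstate_small M m f k : psum jr k + psum jt k < M -> small M m (cs f k).
Proof. by move=> h i _; have := cstate_le f k i; lia. Qed.

Lemma code_eq M m v w : (forall i, i < m -> v i = w i) -> code M m v = code M m w.
Proof. by move=> h; apply: eq_bigr => i _; rewrite h. Qed.

End CState.

Definition decode (M key i : nat) : nat * nat :=
  let d := (key %/ (M * M) ^ i) %% (M * M) in (d %% M, d %/ M).

Lemma decode_code M m v i : small M m v -> i < m -> decode M (code M m v) i = v i.
Proof.
move=> hv hi; rewrite /decode code_digit //; have [h1 h2] := hv _ hi.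
by rewrite enc_mod // enc_div //; case: (v i).
Qed.

(** The parent pointers from [x] spell the assignment backwards, from job [k - 1] to job 0. [P]
    confines the visited nodes to addresses below the free end, so that later layers, which write
    above it, leave the trace intact. *)
Fixpoint trace (h : nat -> nat) (P : nat -> Prop) (k x : nat) (f : nat -> nat) : Prop :=
  P x /\ if k is k'.+1 then h (x + 3) = f k' /\ trace h P k' (h (x + 2)) f else True.

Lemma trace_frame h h' (P P' : nat -> Prop) k x f :
  (forall y, P y -> [/\ P' y, h' (y + 2) = h (y + 2) & h' (y + 3) = h (y + 3)]) ->
  trace h P k x f -> trace h' P' k x f.
Proof.
move=> hh; elim: k x => [|k IH] x /= [Px hx]; have [P'x e2 e3] := hh _ Px; split=> //.
by case: hx => h1 h2; rewrite e2 e3; split=> //; apply: IH.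
Qed.

Lemma trace_eq h P k x f g : (forall c, c < k -> f c = g c) -> trace h P k x f -> trace h P k x g.
Proof.
elim: k x => //= k IH x hfg [Px [h1 h2]]; split=> //; rewrite -hfg //; split=> //.
by apply: IH h2 => c hc; apply: hfg; lia.
Qed.

Definition layer : cmd :=
  (Op Add 29 27 27;; Op Add 29 29 29;; Op Add 29 29 7;; Op Add 29 29 2;; Fetch 29 29;;
   Op Add 29 29 29;; Op Add 29 29 29;; Op Add 29 29 7);;
  (Fetch 32 29;; Op Add 29 29 1;; Fetch 33 29;; Op Defs.Sub 22 22 32);;
  expand;; radix;; dedupe.

Section Layer.
Variables (W A m n a N M jb hb nb : nat) (jr jt ord : nat -> nat).
Local Notation P := (psum jr).
Local Notation T := (psum jt).
Local Notation cs := (cstate a jr jt).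
Hypothesis hM1 : 1 < M.
Hypothesis hM : P n + T n < M.
Hypothesis ha : a = P n.
Hypothesis hW : (M * M) ^ m < W.
Hypothesis hW2 : 4 * M < W.
Hypothesis hAW : A < W.
Hypothesis hm : 0 < m.
Hypothesis hnb : nb = hb + M.
Hypothesis hjb : jb + 4 * n <= hb.
Hypothesis hA : nb + 4 * (1 + n * (N * m)) <= A.
Hypothesis hord : forall k, k < n -> ord k < n.

Definition fok (f : nat -> nat) := forall c, f c < m.

Hypothesis hcap : forall k (l : seq nat), k <= n -> uniq l ->
  (forall key, key \in l -> exists2 f, fok f & key = code M m (cs f k)) -> size l <= N.

Definition dp_env s := [/\ reg s 0 = 0, reg s 1 = 1, reg s 2 = 2 & reg s 4 = 4] /\
  [/\ reg s 5 = m, reg s 6 = n, reg s 7 = jb & reg s 9 = hb] /\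
  [/\ reg s 13 = M, reg s 14 = M * M & reg s 15 = 2 * m] /\
  (forall k, k < n -> [/\ cell s (jb + 4 * k + 2) = ord k,
     cell s (jb + 4 * ord k) = jr k & cell s (jb + 4 * ord k + 1) = jt k]).

(** Every node is realised by an assignment that its parent pointers spell, whereas an assignment is
    only guaranteed a node with the same code. That is what survives the removal of duplicates, and
    it suffices because the transition depends on nothing but the coded state. *)
Definition layer_inv (s0 : state) (k : nat) (s : state) : Prop :=
  (forall x, x < 20 -> reg s x = reg s0 x) /\
  (forall x, x < hb -> cell s x = cell s0 x) /\
  (forall v, v < M -> cell s (hb + v) = 0) /\
  reg s 22 = a - P k /\
  exists fr l, [/\ reg s 20 = fr, nb + 4 <= fr, fr <= nb + 4 * (1 + k * (N * m)) /\
     (exists j, fr = nb + 4 * j),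
     chain (cell s) (reg s 21) l &
     [/\ uniq [seq cell s (x + 1) | x <- l],
       forall x, x \in l -> exists f, [/\ fok f, cell s (x + 1) = code M m (cs f k) &
          trace (cell s) (isnode nb fr) k x f] &
       forall f, fok f -> exists2 x, x \in l & cell s (x + 1) = code M m (cs f k)]].

Definition layer_time := N * (m * (m * 30 + 20) + 20) +
  2 * m * (17 * (N * m) + 12 * M + 9) + 13 * (N * m) + 21.

Lemma cs_small k f : k <= n -> small M m (cs f k).
Proof.
move=> hk; apply: cstate_small.
have h1 := @psum_le jr _ _ hk; have h2 := @psum_le jt _ _ hk.
by clear -h1 h2 hM; lia.
Qed.

Lemma layer_spec s0 k s : dp_env s0 -> k < n -> layer_inv s0 k s -> reg s 27 = k ->
  wp W A layer s layer_time (fun s' => layer_inv s0 k.+1 s' /\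
    forall x, 26 < x -> x < 29 -> reg s' x = reg s x).
Proof.
move=> [[r0 r1 r2 r4] [[r5 r6 r7 r9] [[r13 r14 r15] hjobs]]] hk.
move=> [hr [hc [hz [r22 [fr [l [r20 hfr [hfrA [jfr hjfr]] cl [ul sound compl]]]]]]]] r27.
have [o1 o2 o3] := hjobs _ hk; have ho := hord hk.
have P1 := psumS jr k; have T1 := psumS jt k.
have P2 := @psum_le jr _ _ hk; have T2 := @psum_le jt _ _ hk.
have hszl : size l <= N.
  have := hcap (ltnW hk) ul; rewrite size_map; apply=> key /mapP [x xl ->].
  by have [f [f1 f2 f3]] := sound _ xl; exists f.
have hnodes : fr + 4 * (N * m) <= A.
  apply: leq_trans hA; have : k.+1 * (N * m) <= n * (N * m) by rewrite leq_mul2r hk orbT.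
  by rewrite mulSn; clear -hfrA; lia.
have hjA : jb + 4 * n <= A by clear -hjb hnb hA; lia.
have jn : jb + 4 * k + 4 <= jb + 4 * n by clear -hk; lia.
have jo : jb + 4 * ord k + 4 <= jb + 4 * n by clear -ho; lia.
rewrite /layer_time.
apply: (wp_seq (T1 := 8) (T2 := N * (m * (m * 30 + 20) + 20) +
  2 * m * (17 * (N * m) + 12 * M + 9) + 13 * (N * m) + 13)); first by clear; lia.
apply: wp_sl => //=.
rewrite !(hr 7) // !(hr 2) // r27 r7 r2.
have -> : k + k + (k + k) + jb + 2 = jb + 4 * k + 2 by clear; lia.
rewrite hc; last by clear -jn hjb; lia.
rewrite o1.
have -> : ord k + ord k + (ord k + ord k) + jb = jb + 4 * ord k by clear; lia.
do 8 (split; first by clear -jn jo hjA hAW; lia).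
apply: (wp_seq (T1 := 4) (T2 := N * (m * (m * 30 + 20) + 20) +
  2 * m * (17 * (N * m) + 12 * M + 9) + 13 * (N * m) + 9)); first by clear; lia.
apply: wp_sl => //=.
rewrite !(hr 1) // r1 !hc; try by clear -jo hjb; lia.
rewrite o2 o3 r22.
do 3 (split; first by clear -jn jo hjA hAW; lia).
split=> //.
have -> : a - P k - jr k = a - P k.+1 by rewrite P1 subnDA.
set s1 := set_reg _ _ _.
have q22 : reg s1 22 = a - P k.+1 by [].
have [q32 q33] : reg s1 32 = jr k /\ reg s1 33 = jt k by [].
have qr x : x < 29 -> x != 22 -> reg s1 x = reg s x by move=> x1 x2 /=; skip_reg.
have qc : cell s1 = cell s by [].
clearbody s1.
have q x : x < 20 -> reg s1 x = reg s0 x.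
  by move=> hx; rewrite qr ?hr //; clear -hx; lia.
pose V x := decode M (cell s (x + 1)).
have hVf x : x \in l -> exists f, [/\ fok f, forall i, i < m -> V x i = cs f k i &
    trace (cell s) (isnode nb fr) k x f].
  move=> /sound [f [f1 f2 f3]]; exists f; split=> // i hi.
  by rewrite /V f2 decode_code //; apply: cs_small; apply: ltnW.
(* Redefining [f] at [k] does not touch the state after the first [k] jobs, so a child of a node
   realised by [f] is realised by the redefined function. *)
have hext f x i : (forall i, i < m -> V x i = cs f k i) -> i < m ->
    forall i', i' < m -> trans (a - P k.+1) (jr k) (jt k) i (V x) i' =
      cs (fun c => if c == k then i else f c) k.+1 i'.
  move=> hf hi i' hi'; rewrite /= /trans eqxx.
  have e : cs (fun c => if c == k then i else f c) k =1 cs f k.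
    by apply: eq_cstate => c hck; case: eqP => // ec; move: hck; rewrite ec ltnn.
  by rewrite hf // e.
have nodel x : x \in l -> isnode nb fr x.
  by move=> /sound [f [_ _]]; case: (k) => [|k'] [].
have hl1 x : x \in l -> x + 4 <= fr /\ cell s1 (x + 1) = code M m (V x).
  move=> xl; split; first by have [j] := nodel _ xl.
  have [f [f1 f2 f3]] := sound _ xl; have [f' [_ g2 _]] := hVf _ xl.
  rewrite qc f2; apply: code_eq => i hi; rewrite /V f2 decode_code //.
  by apply: cs_small; apply: ltnW.
have hl2 x : x \in l -> small M m (V x) /\ forall i, i < m ->
    [/\ small M m (trans (a - P k.+1) (jr k) (jt k) i (V x)), (V x i).1 + jr k < M &
       maxn (V x i).2 ((V x i).1 + jr k) + jt k < M].
  move=> xl; have [f [f1 f2 f3]] := hVf _ xl; split.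
    by move=> i hi; rewrite f2 //; apply: cs_small hi; apply: ltnW.
  move=> i hi; split.
  - by move=> i' hi'; rewrite (hext f) //; apply: cs_small hi'.
  - rewrite f2 //; have [h1 h2] := cstate_le a jr jt f k i.
    by clear -h1 h2 P1 T1 P2 T2 hM; lia.
  - rewrite f2 //; have [h1 h2] := cstate_le a jr jt f k i.
    by clear -h1 h2 P1 T1 P2 T2 hM; lia.
have hszA : fr + 4 * (size l * m) <= A.
  by apply: leq_trans hnodes; rewrite leq_add2l leq_mul2l leq_mul2r hszl orbT.
have rM : jr k < M by clear -P1 P2 hM; lia.
have tM : jt k < M by clear -T1 T2 hM; lia.
have LM : a - P k.+1 < M by rewrite ha; clear -hM; lia.
have fr0 : 0 < fr by clear -hfr; lia.
have R1 : [/\ reg s1 0 = 0, reg s1 1 = 1, reg s1 4 = 4 & reg s1 5 = m] by rewrite !q.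
have R2 : [/\ reg s1 13 = M, reg s1 14 = M * M, reg s1 20 = fr & reg s1 22 = a - P k.+1].
  by rewrite (q 13) // (q 14) // (qr 20).
have cl1 : chain (cell s1) (reg s1 21) l by rewrite qc qr.
have E := expand_spec hM1 hW hW2 hAW rM tM LM hm fr0 R1 R2 (conj q32 q33) cl1 hl1 hl2 hszA.
set ps := [seq _ | _ <- _, _ <- _] in E.
have sps : size ps = size l * m by rewrite size_allpairs size_iota.
have spsN : size ps <= N * m by rewrite sps leq_mul2r hszl orbT.
apply: (wp_seq (T1 := N * (m * (m * 30 + 20) + 20) + 3) (T2 :=
  2 * m * (17 * (N * m) + 12 * M + 9) + 13 * (N * m) + 6)); first by clear; lia.
apply: (wp_le (T' := size l * (m * (m * 30 + 20) + 20) + 3)).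
  by rewrite leq_add2r leq_mul2r hszl orbT.
apply: wp_conseq E => s2 [e20 ch2 hch hx2 hr2].
set l2 := node_seq _ _ in ch2.
have hl2' x : x \in l2 -> exists2 j, j < size ps & x = fr + 4 * j by apply: mem_node_seq.
have ul2 : uniq l2 by apply: uniq_node_seq.
set fr' := fr + 4 * size ps in e20.
have hfr'A : fr' <= A by rewrite /fr' sps.
have node2 B x : fr' <= B -> x \in l2 -> isnode nb B x.
  move=> hB /hl2' [j hj ->]; exists (jfr + j); first by rewrite hjfr mulnDr addnA.
  by move: hB; rewrite /fr'; clear -hj; lia.
have child2 j : j < size ps -> exists p i f, [/\ p \in l, i < m, fok f &
    [/\ cell s2 (fr + 4 * j + 2) = p, cell s2 (fr + 4 * j + 3) = i,
      cell s2 (fr + 4 * j + 1) = code M m (cs (fun c => if c == k then i else f c) k.+1) &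
      trace (cell s) (isnode nb fr) k p f]].
  move=> hj; have [c1 c2 c3] := hch _ hj.
  have := mem_nth (0, 0) hj; case/allpairsP => [[p i] /= [pl]]; rewrite mem_iota => hi e.
  rewrite e /= in c1 c2 c3.
  have [f [f1 f2 f3]] := hVf _ pl; exists p, i, f; split=> //; split=> //.
  by rewrite c1; apply: code_eq => i' hi'; apply: hext.
have fok_upd f i : fok f -> i < m -> fok (fun c => if c == k then i else f c).
  by move=> hf hi c; case: eqP.
have key2 x : x \in l2 -> cell s2 (x + 1) < M ^ (2 * m).
  move=> /hl2' [j hj ->]; have [p [i [f [_ hi hf [_ _ -> _]]]]] := child2 _ hj.
  by rewrite expnM -mulnn; apply: code_lt; apply: cs_small.
have nb0 : 0 < nb by clear -hnb hM1; lia.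
have hnbA : nb <= A by clear -hA; lia.
have M0 : 0 < M by clear -hM1; lia.
have hbnb : hb + M <= nb by rewrite hnb.
have ok2 : regs_ok hb M s2 by split; rewrite hr2 // q.
have r15' : reg s2 15 = 2 * m by rewrite hr2 // q.
have hz2 v : v < M -> cell s2 (hb + v) = 0.
  by move=> hv; rewrite hx2 ?qc ?hz //; clear -hv hbnb hfr; lia.
have hW' : M ^ (2 * m) < W by rewrite expnM -mulnn.
have Rd := radix_spec M0 hbnb nb0 hAW hnbA ok2 r15' ul2 (node2 A ^~ hfr'A) ch2 hz2 key2 hW'.
have szl2 : size l2 = size ps by rewrite size_node_seq.
apply: (wp_seq (T1 := 2 * m * (17 * (N * m) + 12 * M + 9) + 4) (T2 := 13 * (N * m) + 2)).
  by clear; lia.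
apply: (wp_le (T' := 2 * m * (17 * size l2 + 12 * M + 9) + 4)).
  by rewrite szl2 leq_add2r leq_mul2l !leq_add2r leq_mul2l spsN !orbT.
apply: wp_conseq Rd => s3 [hr3 [l3 [ch3 pl3 sl3 hx3]]].
have key3 x : x \in l2 -> cell s3 (x + 1) = cell s2 (x + 1).
  move=> /hl2' [j hj ->]; apply: hx3; apply/negP => /hl2' [j' hj' e].
  by clear -e; lia.
have node3 x : x \in l3 -> isnode nb A x by rewrite (perm_mem pl3); apply: node2.
have ul3 : uniq l3 by rewrite (perm_uniq pl3).
have sl3' : pairwise (fun x y => cell s3 (x + 1) <= cell s3 (y + 1)) l3.
  apply: (sub_in_pairwise (P := mem l3)) sl3; last exact: allss.
  by move=> x y; rewrite !(perm_mem pl3) => hx hy; rewrite !key3.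
have D := dedupe_spec nb0 hAW hnbA (_ : reg s3 0 = 0) (_ : reg s3 1 = 1) ul3 node3 ch3 sl3'.
apply: (wp_le (T' := 13 * size l3 + 2)).
  by rewrite (perm_size pl3) szl2 leq_add2r leq_mul2l spsN !orbT.
apply: wp_conseq (D _ _); try by rewrite hr3 // hr2 // q.
move=> s4 [hr4 [l4 [ch4 sub4 ul4 cov4 hx4]]].
have hx24 x : x \notin l2 -> cell s4 x = cell s2 x.
  by move=> hx; rewrite hx4 ?hx3 // (perm_mem pl3).
have key4 x : x \in l2 -> cell s4 (x + 1) = cell s2 (x + 1).
  move=> /hl2' [j hj ->]; apply: hx24; apply/negP => /hl2' [j' hj' e].
  by clear -e; lia.
have low4 x : x < fr -> cell s4 x = cell s x.
  move=> hx; rewrite hx24 ?hx2 ?qc //; apply/negP => /hl2' [j' hj' e].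
  by clear -e hx; lia.
have hr' x : x < 29 -> x != 20 -> x != 21 -> x != 22 -> x != 24 -> x != 25 -> reg s4 x = reg s x.
  move=> x1 x2 x3 x4 x5 x6; rewrite hr4 ?hr3 ?hr2 ?qr //; clear -x1; lia.
have sub42 x : x \in l4 -> x \in l2 by move=> /sub4; rewrite (perm_mem pl3).
split; last by move=> x x1 x2; apply: hr'; clear -x1 x2; lia.
split; first by move=> x hx; rewrite hr' ?hr //; clear -hx; lia.
split; first by move=> x hx; rewrite low4 ?hc //; clear -hx hbnb hfr; lia.
split; first by move=> v hv; rewrite low4 ?hz //; clear -hv hbnb hfr; lia.
split; first by rewrite hr4 // hr3 // hr2.
exists fr', l4; split=> //.
- by rewrite hr4 // hr3.
- by rewrite /fr'; clear -hfr; lia.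
- split; first by rewrite /fr' mulSn; clear -hfrA spsN; lia.
  by exists (jfr + size ps); rewrite /fr' hjfr mulnDr addnA.
split.
- have <- : [seq cell s3 (x + 1) | x <- l4] = [seq cell s4 (x + 1) | x <- l4].
    by apply/eq_in_map => x /sub42 xl; rewrite key4 ?key3.
  exact: ul4.
- move=> x /sub42 /[dup] x2 /hl2' [j hj ex].
  have [p [i [f [pl hi hf [c2 c3 c1 tr]]]]] := child2 _ hj.
  exists (fun c => if c == k then i else f c); split.
  + exact: fok_upd.
  + by rewrite key4 // ex.
  split; first exact: node2.
  rewrite !hx24; try by rewrite ex; apply/negP => /hl2' [j' hj' e]; clear -e; lia.
  rewrite eqxx ex c2 c3; split=> //.
  apply: (trace_eq (f := f)).
    by move=> c hck; case: eqP => // ec; move: hck; rewrite ec ltnn.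
  apply: trace_frame tr => y [jy ey hy]; rewrite !low4; try by clear -hy; lia.
  by split=> //; exists jy => //; rewrite /fr'; clear -hy; lia.
(* Completeness: a node with the code of [f] after [k] jobs has the child for shop [f k], and
   [dedupe] keeps some node with the code of this child. *)
- move=> f hf; have [p pl hp] := compl f hf.
  have hps : (p, f k) \in ps.
    by apply: allpairs_f => //; rewrite mem_iota /= hf.
  have hj : index (p, f k) ps < size ps by rewrite index_mem.
  have [c1 c2 c3] := hch _ hj; rewrite nth_index // /= in c1.
  have hx2' : fr + 4 * index (p, f k) ps \in l2 by apply: mem_node_seqI.
  have [y yl4 ey] := cov4 _ (etrans (perm_mem pl3 _) hx2').
  exists y => //; rewrite key4 ?sub42 // -key3 ?sub42 // ey key3 // c1.
  apply: code_eq => i hi; rewrite /= /trans /V hp decode_code //.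
  by apply: cs_small; apply: ltnW.
Qed.

End Layer.

(** * Choosing a best final state and tracing it back *)

Definition select_best : cmd :=
  (Const 23 0;; Const 24 0;; Op Add 25 21 0);;
  While 25 (
    (Op Add 30 25 1;; Fetch 52 30;; Const 50 0);;
    For 53 5 54 (
      Op Mod 55 52 14;; Op Div 52 52 14;; Op Div 55 55 13;; Op Defs.Sub 55 55 50;;
      Op Add 50 50 55);;
    (Const 31 1;; If 23 (Op Defs.Sub 31 24 50) Skip;;
     If 31 (Op Add 23 25 0;; Op Add 24 50 0) Skip);;
    Fetch 25 25).

Definition backtrack : cmd :=
  Op Add 25 23 0;;
  For 27 6 28 (
    (Op Defs.Sub 29 6 27;; Op Defs.Sub 29 29 1;; Op Add 29 29 29;; Op Add 29 29 29;;
     Op Add 29 29 7;; Op Add 29 29 3);;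
    (Op Add 30 25 3;; Fetch 31 30;; Store 29 31;; Op Add 30 25 2;; Fetch 25 30)).

Definition last_end (m : nat) (v : nat -> nat * nat) : nat := \max_(i < m) (v i).2.

Section Best.
Variables (W A M m : nat).
Hypothesis hW : (M * M) ^ m < W.
Hypothesis hAW : A < W.
Hypothesis hMW : M < W.
Hypothesis hM : 1 < M.

Lemma last_end_lt v : small M m v -> last_end m v < M.
Proof.
move=> hv; apply: leq_ltn_trans (_ : M.-1 < M); last by lia.
by apply/bigmax_leqP => i _; have [_] := hv _ (ltn_ord i); lia.
Qed.

(** Register 23 being zero means that no node has been chosen yet, which is unambiguous since node
    addresses are nonzero. *)
Lemma select_best_spec s0 l (V : nat -> nat -> nat * nat) :
  [/\ reg s0 0 = 0, reg s0 1 = 1 & reg s0 5 = m] ->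
  reg s0 13 = M -> reg s0 14 = M * M ->
  chain (cell s0) (reg s0 21) l ->
  (forall x, x \in l -> [/\ x + 4 <= A, cell s0 (x + 1) = code M m (V x) & small M m (V x)]) ->
  wp W A select_best s0 (size l * (m * 10 + 20) + 4) (fun s =>
   [/\ forall x, x < 23 -> reg s x = reg s0 x, cell s = cell s0,
    (reg s 23 == 0) = (l == [::]) &
    l != [::] -> reg s 23 \in l /\ forall y, y \in l -> last_end m (V (reg s 23)) <= last_end m (V y)]).
Proof.
move=> [r0 r1 r5] r13 r14 cl hl; apply: wp_bounded => bs0.
have b21 := proj1 bs0 21.
have W1 : 1 < W by have := proj1 bs0 1; rewrite r1.
apply: (wp_seq (T1 := 3) (T2 := size l * (m * 10 + 20) + 1)); first by clear; lia.
apply: wp_sl => //=; rewrite r0 addn0.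
do 3 (split; first by clear -W1 b21; lia).
pose I T s := exists l1 l2, [/\ l = l1 ++ l2, T = size l2 * (m * 10 + 20) + 1,
   chain (cell s0) (reg s 25) l2,
   (forall x, x < 23 -> reg s x = reg s0 x) /\ cell s = cell s0 &
   (reg s 23 == 0) = (l1 == [::]) /\
   (l1 != [::] -> [/\ reg s 23 \in l1, reg s 24 = last_end m (V (reg s 23)) &
    forall y, y \in l1 -> reg s 24 <= last_end m (V y)])].
apply: (@wp_while _ _ I).
- move=> T s [l1 [l2 [e -> c2 [hr hc] [h1 h2]]]] h25; split; first by clear; lia.
  have := chain_zero c2; rewrite h25 eqxx => /esym/eqP e2; subst l2.
  rewrite cats0 in e; subst l1; split=> // hne; have [g1 g2 g3] := h2 hne.
  by split=> // y yl; rewrite -g2 g3.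
- move=> T s [l1 [l2 [e -> c2 [hr hc] [h1 h2]]]] h25.
  have := chain_zero c2; rewrite (negbTE h25); case: l2 e c2 => // x l2 e [ex x0 c2] _.
  have xl : x \in l by rewrite e mem_cat inE eqxx orbT.
  have [xA xk xV] := hl _ xl.
  exists (m * 10 + 15), (size l2 * (m * 10 + 20) + 1); split.
    by rewrite /= mulSn; clear; lia.
  apply: (wp_seq (T1 := 3) (T2 := m * 10 + 12)); first by clear; lia.
  apply: wp_sl => //=.
  rewrite (hr 1) // r1 ex hc xk.
  do 3 (split; first by clear -xA hAW W1; lia).
  apply: (wp_seq (T1 := m * 10 + 5) (T2 := 7)); first by clear; lia.
  pose K k s' := [/\ forall x, x < 30 -> reg s' x = reg s x, cell s' = cell s0,
     reg s' 50 = last_end k (V x) & reg s' 52 = code M m (V x) %/ (M * M) ^ k].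
  apply: (@wp_for _ _ K m 5) => //.
  + by rewrite /= hr.
  + by rewrite /= hr.
  + move=> k s' hk [q1 q2 q3 q4] e53 _ _.
    have [v1 v2] := xV _ hk.
    apply: wp_sl => //=.
    rewrite !(q1 14) // !(q1 13) // (hr 14) // (hr 13) // r13 r14 q4 code_digit // enc_div // q3.
    have hsp : last_end k (V x) + ((V x k).2 - last_end k (V x)) = last_end k.+1 (V x).
      by rewrite {3}/last_end big_ord_recr /= -/(last_end k (V x)); clear; lia.
    do 4 (split=> //); rewrite hsp; split.
      apply: leq_ltn_trans hMW; apply: ltnW; apply: leq_ltn_trans (last_end_lt xV).
      apply/bigmax_leqP => i _; have hi : i < m := leq_trans (ltn_ord i) hk.
      exact: (leq_bigmax (Ordinal hi)).
    rewrite !(q1 5) // !(q1 1) // (hr 5) // (hr 1) //.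
    split=> //; split=> //=; first by move=> y hy; skip_reg; apply: q1.
    by rewrite -divnMA -expnSr.
  + split=> //=; first by move=> y hy; skip_reg.
      by rewrite /last_end big_ord0.
    by rewrite expn0 divn1.
  + move=> s' [q1 q2 q3 q4].
    apply: (wp_seq (T1 := 6) (T2 := 1)) => //.
    pose B x' b s'' := [/\ forall x, x < 23 -> reg s'' x = reg s0 x, cell s'' = cell s0,
      reg s'' 25 = x, reg s'' 23 = x' & reg s'' 24 = b].
    apply: (wp_conseq (Q' := fun s'' => exists x', B x' (last_end m (V x')) s'' /\
      x' \in rcons l1 x /\ forall y, y \in rcons l1 x -> last_end m (V x') <= last_end m (V y))).
      move=> s2 [x' [[p1 p2 p3 p4 p5] [p6 p7]]].
      apply: wp_sl => //=; rewrite p3; split; first by clear -xA; lia.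
      have x'0 : x' != 0.
        have : x' \in l by move: p6; rewrite e -cat_rcons mem_cat => ->.
        by elim: (l) (reg s0 21) cl => //= z t IH p [_ z0 ct]; rewrite inE =>
          /orP [/eqP ->//|]; apply: IH ct.
      exists (rcons l1 x), l2; split=> //.
      * by rewrite cat_rcons.
      * by rewrite /= p2.
      * by split=> //= y hy; skip_reg; apply: p1.
      split=> /=; first by rewrite p4 (negbTE x'0); case: (l1).
      by move=> _; rewrite p4 p5.
    have hfin x' b s'' : (forall y, y < 23 -> reg s'' y = reg s' y) -> cell s'' = cell s' ->
      reg s'' 25 = reg s' 25 -> reg s'' 23 = x' -> reg s'' 24 = b -> B x' b s''.
      move=> t1 t2 t3 t4 t5; split=> //; rewrite ?t2 ?t3 ?q1 //.
      by move=> y hy; rewrite t1 // q1 ?hr //; clear -hy; lia.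
    have bx : last_end m (V x) < W by apply: ltn_trans hMW; apply: last_end_lt.
    apply: wp_sl => //=.
    rewrite (q1 23) // (q1 24) // (q1 0) // (q1 25) // (hr 0) // r0 ex q3 !addn0.
    split=> //; split=> h23.
      have hl1 : l1 != [::] by move: h1; rewrite (negbTE h23) => <-.
      have [g1 g2 g3] := h2 hl1.
      split=> //; split=> hlt.
        do 2 (split; first by clear -xA hAW bx; lia).
        exists x; split; [apply: hfin => //= y hy; skip_reg|]; rewrite // mem_rcons inE eqxx.
        split=> // y; rewrite mem_rcons inE => /orP [/eqP ->//|/g3 hy].
        by apply: leq_trans hy; clear -hlt; lia.
      exists (reg s 23); split; [apply: hfin => //=|].
      * by move=> y hy; skip_reg.
      * by rewrite q1.
      * by rewrite q1.
      rewrite mem_rcons inE g1 orbT; split=> // y; rewrite mem_rcons inE => /orP [/eqP ->|/g3].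
        by rewrite -g2; clear -hlt; lia.
      by rewrite g2.
    have hl1 : l1 = [::] by apply/eqP; rewrite -h1 h23.
    split=> // _; do 2 (split; first by clear -xA hAW bx; lia).
    exists x; split; [apply: hfin => //= y hy; skip_reg|]; rewrite // mem_rcons inE eqxx.
    by rewrite hl1; split=> // y; rewrite inE => /eqP ->.
  + by clear; lia.
- exists [::], l; split=> //=.
  by split=> // x hx; skip_reg.
Qed.
End Best.

(** * The dynamic program assembled *)

Definition dp : cmd :=
  (Op Add 20 9 13;; Op Add 21 20 0;; Op Add 20 20 4;; Op Add 22 10 0);;
  For 27 6 28 layer;;
  select_best;;
  backtrack.

Section DP.
Variables (W A m n a N M jb hb nb : nat) (jr jt ord : nat -> nat).
Local Notation P := (psum jr).
Local Notation T := (psum jt).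
Local Notation cs := (cstate a jr jt).
Hypothesis hM1 : 1 < M.
Hypothesis hM : P n + T n < M.
Hypothesis ha : a = P n.
Hypothesis hW : (M * M) ^ m < W.
Hypothesis hW2 : 4 * M < W.
Hypothesis hAW : A < W.
Hypothesis hm : 0 < m.
Hypothesis hnb : nb = hb + M.
Hypothesis hjb : jb + 4 * n <= hb.
Hypothesis hA : nb + 4 * (1 + n * (N * m)) <= A.
Hypothesis hord : forall k, k < n -> ord k < n.
Hypothesis hcap : forall k (l : seq nat), k <= n -> uniq l ->
  (forall key, key \in l -> exists2 f, fok m f & key = code M m (cs f k)) -> size l <= N.

(** The shops are written into the job records, which lie below [hb], while all nodes lie from [nb]
    on; so the writing does not disturb the trace being followed. *)
Lemma backtrack_spec s0 fr f :
  [/\ reg s0 0 = 0, reg s0 1 = 1, reg s0 2 = 2 & reg s0 3 = 3] ->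
  reg s0 6 = n -> reg s0 7 = jb -> fr <= A ->
  trace (cell s0) (isnode nb fr) n (reg s0 23) f ->
  wp W A backtrack s0 (n * 15 + 4) (fun s =>
   [/\ forall x, x < 20 -> reg s x = reg s0 x,
     forall k, k < n -> cell s (jb + 4 * k + 3) = f k &
     forall x, x < hb -> (forall k, k < n -> x != jb + 4 * k + 3) -> cell s x = cell s0 x]).
Proof.
move=> [r0 r1 r2 r3] r6 r7 hfr tr; apply: wp_bounded => bs0.
have b23 := proj1 bs0 23.
apply: (wp_seq (T1 := 1) (T2 := n * 15 + 3)); first by clear; lia.
apply: wp_sl => //=; rewrite r0 addn0; split=> //.
pose I k s := [/\ forall x, x < 20 -> reg s x = reg s0 x,
  trace (cell s) (isnode nb fr) (n - k) (reg s 25) f,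
  forall c, n - k <= c < n -> cell s (jb + 4 * c + 3) = f c &
  forall x, x < hb -> (forall k, k < n -> x != jb + 4 * k + 3) -> cell s x = cell s0 x].
apply: (@wp_for _ _ I n 11) => //.
- move=> k s hk [hr ht hf hc] e27 e6 e1.
  apply: (wp_seq (T1 := 6) (T2 := 5)) => //.
  apply: wp_sl => //=.
  rewrite (hr 6) // (hr 1) // (hr 7) // (hr 3) // r6 r1 r7 r3 e27.
  set c := n - k.+1.
  have -> : n - k - 1 = c by rewrite /c; clear; lia.
  have hcn : c < n by rewrite /c; clear -hk; lia.
  do 6 (split; first by clear -hcn hjb hAW hA hnb; lia).
  have eA : c + c + (c + c) + jb + 3 = jb + 4 * c + 3 by clear; lia.
  have ht' : trace (cell s) (isnode nb fr) c.+1 (reg s 25) f.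
    by move: ht; have -> : n - k = c.+1 by rewrite /c; clear -hk; lia.
  case: ht' => [[j ej hj] [t1 t2]].
  apply: wp_sl => //=.
  rewrite (hr 3) // (hr 2) // r3 r2 eA.
  set x := reg s 25 in ej hj t1 t2 *.
  have q1 : (x + 2 == jb + 4 * c + 3) = false.
    by apply/eqP; clear -ej hcn hjb hnb; lia.
  rewrite q1.
  split; first by clear -hj hfr hAW; lia.
  split; first by clear -hj hfr hAW; lia.
  split; first by clear -hcn hjb hA hnb; lia.
  split; first by clear -hj hfr hAW; lia.
  split; first by clear -hj hfr hAW; lia.
  split=> //; split=> //=.
  + by move=> y hy; skip_reg; apply: hr.
  + apply: trace_frame t2 => y [jy ey hy]; split; first by exists jy.
    * by rewrite /=; case: eqP => // e; clear -e ey hcn hjb hnb; lia.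
    * by rewrite /=; case: eqP => // e; clear -e ey hcn hjb hnb; lia.
  + move=> c' hc'; case: eqP => e; first by have -> : c' = c; [clear -e; lia|].
    by apply: hf; move: hc' e; rewrite /c; clear -hk; lia.
  + move=> y hy hy'; case: eqP => e; last exact: hc.
    by move: (hy' _ hcn); rewrite e eqxx.
- split=> /=; [by move=> x hx; skip_reg|by rewrite subn0| |by []].
  by move=> c; rewrite subn0; clear; lia.
- move=> s [h1 h2 h3 h4]; split=> // k hk; apply: h3.
  by rewrite subnn.
Qed.

(** The root is never written: it is the zero record at [nb], just above the bucket heads. Its link
    0 is null and its code 0 is the code of the state in which all shops are at [(0, 0)]. *)
Lemma dp_spec s0 :
  dp_env m n M jb hb jr jt ord s0 -> reg s0 10 = a -> reg s0 3 = 3 ->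
  (forall x, hb <= x -> cell s0 x = 0) ->
  wp W A dp s0 (n * (layer_time m N M + 19) + N * (m * 10 + 20) + 15) (fun s =>
   [/\ forall x, x < 20 -> reg s x = reg s0 x,
     exists f, [/\ fok m f, forall g, fok m g -> last_end m (cs f n) <= last_end m (cs g n) &
        forall k, k < n -> cell s (jb + 4 * k + 3) = f k] &
     forall x, x < hb -> (forall k, k < n -> x != jb + 4 * k + 3) -> cell s x = cell s0 x]).
Proof.
move=> env r10 r3 hz; have [[r0 r1 r2 r4] [[r5 r6 r7 r9] [[r13 r14 r15] hjobs]]] := env.
apply: (wp_seq (T1 := 4) (T2 := n * (layer_time m N M + 19) + N * (m * 10 + 20) + 11)).
  by clear; lia.
apply: wp_sl => //=; rewrite r0 r4 r9 r13 r10 -hnb !addn0.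
have hnbA : nb + 4 <= A by clear -hA; lia.
do 4 (split; first by clear -hnbA hAW ha hM hW2; lia).
set s1 := set_reg _ _ _.
have q20 : reg s1 20 = nb + 4 by [].
have q21 : reg s1 21 = nb by [].
have q22 : reg s1 22 = a by [].
have q x : x < 20 -> reg s1 x = reg s0 x by move=> hx /=; skip_reg.
have qc : cell s1 = cell s0 by [].
clearbody s1.
apply: (wp_seq (T1 := n * (layer_time m N M + 4) + 3)
  (T2 := n * 15 + N * (m * 10 + 20) + 8)).
  by rewrite !mulnDr; clear; lia.
have last_end_eq u v : (forall i, i < m -> u i = v i) -> last_end m u = last_end m v.
  by move=> h; apply: eq_bigr => i _; rewrite h.
pose J k s := layer_inv m a N M hb nb jr jt s0 k s.
apply: (@wp_for _ _ J n (layer_time m N M)) => //.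
- by rewrite q.
- by rewrite q.
- move=> k s hk hJ e27 e6 e1.
  have LS := layer_spec hM1 hM ha hW hW2 hAW hm hnb hjb hA hord hcap env hk hJ e27.
  apply: wp_conseq LS => s' [[g1 [g2 [g3 [g4 [fr [l [h1 h2 h3 h4 h5]]]]]]] g6].
  rewrite g6 // (g1 6) // (g1 1) // r6 r1; split=> //.
  split; first by move=> x hx /=; skip_reg; apply: g1.
  split=> //; split=> //; split=> //.
  by exists fr, l; split.
- split; first by move=> x hx /=; skip_reg; apply: q.
  split; first by move=> x hx; rewrite /= qc.
  split; first by move=> v hv; rewrite /= qc hz // leq_addr.
  split; first by rewrite /= q22 /psum big_ord0 subn0.
  exists (nb + 4), [:: nb]; split=> //=.
  + by split; [rewrite mul0n|exists 1].
  + split=> //; first by clear -hnb hM1; lia.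
    by rewrite qc hz //; clear -hnb; lia.
  have c0 f : code M m (cs f 0) = 0.
    by rewrite /code big1 // => i _; rewrite /= /enc.
  have z1 : cell s1 (nb + 1) = 0 by rewrite qc hz //; clear -hnb; lia.
  split=> //.
  + move=> x; rewrite inE => /eqP ->; exists (fun=> 0); split=> //; first by rewrite z1 c0.
    by split=> //; exists 0; rewrite ?addn0.
  + by move=> f hf; exists nb; rewrite ?inE // z1 c0.
move=> s2 [g1 [g2 [g3 [g4 [fr [l [h1 h2 [h3 _] h4 [h5 h6 h7]]]]]]]].
have hszl : size l <= N.
  have := hcap (leqnn n) h5; rewrite size_map; apply=> key /mapP [x xl ->].
  by have [f [f1 f2 f3]] := h6 _ xl; exists f.
have sm f : small M m (cs f n) by apply: cstate_small.
pose V x := decode M (cell s2 (x + 1)).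
have hV x : x \in l -> exists f, [/\ fok m f, cell s2 (x + 1) = code M m (cs f n),
    trace (cell s2) (isnode nb fr) n x f & forall i, i < m -> V x i = cs f n i].
  move=> /h6 [f [f1 f2 f3]]; exists f; split=> // i hi.
  by rewrite /V f2 decode_code.
have frA : fr <= A by apply: leq_trans hA.
have nodel x : x \in l -> x + 4 <= fr.
  by move=> /h6 [f [_ _]]; case: (n) => [|k'] [] [].
have SB := @select_best_spec W A M m hW hAW.
have hl x : x \in l -> [/\ x + 4 <= A, cell s2 (x + 1) = code M m (V x) & small M m (V x)].
  move=> xl; have [f [f1 f2 f3 f4]] := hV _ xl; split.
  - by apply: leq_trans frA; apply: nodel.
  - by rewrite f2; apply: code_eq => i hi; rewrite f4.
  - by move=> i hi; rewrite f4 //; apply: sm hi.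
have hMW : M < W by clear -hW2 hM1; lia.
have {}SB := SB hMW hM1 s2 l V.
apply: (wp_seq (T1 := N * (m * 10 + 20) + 4) (T2 := n * 15 + 4)); first by clear; lia.
apply: (wp_le (T' := size l * (m * 10 + 20) + 4)).
  by rewrite leq_add2r leq_mul2r hszl orbT.
have R5 : [/\ reg s2 0 = 0, reg s2 1 = 1 & reg s2 5 = m] by rewrite !g1.
apply: wp_conseq (SB R5 _ _ h4 hl); try by rewrite g1.
move=> s3 [k1 k2 k3 k4].
have lne : l != [::].
  by have [x xl _] := h7 (fun=> 0) (fun=> hm); apply/eqP => e; rewrite e in xl.
have [k5 k6] := k4 lne.
have [f [f1 f2 f3 f4]] := hV _ k5.
have R6 : [/\ reg s3 0 = 0, reg s3 1 = 1, reg s3 2 = 2 & reg s3 3 = 3].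
  by rewrite !k1 // !g1.
have R7 : reg s3 6 = n by rewrite k1 ?g1.
have R8 : reg s3 7 = jb by rewrite k1 ?g1.
rewrite -k2 in f3.
apply: wp_conseq (backtrack_spec R6 R7 R8 frA f3) => s4 [m1 m2 m3]; split.
- by move=> x hx; rewrite m1 // k1 ?g1 //; clear -hx; lia.
- exists f; split=> // g hg.
  have [y yl ey] := h7 _ hg.
  have := k6 _ yl; rewrite (last_end_eq _ _ f4) => hle; apply: leq_trans hle _.
  rewrite (last_end_eq _ (cs g n)) // => i hi.
  by rewrite /V ey decode_code.
- by move=> x hx hx'; rewrite m3 // k2 g2.
Qed.
End DP.

(** * Input, Johnson's order and output *)

(** The input occupies [2 * n + 2] cells and the output will overwrite the first [3 * n]; the job
    records start at [3 * n + 2], clear of both. *)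
Definition setup : cmd :=
  (Const 1 1;; Const 2 2;; Const 3 3;; Const 4 4;; Fetch 5 0;; Fetch 6 1);;
  (Op Mul 7 6 3;; Op Add 7 7 2;; Op Mul 8 6 4;; Op Add 8 8 7;;
   Op Add 9 8 5;; Op Add 9 9 5).

Definition sums : cmd :=
  For 27 6 28 (
    Op Add 29 27 27;; Op Add 29 29 2;; Fetch 30 29;; Op Add 10 10 30;;
    Op Add 29 29 1;; Fetch 30 29;; Op Add 11 11 30);;
  (Op Defs.Sub 12 10 11;;
   If 12 (Op Add 29 10 0;; Op Add 10 11 0;; Op Add 11 29 0) Skip).

Definition copy : cmd :=
  For 27 6 28 (
    (Op Add 29 27 27;; Op Add 29 29 2;; Fetch 30 29;; Op Add 29 29 1;; Fetch 31 29);;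
    If 12 (Op Add 32 30 0;; Op Add 30 31 0;; Op Add 31 32 0) Skip;;
    (Op Mul 29 27 4;; Op Add 29 29 7;; Store 29 30;; Op Add 29 29 1;; Store 29 31)).

Section Load.
Variables (W A m n : nat) (r t : nat -> nat).
Local Notation jb := (3 * n + 2).
Local Notation sb := (jb + 4 * n).
Local Notation hb := (sb + 2 * m).
Local Notation R := (psum r n).
Local Notation T := (psum t n).
Local Notation sw := (T < R).
Hypothesis hAW : A < W.
Hypothesis hhb : hb <= A.
Hypothesis hRW : R < W.
Hypothesis hTW : T < W.
Hypothesis hm : 0 < m.

Definition consts_ok s := [/\ reg s 0 = 0, reg s 1 = 1, reg s 2 = 2, reg s 3 = 3 & reg s 4 = 4] /\
  [/\ reg s 5 = m, reg s 6 = n, reg s 7 = jb, reg s 8 = sb & reg s 9 = hb].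

Definition input_ok (h : nat -> nat) := [/\ h 0 = m, h 1 = n,
  forall k, k < n -> h (2 * k + 2) = r k /\ h (2 * k + 3) = t k &
  forall x, 2 * n + 2 <= x -> h x = 0].

Lemma setup_spec s0 : (forall x, reg s0 x = 0) -> input_ok (cell s0) -> 4 < W ->
  wp W A setup s0 12 (fun s => consts_ok s /\ cell s = cell s0 /\
     forall x, 9 < x -> reg s x = 0).
Proof.
move=> hz [h0 h1 h2 h3] W4.
apply: (wp_seq (T1 := 6) (T2 := 6)) => //.
apply: wp_sl => //=; rewrite hz h0 h1.
do 4 (split; first by clear -W4; lia).
do 2 (split; first by clear -hhb hm; lia).
apply: wp_sl => //=.
have -> : n * 3 + 2 = jb by clear; lia.
have -> : n * 4 + jb = sb by clear; lia.
have -> : sb + m + m = hb by clear; lia.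
do 6 (split; first by clear -hhb hAW; lia).
split; first by split; split=> //=; rewrite hz.
by split=> // x hx /=; skip_reg.
Qed.

Lemma sums_spec s0 : consts_ok s0 -> input_ok (cell s0) -> reg s0 10 = 0 -> reg s0 11 = 0 ->
  wp W A sums s0 (n * 11 + 8) (fun s =>
    [/\ forall x, x < 10 -> reg s x = reg s0 x, cell s = cell s0,
     reg s 10 = (if sw then T else R), reg s 11 = (if sw then R else T) &
     (reg s 12 != 0) = sw]).
Proof.
move=> [[r0 r1 r2 r3 r4] [r5 r6 r7 r8 r9]] [h0 h1 h2 h3] r10 r11.
apply: (wp_seq (T1 := n * 11 + 3) (T2 := 5)); first by clear; lia.
pose I k s := [/\ forall x, x < 10 -> reg s x = reg s0 x, cell s = cell s0,
   reg s 10 = psum r k & reg s 11 = psum t k].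
apply: (@wp_for _ _ I n 7) => //.
- move=> k s hk [q1 q2 q3 q4] e27 _ _.
  apply: wp_sl => //=.
  have [hr ht] := h2 _ hk.
  rewrite !(q1 2) // !(q1 1) // r1 r2 q2 q3 q4 e27.
  have -> : k + k + 2 = 2 * k + 2 by clear; lia.
  have -> : 2 * k + 2 + 1 = 2 * k + 3 by clear; lia.
  rewrite hr ht -!psumS.
  have p1 := @psum_le r _ _ hk; have p2 := @psum_le t _ _ hk.
  do 7 (split; first by clear -hk p1 p2 hhb hAW hRW hTW; lia).
  rewrite !q1 // r6; split=> //; split=> //= x hx; skip_reg; exact: q1.
- by split=> //= [x hx||]; [skip_reg|rewrite r10 /psum big_ord0|rewrite r11 /psum big_ord0].
move=> s [q1 q2 q3 q4]; apply: wp_sl => //=; rewrite (q1 0) // r0 q3 q4 !addn0.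
split=> //; split=> h12.
  have hs : sw by clear -h12; lia.
  do 3 (split=> //); split=> //=; rewrite ?hs // => x hx; skip_reg; exact: q1.
have hs : sw = false by apply/negbTE; clear -h12; lia.
split=> //=; rewrite ?hs //; last by rewrite h12.
by move=> x hx; skip_reg; exact: q1.
Qed.

Definition r' k := if sw then t k else r k.
Definition t' k := if sw then r k else t k.

Lemma copy_spec s0 : consts_ok s0 -> input_ok (cell s0) -> (reg s0 12 != 0) = sw ->
  wp W A copy s0 (n * 18 + 3) (fun s =>
    [/\ forall x, x < 20 -> reg s x = reg s0 x,
      forall k, k < n -> cell s (jb + 4 * k) = r' k /\ cell s (jb + 4 * k + 1) = t' k &
      forall x, jb <= x -> (forall k, k < n -> x != jb + 4 * k /\ x != jb + 4 * k + 1) ->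
        cell s x = 0]).
Proof.
move=> [[r0 r1 r2 r3 r4] [r5 r6 r7 r8 r9]] [h0 h1 h2 h3] r12.
pose I k s := [/\ forall x, x < 20 -> reg s x = reg s0 x,
      forall x, x < jb -> cell s x = cell s0 x,
      forall c, c < k -> cell s (jb + 4 * c) = r' c /\ cell s (jb + 4 * c + 1) = t' c &
      forall x, jb <= x -> (forall k, k < n -> x != jb + 4 * k /\ x != jb + 4 * k + 1) ->
        cell s x = 0].
apply: (@wp_for _ _ I n 14) => //.
- move=> k s hk [q1 q2 q3 q4] e27 _ _.
  have [hr ht] := h2 _ hk.
  apply: (wp_seq (T1 := 5) (T2 := 9)) => //.
  apply: wp_sl => //=.
  rewrite !(q1 2) // !(q1 1) // r1 r2 e27.
  have -> : k + k + 2 = 2 * k + 2 by clear; lia.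
  have -> : 2 * k + 2 + 1 = 2 * k + 3 by clear; lia.
  rewrite !q2; try by clear -hk; lia.
  rewrite hr ht.
  do 5 (split; first by clear -hk hhb hAW hm; lia).
  pose K s' := [/\ forall x, x < 20 -> reg s' x = reg s0 x, cell s' = cell s,
     reg s' 27 = k, reg s' 30 = r' k & reg s' 31 = t' k].
  apply: (wp_seq (T1 := 4) (T2 := 5)) => //.
  apply: (wp_conseq (Q' := K)); last first.
    apply: wp_bounded => bs.
    have br : r k < W by have := proj1 bs 30.
    have bt : t k < W by have := proj1 bs 31.
    apply: wp_sl => //=; rewrite (q1 12) // (q1 0) // r0 !addn0.
    split=> h12.
      have hs : sw by rewrite -r12.
      do 3 (split=> //); split=> //=; rewrite /r' /t' ?hs //.
      by move=> x hx; skip_reg; apply: q1.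
    have hs : sw = false by rewrite -r12 h12.
    split=> //=; rewrite /r' /t' ?hs //.
    by move=> x hx; skip_reg; apply: q1.
  move=> s1 [k1 k2 k3 k4 k5].
  apply: wp_sl => //=.
  rewrite !(k1 1) // (k1 4) // (k1 7) // r1 r4 r7 k3 k4 k5.
  have -> : k * 4 + jb = jb + 4 * k by clear; lia.
  do 5 (split; first by clear -hk hhb hAW; lia).
  rewrite (k1 6) // r6; split=> //; split; rewrite /= ?k2 //.
  + by move=> x hx; skip_reg; apply: k1.
  + by move=> x hx; skip_reg; apply: q2.
  + move=> c; rewrite ltnS leq_eqVlt => /orP [/eqP ->|hc].
      by rewrite !eqxx; split=> //; skip_reg.
    by have [q5 q6] := q3 _ hc; split; skip_reg.
  + move=> x hx hx'; have [x1 x2] := hx' _ hk.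
    by rewrite (negbTE x1) (negbTE x2) q4.
- split=> //= [x hx|x hx _]; first by skip_reg.
  by apply: h3; clear -hx; lia.
- by move=> s [q1 q2 q3 q4]; split.
Qed.
End Load.

(* Increasing [jkey] is Johnson's order: first the jobs with [r <= t] by increasing
   [r], then the others by decreasing [t]. *)
Definition jkey (a : nat) (r t : nat -> nat) (k : nat) : nat :=
  if r k <= t k then r k else 2 * a + 1 - t k.

Definition jorder (n a : nat) (r t : nat -> nat) : seq nat :=
  bsort (jkey a r t) (2 * a + 2) (iota 0 n).

(** One scan of all jobs for each of the [2 * a + 2] possible keys. The resulting time of order
    [a * n] is affordable for every [m], whereas a range of keys growing with [b] would not be for
    [m = 1]; this is why the keys are built from the smaller of the two lengths of each job, which
    is at most [a]. *)
Definition sort_jobs : cmd :=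
  (Op Add 20 7 2;; Op Add 21 10 10;; Op Add 21 21 1;; Op Add 22 21 1);;
  For 23 22 24 (For 25 6 26 (
   (Op Mul 29 25 4;; Op Add 29 29 7;; Fetch 30 29;; Op Add 29 29 1;; Fetch 31 29);;
   (Op Defs.Sub 32 30 31;; If 32 (Op Defs.Sub 30 21 31) Skip);;
   (Op Defs.Sub 33 30 23;; Op Defs.Sub 32 23 30;; Op Add 33 33 32;;
    If 33 Skip (Store 20 25;; Op Add 20 20 4)))).

Section Sort.
Variables (n a : nat) (r t : nat -> nat).
Hypothesis hr : forall k, k < n -> r k <= a.
Local Notation key := (jkey a r t).

Lemma jkey_lt k : k < n -> key k < 2 * a + 2.
Proof. by move=> /hr; rewrite /jkey; case: ifP => _; clear; lia. Qed.

Lemma perm_jorder : perm_eq (jorder n a r t) (iota 0 n).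
Proof.
by apply: perm_bsort => k; rewrite mem_iota add0n => /andP [_ hk]; apply: jkey_lt.
Qed.

Lemma size_jorder : size (jorder n a r t) = n.
Proof. by rewrite (perm_size perm_jorder) size_iota. Qed.

Lemma bsortS (d : nat -> nat) v l : bsort d v.+1 l = bsort d v l ++ [seq x <- l | d x == v].
Proof. by rewrite /bsort -addn1 iotaD map_cat flatten_cat /= cats0. Qed.

Lemma size_bsort_le (d : nat -> nat) v v' l : v <= v' -> size (bsort d v l) <= size (bsort d v' l).
Proof.
move/subnK => <-; elim: (v' - v) => //= i IH.
by rewrite addSn bsortS size_cat; clear -IH; lia.
Qed.

Variables (W A m jb : nat).
Hypothesis hAW : A < W.
Hypothesis hjb : jb + 4 * n + 2 <= A.
Hypothesis haW : 2 * a + 2 < W.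

Lemma sort_spec s0 :
  [/\ reg s0 0 = 0, reg s0 1 = 1, reg s0 2 = 2, reg s0 4 = 4 & reg s0 10 = a] ->
  reg s0 6 = n -> reg s0 7 = jb ->
  (forall k, k < n -> cell s0 (jb + 4 * k) = r k /\ cell s0 (jb + 4 * k + 1) = t k) ->
  jb + 2 < W ->
  wp W A sort_jobs s0 ((2 * a + 2) * (n * 21 + 7) + 7) (fun s =>
    [/\ forall x, x < 20 -> reg s x = reg s0 x,
      forall k, k < n -> cell s (jb + 4 * k + 2) = nth 0 (jorder n a r t) k &
      forall x, (forall k, k < n -> x != jb + 4 * k + 2) -> cell s x = cell s0 x]).
Proof.
move=> [r0 r1 r2 r4 r10] r6 r7 hjobs hjW.
apply: (wp_seq (T1 := 4) (T2 := (2 * a + 2) * (n * 21 + 7) + 3)); first by clear; lia.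
apply: wp_sl => //=; rewrite r1 r2 r7 r10.
do 4 (split; first by clear -hjW haW; lia).
pose J out s := [/\ forall x, x < 20 -> reg s x = reg s0 x,
  reg s 20 = jb + 2 + 4 * size out /\ reg s 21 = 2 * a + 1,
  forall k, k < size out -> cell s (jb + 4 * k + 2) = nth 0 out k &
  forall x, (forall k, k < n -> x != jb + 4 * k + 2) -> cell s x = cell s0 x].
pose I v s := J (bsort key v (iota 0 n)) s /\ reg s 22 = 2 * a + 2.
apply: (@wp_for _ _ I (2 * a + 2) (n * 21 + 3)) => //.
- by rewrite /=; clear; lia.
- move=> v s hv [hJ e22] e23 _ _.
  pose K k s' := J (bsort key v (iota 0 n) ++ [seq x <- iota 0 k | key x == v]) s' /\
    reg s' 22 = 2 * a + 2 /\ reg s' 23 = v.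
  have [h1 [h2 h2'] h3 h4] := hJ.
  apply: (@wp_for _ _ K n 17) => //.
  + by rewrite h1.
  + by rewrite h1.
  + move=> k s' hk [[q1 [q2 q2'] q3 q4] [p22 p23]] p25 _ _.
    set out := _ ++ _ in q2 q3.
    have [hrk htk] := hjobs _ hk.
    apply: (wp_seq (T1 := 5) (T2 := 12)) => //.
    apply: wp_sl => //=; rewrite !(q1 4) // !(q1 7) // !(q1 1) // r4 r7 r1 p25.
    have -> : k * 4 + jb = jb + 4 * k by clear; lia.
    rewrite !q4; first last.
      by move=> i hi; apply/eqP; clear; lia.
      by move=> i hi; apply/eqP; clear; lia.
    rewrite hrk htk.
    do 5 (split; first by clear -hk hjb hAW; lia).
    pose B s'' := [/\ forall x, x < 30 -> x != 29 -> reg s'' x = reg s' x,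
       cell s'' = cell s' & reg s'' 30 = key k].
    apply: (wp_seq (T1 := 3) (T2 := 9)) => //.
    apply: (wp_conseq (Q' := B)); last first.
      apply: wp_sl => //=; rewrite q2'; split=> //; split=> hlt.
        split=> //; split=> //=; first by move=> x x1 x2; skip_reg.
        by rewrite /jkey ifN // -ltnNge; clear -hlt; lia.
      split=> //=; first by move=> x x1 x2; skip_reg.
      by rewrite /jkey ifT //; clear -hlt; lia.
    move=> s2 [k1 k2 k3].
    have hout : [seq x <- iota 0 k.+1 | key x == v] =
        [seq x <- iota 0 k | key x == v] ++ (if key k == v then [:: k] else [::]).
      by rewrite -addn1 iotaD filter_cat.
    have hkb := jkey_lt hk.
    apply: wp_sl => //=; rewrite k3 (k1 23) // !(k1 20) // (k1 25) // (k1 4) // p23 p25 q2.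
    rewrite (q1 4) // r4.
    do 2 (split=> //); split; first by clear -hv hkb haW; lia.
    split=> hne.
      have hf : (key k == v) = false by apply/eqP; clear -hne; lia.
      rewrite (k1 6) // (k1 1) // (q1 6) // (q1 1) // r6 r1.
      split=> //; split; last by rewrite /= !k1.
      rewrite hout hf cats0; split=> //=; rewrite ?k2 ?k1 //.
      by move=> x hx; skip_reg; rewrite k1 ?q1 //; clear -hx; lia.
    have hf : key k == v by apply/eqP; clear -hne; lia.
    (* There is room for one more entry: the output so far and job [k] itself are all counted in the
       complete sorted list, which has length [n]. *)
    have hso : size out < n.
      have := @size_bsort_le key _ _ (iota 0 n) hv.
      rewrite -/(jorder n a r t) size_jorder => hle; apply: leq_trans hle.
      rewrite bsortS /out !size_cat -addnS leq_add2l.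
      have -> : iota 0 n = iota 0 k.+1 ++ iota k.+1 (n - k.+1).
        by rewrite -{1}(subnKC hk) iotaD.
      rewrite filter_cat size_cat hout hf size_cat /= addn1.
      exact: leq_addr.
    do 2 (split; first by clear -hso hjb hAW; lia).
    rewrite (k1 6) // (k1 1) // (q1 6) // (q1 1) // r6 r1.
      split=> //; split; last by rewrite /= !k1.
    rewrite hout hf catA cats1 -/out; split=> //=.
    * by move=> x hx; skip_reg; rewrite k1 ?q1 //; clear -hx; lia.
    * by rewrite size_rcons k1 //; split=> //; clear; lia.
    * move=> i; rewrite size_rcons ltnS leq_eqVlt nth_rcons => /orP [/eqP ->|hi].
        rewrite ltnn eqxx ifT //; apply/eqP; clear; lia.
      by rewrite hi ifN ?k2 ?q3 //; apply/eqP; clear -hi; lia.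
    * move=> x hx; rewrite ifN ?k2 ?q4 //.
      have := hx _ hso; congr (~~ (_ == _)); clear; lia.
  + split=> /=; last by rewrite e22 e23.
    rewrite cats0; split=> //= x hx; skip_reg; exact: h1.
  + move=> s' [[q1 q2 q3 q4] [p22 p23]].
    split; rewrite ?p23 ?p22 ?(q1 1) //; split=> //=.
    rewrite bsortS; split=> //= x hx; skip_reg; exact: q1.
- split=> /=; last by clear; lia.
  split=> //=; first by move=> x hx; skip_reg.
  by rewrite addn0; split=> //; clear; lia.
- move=> s [[h1 h2 h3 h4] e22]; split=> // k hk; apply: h3.
  by rewrite -/(jorder n a r t) size_jorder.
- by rewrite -addnA.
Qed.
End Sort.

(** * Start times from an assignment, and the reversal of time *)

Fixpoint tstate (jr jt f : nat -> nat) (k : nat) : nat -> nat * nat :=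
  if k is k'.+1 then
    fun i => if i == f k' then step (jr k') (jt k') (tstate jr jt f k' i)
             else tstate jr jt f k' i
  else fun=> (0, 0).

Definition start1 jr jt f k := (tstate jr jt f k (f k)).1.
Definition start2 jr jt f k :=
  maxn (tstate jr jt f k (f k)).2 (start1 jr jt f k + jr k).
Definition endtime n jr jt f := \max_(k < n) (start2 jr jt f k + jt k).

Lemma tstate_le jr jt f k i :
  (tstate jr jt f k i).1 <= psum jr k /\ (tstate jr jt f k i).2 <= psum jr k + psum jt k.
Proof.
elim: k => //= k [IH1 IH2]; rewrite !psumS; case: eqP => _ /=; clear -IH1 IH2; lia.
Qed.

Lemma endtime_le n jr jt f : endtime n jr jt f <= psum jr n + psum jt n.
Proof.
apply/bigmax_leqP => i _; have [h1 h2] := tstate_le jr jt f i (f i).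
have h3 := @psum_le jr _ _ (ltn_ord i); have h4 := @psum_le jt _ _ (ltn_ord i).
rewrite /start2 /start1; rewrite !psumS in h3 h4; clear -h1 h2 h3 h4; lia.
Qed.

(** The dynamic program delivers only an assignment, since its states have forgotten some completion
    times of R-processors. The true completion times are therefore recomputed, starting every
    operation as early as Johnson's order allows; register 19 collects the makespan. *)
Definition simulate : cmd :=
  For 27 6 28 (
    (Op Mul 29 27 4;; Op Add 29 29 7;; Op Add 29 29 2;; Fetch 30 29;; Op Add 29 29 1;;
     Fetch 31 29);;
    (Op Mul 29 30 4;; Op Add 29 29 7;; Fetch 32 29;; Op Add 29 29 1;; Fetch 33 29);;
    (Op Add 34 31 31;; Op Add 34 34 8;; Fetch 35 34);; (Op Add 36 34 1;; Fetch 37 36);;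
    (Op Mul 29 30 3;; Store 29 31;; Op Add 29 29 1;; Store 29 35;;
     Op Add 35 35 32;; Store 34 35);;
    (Op Defs.Sub 38 35 37;; Op Add 37 37 38;; Op Add 29 29 1;; Store 29 37;;
     Op Add 37 37 33;; Store 36 37);;
    (Op Defs.Sub 38 37 19;; Op Add 19 19 38)).

Definition reverse_time : cmd :=
  For 27 6 28 (
    (Op Mul 29 27 3;; Op Add 29 29 1;; Fetch 30 29;; Op Add 31 29 1;; Fetch 32 31);;
    (Op Mul 33 27 4;; Op Add 33 33 7;; Fetch 34 33;; Op Add 33 33 1;; Fetch 35 33);;
    (Op Add 32 32 35;; Op Defs.Sub 32 19 32;; Store 29 32;;
     Op Add 30 30 34;; Op Defs.Sub 30 19 30;; Store 31 30)).

Section Simulate.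
Variables (W A m n jb sb : nat) (r t ord f : nat -> nat).
Hypothesis ejb : jb = 3 * n + 2.
Hypothesis esb : sb = jb + 4 * n.
Local Notation hb := (sb + 2 * m).
Local Notation jr := (fun k => r (ord k)).
Local Notation jt := (fun k => t (ord k)).
Hypothesis hAW : A < W.
Hypothesis hhb : hb <= A.
Hypothesis hRT : psum jr n + psum jt n < W.
Hypothesis hf : forall k, f k < m.
Hypothesis hord : forall k, k < n -> ord k < n.
Hypothesis iord : forall k k', k < n -> k' < n -> ord k = ord k' -> k = k'.

Lemma simulate_spec s0 : consts_ok m n s0 -> reg s0 19 = 0 ->
  (forall k, k < n -> cell s0 (jb + 4 * k) = r k /\ cell s0 (jb + 4 * k + 1) = t k) ->
  (forall k, k < n -> cell s0 (jb + 4 * k + 2) = ord k /\ cell s0 (jb + 4 * k + 3) = f k) ->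
  (forall x, sb <= x < hb -> cell s0 x = 0) ->
  wp W A simulate s0 (n * 34 + 3) (fun s =>
    [/\ forall x, x < 19 -> reg s x = reg s0 x, reg s 19 = endtime n jr jt f,
     forall k, k < n -> [/\ cell s (3 * ord k) = f k, cell s (3 * ord k + 1) = start1 jr jt f k &
       cell s (3 * ord k + 2) = start2 jr jt f k] &
     forall x, jb <= x < sb -> cell s x = cell s0 x]).
Proof.
move=> [[r0 r1 r2 r3 r4] [r5 r6 r7 r8 r9]] r19 hj ho hz.
rewrite -ejb -?esb in r7 r8.
pose I k s := [/\ (forall x, x < 19 -> reg s x = reg s0 x) /\ reg s 19 = endtime k jr jt f,
  forall i, i < m -> cell s (sb + 2 * i) = (tstate jr jt f k i).1 /\
     cell s (sb + 2 * i + 1) = (tstate jr jt f k i).2,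
  forall c, c < k -> [/\ cell s (3 * ord c) = f c, cell s (3 * ord c + 1) = start1 jr jt f c &
       cell s (3 * ord c + 2) = start2 jr jt f c] &
  forall x, jb <= x < sb -> cell s x = cell s0 x].
apply: (@wp_for _ _ I n 30) => //.
- move=> k s hk [[q1 q19] q2 q3 q4] e27 _ _.
  have [ho1 ho2] := ho _ hk; have hok := hord hk; have [hj1 hj2] := hj _ hok.
  have hfk := hf k.
  apply: (wp_seq (T1 := 6) (T2 := 24)) => //.
  apply: wp_sl => //=; rewrite !(q1 4) // !(q1 7) // !(q1 2) // !(q1 1) // r4 r7 r2 r1 e27.
  have -> : k * 4 + jb + 2 = jb + 4 * k + 2 by clear; lia.
  have -> : jb + 4 * k + 2 + 1 = jb + 4 * k + 3 by clear; lia.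
  rewrite !q4; try by clear -ejb esb hk; lia.
  rewrite ho1 ho2.
  do 6 (split; first by clear -ejb esb hk hAW hhb; lia).
  apply: (wp_seq (T1 := 5) (T2 := 19)) => //.
  apply: wp_sl => //=; rewrite !(q1 4) // !(q1 7) // !(q1 1) // r4 r7 r1.
  have -> : ord k * 4 + jb = jb + 4 * ord k by clear; lia.
  rewrite !q4; try by clear -ejb esb hok; lia.
  rewrite hj1 hj2.
  do 5 (split; first by clear -ejb esb hok hAW hhb; lia).
  set s1 := set_reg _ _ _.
  have p1 x : x < 29 -> reg s1 x = reg s x by move=> hx /=; skip_reg.
  have [p30 p31 p32 p33] : [/\ reg s1 30 = ord k, reg s1 31 = f k, reg s1 32 = r (ord k) &
    reg s1 33 = t (ord k)] by [].
  have pc : cell s1 = cell s by [].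
  move: s1 p1 p30 p31 p32 p33 pc => s1 p1 p30 p31 p32 p33 pc.
  have p1' x : x < 19 -> reg s1 x = reg s0 x by move=> hx; rewrite p1 ?q1 //; clear -ejb esb hx; lia.
  have [hs1 hs2] := q2 _ hfk.
  apply: (wp_seq (T1 := 3) (T2 := 16)) => //.
  apply: wp_sl => //=; rewrite !(p1' 8) // r8 p31 pc.
  have -> : f k + f k + sb = sb + 2 * f k by clear; lia.
  rewrite hs1.
  do 3 (split; first by clear -ejb esb hfk hAW hhb; lia).
  apply: (wp_seq (T1 := 2) (T2 := 14)) => //.
  apply: wp_sl => //=; rewrite !(p1' 1) // r1 pc hs2.
  do 2 (split; first by clear -ejb esb hfk hAW hhb; lia).
  set s2 := set_reg _ _ _.
  have u1 x : x < 34 -> reg s2 x = reg s1 x by move=> hx /=; skip_reg.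
  have [u34 u35 u36 u37] : [/\ reg s2 34 = sb + 2 * f k, reg s2 35 = start1 jr jt f k,
    reg s2 36 = sb + 2 * f k + 1 & reg s2 37 = (tstate jr jt f k (f k)).2] by [].
  have uc : cell s2 = cell s by rewrite -pc.
  move: s2 u1 u34 u35 u36 u37 uc => s2 u1 u34 u35 u36 u37 uc.
  have u1' x : x < 19 -> reg s2 x = reg s0 x by move=> hx; rewrite u1 ?p1' //; clear -ejb esb hx; lia.
  have [v1 v2] := tstate_le jr jt f k (f k).
  have w1 := @psum_le jr _ _ hk; have w2 := @psum_le jt _ _ hk.
  rewrite !psumS -/(start1 jr jt f k) in v1 v2 w1 w2.
  have st1 : start1 jr jt f k + r (ord k) < W by clear -ejb esb v1 w1 hRT; lia.
  apply: (wp_seq (T1 := 6) (T2 := 8)) => //.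
  apply: wp_sl => //=.
  rewrite !(u1' 3) // !(u1' 1) // r3 r1 (u1 30) // (u1 31) // (u1 32) // p30 p31 p32 u34 u35.
  rewrite (mulnC _ 3).
  do 6 (split; first by clear -ejb esb hok hfk st1 hAW hhb; lia).
  apply: (wp_seq (T1 := 6) (T2 := 2)) => //.
  apply: wp_sl => //=.
  rewrite !(u1' 1) // (u1 33) // r1 p33 u36 u37.
  have -> : (tstate jr jt f k (f k)).2 + (start1 jr jt f k + r (ord k) -
     (tstate jr jt f k (f k)).2) = start2 jr jt f k by rewrite /start2; clear; lia.
  have -> : 3 * ord k + 1 + 1 = 3 * ord k + 2 by clear; lia.
  have st2 : start2 jr jt f k + t (ord k) < W.
    by rewrite /start2; clear -ejb esb v1 v2 w1 w2 hRT; lia.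
  split=> //.
  do 5 (split; first by clear -ejb esb hok hfk st2 hAW hhb; lia).
  apply: wp_sl => //=.
  have e19 : reg s2 19 = endtime k jr jt f by rewrite u1 // p1.
  rewrite e19.
  have hend : endtime k jr jt f + (start2 jr jt f k + t (ord k) - endtime k jr jt f) =
     endtime k.+1 jr jt f by rewrite {3}/endtime big_ord_recr /= -/(endtime k jr jt f); clear; lia.
  rewrite hend; split=> //; split.
    have h1 := endtime_le k.+1 jr jt f; clear -ejb esb h1 w1 w2 hRT.
    by apply: leq_ltn_trans h1 _; rewrite !psumS; lia.
  rewrite (u1 27) // (p1 27) // e27 !u1' // r6 r1; split=> //; split.
  + by split=> //= x hx; skip_reg; apply: u1'.
  + move=> i hi; rewrite /= uc.
    have n1 : (sb + 2 * i == sb + 2 * f k + 1) = false by apply/eqP; clear; lia.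
    have n2 : (sb + 2 * i + 1 == sb + 2 * f k) = false by apply/eqP; clear; lia.
    have n3 : (sb + 2 * i == sb + 2 * f k) = (i == f k) by apply/eqP/eqP; clear; lia.
    have n4 : (sb + 2 * i + 1 == sb + 2 * f k + 1) = (i == f k) by apply/eqP/eqP; clear; lia.
    have n5 j d : j <= 2 -> (sb + 2 * i + d == 3 * ord k + j) = false.
      by move=> hj3; apply/eqP; clear -ejb esb hj3 hok; lia.
    have n6 j : j <= 2 -> (sb + 2 * i == 3 * ord k + j) = false.
      by move=> hj3; apply/eqP; clear -ejb esb hj3 hok; lia.
    have n7 : (sb + 2 * i == 3 * ord k) = false by apply/eqP; clear -ejb esb hok; lia.
    have n8 : (sb + 2 * i + 1 == 3 * ord k) = false by apply/eqP; clear -ejb esb hok; lia.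
    rewrite n1 n2 n3 n4 !n5 // !n6 // n7 n8.
    by case: eqP => [->|_] /=; [split|exact: q2].
  + move=> c; rewrite ltnS leq_eqVlt => /orP [/eqP ->|hc]; rewrite /= uc.
      by rewrite !eqxx; split; skip_reg.
    have hcn : c < n by apply: ltn_trans hk.
    have hne : ord c <> ord k by move=> e; have := iord hcn hk e; clear -ejb esb hc; lia.
    have hoc := hord hcn.
    have [a1 a2 a3] := q3 _ hc.
    split; do 5 (case: eqP => [ea|_]; first by exfalso; clear -ejb esb ea hne hoc hok; lia); by [].
  + move=> x hx; rewrite /= uc.
    do 5 (case: eqP => [ea|_]; first by exfalso; clear -ejb esb ea hx hok; lia).
    exact: q4.
- split=> //=.
  + by split=> [x hx|]; [skip_reg|rewrite /endtime big_ord0].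
  + by move=> i hi; rewrite !hz //; clear -ejb esb hi; lia.
- by move=> s [[h1 h2] h3 h4 h5]; split.
Qed.

Lemma reverse_spec s0 D (sR sT : nat -> nat) : consts_ok m n s0 -> reg s0 19 = D -> D < W ->
  (forall k, k < n -> cell s0 (jb + 4 * k) = r k /\ cell s0 (jb + 4 * k + 1) = t k) ->
  (forall k, k < n -> cell s0 (3 * k + 1) = sR k /\ cell s0 (3 * k + 2) = sT k) ->
  (forall k, k < n -> sR k + r k <= D /\ sT k + t k <= D) ->
  wp W A reverse_time s0 (n * 20 + 3) (fun s =>
     forall k, k < n -> [/\ cell s (3 * k) = cell s0 (3 * k),
       cell s (3 * k + 1) = D - (sT k + t k) & cell s (3 * k + 2) = D - (sR k + r k)]).
Proof.
move=> [[r0 r1 r2 r3 r4] [r5 r6 r7 r8 r9]] r19 DW hj hs hD.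
rewrite -ejb in r7.
pose I k s := [/\ forall x, x < 20 -> reg s x = reg s0 x,
  forall x, 3 * k <= x -> cell s x = cell s0 x &
  forall c, c < k -> [/\ cell s (3 * c) = cell s0 (3 * c),
       cell s (3 * c + 1) = D - (sT c + t c) & cell s (3 * c + 2) = D - (sR c + r c)]].
apply: (@wp_for _ _ I n 16) => //.
- move=> k s hk [q1 q2 q3] e27 _ _.
  have [hj1 hj2] := hj _ hk; have [hs1 hs2] := hs _ hk; have [hD1 hD2] := hD _ hk.
  apply: (wp_seq (T1 := 5) (T2 := 11)) => //.
  apply: wp_sl => //=; rewrite !(q1 3) // !(q1 1) // r3 r1 e27 (mulnC k).
  have -> : 3 * k + 1 + 1 = 3 * k + 2 by clear; lia.
  rewrite !q2; try by clear; lia.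
  rewrite hs1 hs2.
  do 5 (split; first by clear -ejb esb hk hAW hhb; lia).
  apply: (wp_seq (T1 := 5) (T2 := 6)) => //.
  apply: wp_sl => //=; rewrite !(q1 4) // !(q1 7) // !(q1 1) // r4 r7 r1 e27.
  have -> : k * 4 + jb = jb + 4 * k by clear; lia.
  rewrite !q2; try by clear -ejb esb hk; lia.
  rewrite hj1 hj2.
  do 5 (split; first by clear -ejb esb hk hAW hhb; lia).
  apply: wp_sl => //=; rewrite !(q1 19) // r19.
  split; first by clear -ejb esb hD2 DW; lia.
  split=> //; split; first by clear -ejb esb hk hhb; lia.
  split; first by clear -ejb esb hD1 DW; lia.
  split=> //; split; first by clear -ejb esb hk hhb; lia.
  rewrite e27 !q1 // r6 r1; split=> //; split=> /=.
  + by move=> x hx; skip_reg; apply: q1.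
  + by move=> x hx; skip_reg; apply: q2; clear -ejb esb hx; lia.
  + move=> c; rewrite ltnS leq_eqVlt => /orP [/eqP ->|hc].
      by rewrite !eqxx; split=> //; skip_reg => //; apply: q2; clear; lia.
    have [a1 a2 a3] := q3 _ hc.
    by split; skip_reg.
- by split=> //= x hx; skip_reg.
- by move=> s [h1 h2 h3].
Qed.
End Simulate.

(** * Counting the states *)

Section Enumeration.
Variable L : nat.

(** An explicit list, so that its length can be computed by recursion on the number [q] of shops.
    [p] bounds the sum of the nonzero [rho], [Q] the sum of the [tau] of shops with [rho = 0], and
    [l] is the lead [tau - rho] of any other shop. *)
Fixpoint vectors (q p Q : nat) : seq (seq (nat * nat)) :=
  if q is q'.+1 then
    flatten [seq [seq (0, t) :: v | v <- vectors q' p (Q - t)] | t <- iota 0 Q.+1] ++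
    flatten [seq flatten [seq [seq (r, r + l) :: v | v <- vectors q' (p - r) Q]
                         | l <- iota 0 L] | r <- iota 1 p]
  else [:: [::]].

Arguments vectors : simpl never.

Definition head_idle q p Q :=
  flatten [seq [seq (0, t) :: v | v <- vectors q p (Q - t)] | t <- iota 0 Q.+1].
Definition head_busy q p Q :=
  flatten [seq flatten [seq [seq (r, r + l) :: v | v <- vectors q (p - r) Q]
                       | l <- iota 0 L] | r <- iota 1 p].

Lemma vectorsS q p Q : vectors q.+1 p Q = head_idle q p Q ++ head_busy q p Q.
Proof. by []. Qed.

Definition idle_sum (v : seq (nat * nat)) : nat := \sum_(x <- v | x.1 == 0) x.2.
Definition fst_sum (v : seq (nat * nat)) : nat := \sum_(x <- v) x.1.
Definition snd_sum (v : seq (nat * nat)) : nat := \sum_(x <- v) x.2.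

(** What [canon] leaves behind: a shop with [rho + L <= tau] has been reset to [rho = 0]. *)
Definition admissible (x : nat * nat) : bool := (x.1 == 0) || (x.1 <= x.2 < x.1 + L).

Lemma mem_vectors q p Q v : size v = q -> all admissible v ->
  fst_sum v <= p -> idle_sum v <= Q -> v \in vectors q p Q.
Proof.
elim: v q p Q => [|[r t] v IH] [|q] p Q // [sv] /andP [hx hv].
rewrite /fst_sum /idle_sum !big_cons /= => h1 h2; rewrite vectorsS mem_cat; apply/orP.
case: eqP h2 => [r0|/eqP r0] h2; [left|right].
  apply/flattenP; exists [seq (0, t) :: v | v <- vectors q p (Q - t)].
    by apply/mapP; exists t; rewrite // (mem_iota 0); lia.
  rewrite r0; apply/mapP; exists v => //; apply: IH => //; rewrite /fst_sum /idle_sum; lia.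
apply/flattenP; exists (flatten [seq [seq (r, r + l) :: v | v <- vectors q (p - r) Q]
                         | l <- iota 0 L]).
  by apply/mapP; exists r; rewrite // mem_iota; lia.
move: hx; rewrite /admissible /= (negbTE r0) /= => hx.
apply/flattenP; exists [seq (r, r + (t - r)) :: v | v <- vectors q (p - r) Q].
  by apply/mapP; exists (t - r); rewrite // mem_iota; lia.
rewrite subnKC; last by lia.
apply/mapP; exists v => //; apply: IH => //; rewrite /fst_sum /idle_sum; lia.
Qed.

Lemma hockey_stick n k : \sum_(0 <= t < n.+1) 'C(n - t + k, k) = 'C(n + k.+1, k.+1).
Proof.
rewrite big_nat_rev /= add0n.
rewrite (eq_big_nat _ _ (F2 := fun t => 'C(t + k, k))) => [|t ht]; last first.
  by congr 'C(_ + _, _); lia.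
elim: n => [|n IH]; first by rewrite big_nat1 add0n !binn.
by rewrite big_nat_recr //= IH [in RHS]addSn binS addSnnS.
Qed.

Lemma sum_bin_sub p j : \sum_(1 <= r < p.+1) 'C(p - r, j) = 'C(p, j.+1).
Proof.
elim: p => [|p IH]; first by rewrite big_nil.
rewrite big_ltn // subSS subn0 binS addnC -IH; congr (_ + _).
by rewrite big_add1 /=; apply: eq_big_nat => r hr; rewrite subSS.
Qed.

Lemma sumn_iota (F : nat -> nat) a n : sumn [seq F t | t <- iota a n] = \sum_(a <= t < a + n) F t.
Proof. by rewrite sumnE big_map /index_iota addKn. Qed.

(** Here [j] is the number of shops with nonzero [rho]. There are ['C(q, j)] ways to choose them,
    ['C(p, j)] ways to choose positive [rho] of sum at most [p], [L ^ j] choices of the leads, and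
    ['C(Q + (q - j), q - j)] choices of the other [tau] with sum at most [Q]. In the induction the
    two kinds of first shop combine by Pascal's rule for ['C(q.+1, j)]. *)
Lemma size_vectors q p Q : size (vectors q p Q) =
  \sum_(j < q.+1) 'C(q, j) * 'C(p, j) * L ^ j * 'C(Q + (q - j), q - j).
Proof.
elim: q p Q => [|q IH] p Q.
  by rewrite big_ord_recl big_ord0 /= !bin0 !muln1.
rewrite vectorsS size_cat.
have -> : size (head_idle q p Q) =
    \sum_(j < q.+1) 'C(q, j) * 'C(p, j) * L ^ j * 'C(Q + (q.+1 - j), q.+1 - j).
  rewrite size_flatten /shape -map_comp.
  under eq_map => t do rewrite /= size_map IH.
  rewrite sumn_iota add0n exchange_big /=; apply: eq_bigr => j _.
  by rewrite -big_distrr /= hockey_stick subSn // -ltnS.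
have -> : size (head_busy q p Q) =
    \sum_(j < q.+1) 'C(q, j) * 'C(p, j.+1) * L ^ j.+1 * 'C(Q + (q - j), q - j).
  rewrite size_flatten /shape -map_comp.
  under eq_map => r.
    rewrite /= size_flatten /shape -map_comp.
    under eq_map => l do rewrite /= size_map IH.
    rewrite sumn_iota add0n sum_nat_const_nat subn0 big_distrr /=.
    over.
  rewrite sumn_iota add1n exchange_big /=; apply: eq_bigr => j _.
  rewrite -(sum_bin_sub p j) expnS big_distrr /= !big_distrl /=.
  by apply: eq_bigr => r _; lia.
rewrite big_ord_recl [in RHS]big_ord_recl /= !bin0 -addnA; congr (_ + _).
rewrite [in RHS](eq_bigr (fun j : 'I_q.+1 =>
  'C(q, j.+1) * 'C(p, j.+1) * L ^ j.+1 * 'C(Q + (q.+1 - j.+1), q.+1 - j.+1) +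
  'C(q, j) * 'C(p, j.+1) * L ^ j.+1 * 'C(Q + (q - j), q - j))).
  rewrite big_split /=; congr (_ + _).
  by rewrite big_ord_recr /= bin_small // !mul0n addn0.
by move=> j _; rewrite /= /bump /= add1n binS subSS -!mulnDl.
Qed.
End Enumeration.

(** * Binomial estimates with constants independent of the number of shops *)

Lemma bin_fact_le n k : 'C(n, k) * k`! <= n ^ k.
Proof.
rewrite bin_ffact; elim: k n => [|k IH] [|n] //.
rewrite ffactnS expnS leq_mul2l /=; apply: leq_trans (IH n) _.
by case: (k) => // k'; rewrite leq_exp2r.
Qed.

Lemma bin_le_exp n k : 'C(n, k) <= n ^ k.
Proof. by apply: leq_trans (bin_fact_le n k); rewrite leq_pmulr ?fact_gt0. Qed.

Lemma fact_ratio_le q j : j <= q -> q`! <= j`! * q ^ (q - j).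
Proof.
elim: q => [|q IH]; first by rewrite leqn0 => /eqP ->.
rewrite leq_eqVlt => /orP [/eqP ->|]; first by rewrite subnn muln1.
rewrite ltnS => hj; rewrite factS subSn // expnS mulnCA leq_mul2l /=.
apply: leq_trans (IH hj) _; rewrite leq_mul2l; apply/orP; right.
by case: (q - j) => // k; rewrite leq_exp2r.
Qed.

Lemma exp_le_fact_exp2 x d : x ^ d <= d`! * 2 ^ (x + d).
Proof.
have h : x ^ d <= (x + d) ^_ d.
  elim: d => [|d IH] //; rewrite addnS ffactnS expnS leq_mul //; lia.
apply: leq_trans h _; rewrite -bin_ffact mulnC leq_mul2l; apply/orP; right.
have -> : 2 ^ (x + d) = \sum_(i < (x + d).+1) 'C(x + d, i).
  by rewrite -[2]/(1 + 1) Pascal; apply: eq_bigr => i _; rewrite !exp1n !muln1.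
have hd : d < (x + d).+1 by lia.
by rewrite (bigD1 (Ordinal hd)) //= leq_addr.
Qed.

(** Raising [i] by one multiplies the left side by [16 * (Q / (i + 1) + 1)], which is at most
    [32 * b / (i + 1) + 16]. For [i >= 64] this is at most [b], as [16 <= b / 2] by the assumption
    [32 <= b]; for the first 64 steps it is at most [48 * b]. So the gain [16 ^ i] costs only a
    constant. *)
Lemma bin_exp_le b Q i : 32 <= b -> Q <= 2 * b -> 'C(Q + i, i) * 16 ^ i <= 48 ^ (minn i 64) * b ^ i.
Proof.
move=> hb hQ; elim: i => [|i IH]; first by rewrite bin0 min0n !expn0.
have e : 'C(Q + i.+1, i.+1) * i.+1 = (Q + i.+1) * 'C(Q + i, i).
  by rewrite addnS mulnC; have := mul_bin_diag (Q + i).+1 i => /= <-.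
rewrite -(leq_pmul2r (_ : 0 < i.+1)) // mulnAC e !expnS.
case: (boolP (i < 64)) => hi.
  have -> : minn i.+1 64 = (minn i 64).+1 by lia.
  rewrite expnS.
  apply: (@leq_trans (((Q + i.+1) * 16) * (48 ^ minn i 64 * b ^ i))).
    by rewrite -!mulnA leq_mul2l; apply/orP; right; move: IH; nia.
  rewrite [X in _ <= X](_ : _ = (48 * b * i.+1) * (48 ^ minn i 64 * b ^ i)); last by lia.
  rewrite leq_mul2r; apply/orP; right; nia.
have -> : minn i.+1 64 = minn i 64 by lia.
apply: (@leq_trans (((Q + i.+1) * 16) * (48 ^ minn i 64 * b ^ i))).
  by rewrite -!mulnA leq_mul2l; apply/orP; right; move: IH; nia.
rewrite [X in _ <= X](_ : _ = (b * i.+1) * (48 ^ minn i 64 * b ^ i)); last by lia.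
rewrite leq_mul2r; apply/orP; right; nia.
Qed.

Lemma expnD_le x y q : (x + y) ^ q <= 2 ^ q * (x ^ q + y ^ q).
Proof.
wlog hxy : x y / x <= y => [h|].
  by case: (leqP x y) => [/h //|/ltnW /h]; rewrite addnC [X in _ * X]addnC.
apply: (@leq_trans ((2 * y) ^ q)).
  by case: q => // q; rewrite leq_exp2r //; lia.
by rewrite expnMn leq_mul2l leq_addl orbT.
Qed.

(** The summand for [j] is multiplied by [64 ^ q], split as [4 ^ j * 16 ^ j * 4 ^ (q - j) * 16 ^ (q
    - j)]: [4 ^ j] turns [(p * L) ^ j] into at most [a ^ (2 * j)], and [16 ^ (q - j)] is absorbed by
    [bin_exp_le]. The rest sums by the binomial theorem to [(16 * a ^ 2 + 4 * q * b) ^ q].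
    Separating the two bases costs [2 ^ q], and with [q ^ q <= q! * 4 ^ q] both terms carry
    [16 ^ q]. Thus [32 ^ q] is used up, and the [2 ^ q] on the left is what remains. *)
Lemma size_vectors_large K L q p Q a b : (forall i, 48 ^ minn i 64 <= K) -> 32 <= b -> Q <= 2 * b -> p + L <= a ->
  2 ^ q * q`! * size (vectors L q p Q) <= K * (a ^ (2 * q) + q`! * b ^ q).
Proof.
move=> hK hb hQ hpL.
have hpl : 4 * (p * L) <= a ^ 2 by apply: leq_trans (nat_AGM2 p L) _; rewrite leq_exp2r.
have term (j : 'I_q.+1) : q`! * 64 ^ q * ('C(q, j) * 'C(p, j) * L ^ j * 'C(Q + (q - j), q - j))
    <= K * ('C(q, j) * ((4 * q * b) ^ (q - j) * (16 * a ^ 2) ^ j)).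
  have hj : j <= q by rewrite -ltnS.
  have h1 := fact_ratio_le hj; have h2 := bin_fact_le p j.
  have h3 := @bin_exp_le b Q (q - j) hb hQ.
  have h4 := hK (q - j).
  have e64 : 64 ^ q = 4 ^ j * 16 ^ j * (4 ^ (q - j) * 16 ^ (q - j)).
    by rewrite -!expnMn -expnD subnKC.
  have h5 : (4 * (p * L)) ^ j <= (a ^ 2) ^ j by case: (nat_of_ord j) => // j'; rewrite leq_exp2r.
  apply: (@leq_trans ((j`! * q ^ (q - j)) * 64 ^ q *
      ('C(q, j) * 'C(p, j) * L ^ j * 'C(Q + (q - j), q - j)))).
    by rewrite !leq_mul2r h1 !orbT.
  rewrite e64.
  rewrite [X in X <= _](_ : _ = 'C(q, j) * (('C(p, j) * j`!) * (4 ^ j * L ^ j * 16 ^ j)) *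
     (q ^ (q - j) * 4 ^ (q - j)) * ('C(Q + (q - j), q - j) * 16 ^ (q - j))); last by lia.
  rewrite [X in _ <= X](_ : _ = 'C(q, j) * ((a ^ 2) ^ j * 16 ^ j) *
     (q ^ (q - j) * 4 ^ (q - j)) * (K * b ^ (q - j))); last by rewrite !expnMn; lia.
  apply: leq_mul; last first.
    by apply: leq_trans h3 _; rewrite leq_mul2r h4 orbT.
  rewrite leq_mul2r leq_mul2l; apply/orP; right; apply/orP; right.
  apply: (@leq_trans (p ^ j * (4 ^ j * L ^ j * 16 ^ j))); first by rewrite leq_mul2r h2 orbT.
  rewrite !mulnA leq_mul2r; apply/orP; right; apply: leq_trans h5.
  by rewrite !expnMn; lia.
have main : q`! * 64 ^ q * size (vectors L q p Q) <= K * (16 * a ^ 2 + 4 * q * b) ^ q.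
  rewrite size_vectors big_distrr /= addnC Pascal big_distrr /=.
  by apply: leq_sum => j _; apply: term.
have h8 := leq_trans main (leq_mul (leqnn K) (expnD_le _ _ q)).
have hq : q ^ q <= q`! * 4 ^ q.
  by have := exp_le_fact_exp2 q q; rewrite addnn -mul2n expnM.
have e1 : (16 * a ^ 2) ^ q = 16 ^ q * a ^ (2 * q) by rewrite expnMn -expnM.
have e2 : (4 * q * b) ^ q = 4 ^ q * q ^ q * b ^ q by rewrite !expnMn.
have e3 : 64 ^ q = 32 ^ q * 2 ^ q by rewrite -expnMn.
have e4 : 32 ^ q = 2 ^ q * (4 ^ q * 4 ^ q) by rewrite -!expnMn.
have e5 : 16 ^ q = 4 ^ q * 4 ^ q by rewrite -expnMn.
rewrite e1 e2 e3 in h8.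
rewrite -(leq_pmul2l (_ : 0 < 32 ^ q)) ?expn_gt0 //.
apply: leq_trans (leq_trans h8 _).
  by clear; move: (size _) (q`!) (32 ^ q) (2 ^ q) => s f u v; lia.
rewrite e4 e5 [X in _ <= X](_ : _ =
  K * (2 ^ q * (4 ^ q * 4 ^ q * a ^ (2 * q) + 4 ^ q * (q`! * 4 ^ q) * b ^ q))); last first.
  by clear; move: (q`!) (4 ^ q) (2 ^ q) (a ^ _) (b ^ _) => f u v x y; lia.
rewrite !leq_mul2l leq_add2l leq_mul2r leq_mul2l hq !orbT.
by [].
Qed.

Lemma leq_exp_base x y k : x <= y -> x ^ k <= y ^ k.
Proof. by case: k => // k; rewrite leq_exp2r. Qed.

(** With bounded lengths, only the summands with [j <= c] are nonzero, and the complementary form of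
    the last binomial coefficient shows that each is polynomial in [q] of degree at most [c + d]. A
    polynomial of fixed degree is at most a constant times [2 ^ q]. *)
Lemma size_vectors_small c d : 0 < c -> 2 <= d ->
  exists K, forall L q p Q, L <= c -> p <= c -> Q <= d ->
  (q + 2) * size (vectors L q p Q) <= K * 2 ^ q.
Proof.
move=> hc hd; have [E eE] : exists E, E = c ^ c by eexists.
have [D eD] : exists D, D = 2 + (c + d) by eexists.
exists (E * E * (D`! * 2 ^ (d + D))) => L q p Q hL hp hQ.
have q1 : 0 < q + d by lia.
have term (j : 'I_q.+1) :
    'C(q, j) * 'C(p, j) * L ^ j * 'C(Q + (q - j), q - j) <= E * E * (q + d) ^ (c + d).
  case: (ltnP p j) => hpj; first by rewrite (bin_small hpj) muln0.
  have hj : j <= c by apply: leq_trans hp.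
  have h1 : 'C(q, j) <= (q + d) ^ c.
    apply: leq_trans (bin_le_exp q j) _; apply: leq_trans (leq_exp_base _ (leq_addr d q)) _.
    by rewrite leq_pexp2l.
  have h2 : 'C(p, j) <= E.
    apply: leq_trans (bin_le_exp p j) _; apply: leq_trans (leq_exp_base _ hp) _.
    by rewrite eE leq_pexp2l.
  have h3 : L ^ j <= E by apply: leq_trans (leq_exp_base _ hL) _; rewrite eE leq_pexp2l.
  have h4 : 'C(Q + (q - j), q - j) <= (q + d) ^ d.
    rewrite -bin_sub ?leq_addl // addnK.
    apply: leq_trans (bin_le_exp _ _) _.
    apply: (@leq_trans ((q + d) ^ Q)); last by rewrite leq_pexp2l.
    by apply: leq_exp_base; rewrite addnC leq_add // leq_subr.
  have := leq_mul (leq_mul (leq_mul h1 h2) h3) h4; rewrite expnD.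
  by move: ((q + d) ^ c) ((q + d) ^ d) => u v; rewrite -[u * E * E]mulnA (mulnC u) -[_ * u * v]mulnA.
have hX : size (vectors L q p Q) <= q.+1 * (E * E * (q + d) ^ (c + d)).
  rewrite size_vectors -[q.+1 in X in _ <= X]card_ord -sum_nat_const.
  by apply: leq_sum => j _; apply: term.
have hD := exp_le_fact_exp2 (q + d) D.
apply: (@leq_trans (E * E * (q + d) ^ D)).
  apply: (@leq_trans ((q + d) * ((q + d) * (E * E * (q + d) ^ (c + d))))); last first.
    by rewrite eD (expnD _ 2) -mulnn; move: ((q + d) ^ (c + d)) => u; lia.
  apply: leq_mul; first by rewrite leq_add2l.
  by apply: leq_trans hX _; rewrite leq_mul2r; apply/orP; right; lia.
rewrite -!mulnA !leq_mul2l; apply/orP; right; apply/orP; right.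
apply: leq_trans hD _; rewrite leq_mul2l -expnD; apply/orP; right.
by rewrite leq_exp2l //; lia.
Qed.

(** * Saving one power by leaving out one shop *)

Section CountStates.
Variables (m P T L : nat).

(** Forgotten values of [rho] drop out of [fst_sum], so in general it is only at most [P]; the last
    clause keeps the equality that determines the omitted shop when no shop has [rho = 0]. *)
Definition good (v : seq (nat * nat)) : Prop :=
  [/\ size v = m, all (admissible L) v, fst_sum v <= P, T <= snd_sum v <= T + P &
     all (fun x => x.1 != 0) v -> fst_sum v = P].

(* A state is determined by the state without its first idle shop (or, if no shop
   is idle, without its first shop) and one number at most [P] (or less than [L]). *)
Definition squeeze (v : seq (nat * nat)) : nat * nat * seq (nat * nat) :=
  let g := find (fun x => x.1 == 0) v in
  if g < size v then (g, snd_sum v - T, take g v ++ drop g.+1 v)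
  else (g, (head (0, 0) v).2 - (head (0, 0) v).1, behead v).

Definition unsqueeze (c : nat * nat * seq (nat * nat)) : seq (nat * nat) :=
  let: (g, w, v) := c in
  if g < m then take g v ++ (0, T + w - snd_sum v) :: drop g v
  else (P - fst_sum v, P - fst_sum v + w) :: v.

Lemma squeezeK v : 0 < m -> good v -> unsqueeze (squeeze v) = v.
Proof.
move=> hm [sv adm hf hs hall]; rewrite /squeeze.
case: (ltnP (find _ v) (size v)) => hg; rewrite /unsqueeze.
  set g := find _ v in hg *; rewrite -sv hg.
  have hsum : snd_sum v = snd_sum (take g v ++ drop g.+1 v) + (nth (0, 0) v g).2.
    have ev : v = take g v ++ nth (0, 0) v g :: drop g.+1 v.
      by rewrite -drop_nth // cat_take_drop.
    by rewrite {1}ev /snd_sum !big_cat big_cons /= addnCA addnC.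
  have e : T + (snd_sum v - T) - snd_sum (take g v ++ drop g.+1 v) = (nth (0, 0) v g).2.
    by case/andP: hs => h1 h2; rewrite subnKC // hsum addKn.
  rewrite e take_cat drop_cat size_take hg ltnn subnn take0 drop0 cats0.
  have h0 : (nth (0, 0) v g).1 = 0.
    by apply/eqP; apply: (nth_find (0, 0) (a := fun x => x.1 == 0)); rewrite has_find.
  have -> : (0, (nth (0, 0) v g).2) = nth (0, 0) v g.
    by move: h0; case: (nth _ _ _) => x y /= ->.
  by rewrite -drop_nth // cat_take_drop.
have hno : all (fun x => x.1 != 0) v.
  by rewrite all_predC has_find -leqNgt.
have hP := hall hno; rewrite ifN; last by rewrite -leqNgt -sv.
case: v sv adm hP hno {hf hs hall hg} => [|[r t] v]; first by move=> sv; rewrite -sv in hm.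
move=> _ /andP [ha _] hP /andP [/= hr _].
have {hP} e : P - fst_sum v = r by rewrite -hP /fst_sum big_cons /= addnK.
rewrite e subnKC //; move: ha; rewrite /admissible /= (negbTE hr) /=.
by case/andP.
Qed.

Lemma squeeze_mem v a : 0 < m -> P + L = a -> good v ->
  squeeze v \in [seq (gw, x) | gw <- [seq (g, w) | g <- iota 0 m.+1, w <- iota 0 a.+1],
    x <- vectors L m.-1 P (T + P)].
Proof.
move=> hm ha [sv adm hf hs hall]; rewrite /squeeze.
have idle_le u : idle_sum u <= snd_sum u.
  rewrite /idle_sum /snd_sum [X in _ <= X](bigID (fun x => x.1 == 0)) /=; exact: leq_addr.
set g := find _ _; case: (ltnP g (size v)) => hg.
  apply/allpairsP; exists ((g, snd_sum v - T), take g v ++ drop g.+1 v); split=> //.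
    apply/allpairsP; exists (g, snd_sum v - T); split=> //; rewrite (mem_iota 0) leq0n add0n andTb.
      by rewrite ltnS -sv ltnW.
    by clear -hs ha; case/andP: hs => h1 h2; rewrite /=; lia.
  have ev : v = take g v ++ nth (0, 0) v g :: drop g.+1 v by rewrite -drop_nth // cat_take_drop.
  move: hf hs adm; rewrite {1 2 3 4}ev /fst_sum /snd_sum !big_cat !big_cons /= all_cat /=.
  move=> hf hs /and3P [a1 a2 a3].
  apply: mem_vectors.
  - by rewrite size_cat size_take size_drop hg; clear -sv hg; lia.
  - by rewrite all_cat a1.
  - by rewrite /fst_sum big_cat /=; clear -hf; lia.
  - apply: leq_trans (idle_le _) _; rewrite /snd_sum big_cat /=; clear -hs; lia.
have hno : all (fun x => x.1 != 0) v by rewrite all_predC has_find -leqNgt.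
case: v sv adm hf hs hall hno @g hg => [|[r t] v]; first by move=> sv; rewrite -sv in hm.
move=> sv /andP [a1 a2] hf hs _ /andP [hr hno] g hg; rewrite /= in hr.
have {}a1 : r <= t < r + L by move: a1; rewrite /admissible /= (negbTE hr).
rewrite /fst_sum big_cons /= in hf; rewrite /snd_sum !big_cons /= in hs.
rewrite [head _ _]/=.
apply/allpairsP; exists ((g, t - r), v); split=> //.
  apply/allpairsP; exists (g, t - r); split=> //; rewrite (mem_iota 0) leq0n add0n andTb.
    by rewrite ltnS -sv; apply: find_size.
  by move: a1 ha; clear; rewrite /=; lia.
apply: mem_vectors => //; first by rewrite -sv.
  by apply: leq_trans hf; apply: leq_addl.
apply: leq_trans (idle_le _) _; case/andP: hs => _ h; apply: leq_trans h.
exact: leq_addl.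
Qed.

Lemma size_good_le a (Ls : seq (seq (nat * nat))) : 0 < m -> P + L = a -> uniq Ls ->
  (forall v, v \in Ls -> good v) ->
  size Ls <= (m + 1) * (a + 1) * size (vectors L m.-1 P (T + P)).
Proof.
move=> hm ha uL gL.
have -> : (m + 1) * (a + 1) * size (vectors L m.-1 P (T + P)) =
    size [seq (gw, x) | gw <- [seq (g, w) | g <- iota 0 m.+1, w <- iota 0 a.+1],
    x <- vectors L m.-1 P (T + P)].
  by rewrite !size_allpairs !size_iota !addn1.
rewrite -(size_map squeeze); apply: uniq_leq_size.
  rewrite map_inj_in_uniq // => u v /gL hu /gL hv e.
  by rewrite -(squeezeK hm hu) e squeezeK.
by move=> _ /mapP [v /gL hv ->]; apply: squeeze_mem.
Qed.
End CountStates.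

(** The threshold [b = 32] is that of [bin_exp_le]. Below it the first term on the right is given up
    and [m! * b ^ m.-1] carries everything; 32 and 64 then bound [L], [P] and [T + P <= 2 * b]. *)
Theorem count_states : exists C0, forall m a b P T L (Ls : seq (seq (nat * nat))),
  0 < m -> 2 <= b -> a <= b -> P + L = a -> T <= b -> uniq Ls ->
  (forall v, v \in Ls -> good m P T L v) ->
  size Ls * m`! <= C0 * (maxn 1 a ^ (2 * m).-1 + m`! * maxn 1 a * b ^ m.-1).
Proof.
have [K hK] : exists K, forall i, 48 ^ minn i 64 <= K.
  by exists (48 ^ 64) => i; rewrite leq_pexp2l // geq_minr.
have [K2 hK2] := @size_vectors_small 32 64 isT isT.
exists (12 * K + 2 * K2) => [[//|q]] a b P T L Ls _ hb hab ha hT uL gL.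
have := size_good_le (isT : 0 < q.+1) ha uL gL; rewrite [q.+1.-1]/=.
have [A eA] : exists A, A = maxn 1 a by eexists.
have hA1 : 1 <= A by lia.
have haA : a <= A by lia.
rewrite -eA; have -> : (2 * q.+1).-1 = (2 * q).+1 by lia.
have hQ : T + P <= 2 * b by lia.
have hPL : P + L <= a by lia.
move: (size Ls) => N; have [X eX] : exists X, X = size (vectors L q P (T + P)) by eexists.
rewrite -eX => hN.
case: (leqP 32 b) => hb32.
  have h := size_vectors_large q hK hb32 hQ hPL; rewrite -eX in h.
  (* The spare [2 ^ q] pays for [q + 2], the possible positions of the omitted shop, and for
     [q + 1], the quotient of [m!] and [q!]. *)
  have hq : (q + 2) * (q + 1) <= 6 * 2 ^ q.
    elim: (q) => // i IH; rewrite expnS; case: i IH => [|[|i]] // IH; nia.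
  rewrite -(leq_pmul2r (_ : 0 < 2 ^ q)) ?expn_gt0 //.
  have hAq : a ^ (2 * q) <= A ^ (2 * q) by apply: leq_exp_base.
  have hNA : N <= (q + 2) * (2 * A) * X.
    apply: leq_trans hN _; rewrite leq_mul2r; apply/orP; right; apply: leq_mul; lia.
  apply: (@leq_trans ((q + 2) * (q + 1) * (2 * A) * (2 ^ q * q`! * X))).
    rewrite factS; apply: (@leq_trans ((q + 2) * (2 * A) * X * (q.+1 * q`!) * 2 ^ q)).
      by rewrite !leq_mul2r hNA !orbT.
    by rewrite addn1; move: (q`!) (2 ^ q) => f u; lia.
  apply: (@leq_trans (6 * 2 ^ q * (2 * A) * (K * (A ^ (2 * q) + q`! * b ^ q)))).
    apply: leq_mul; first by rewrite leq_mul2r hq orbT.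
    by apply: leq_trans h _; rewrite leq_mul2l leq_add2r hAq orbT.
  rewrite expnS factS; move: (q`!) (2 ^ q) (A ^ (2 * q)) (b ^ q) => f u x y.
  rewrite mulnDl mulnDl; apply: leq_trans (leq_addr _ _).
  rewrite [X in X <= _](_ : _ = 12 * K * (A * x + f * A * y) * u); last by lia.
  by rewrite leq_mul2r leq_mul2l leq_add2l !leq_mul2r mulSn leq_addr !orbT.
have h : (q + 2) * X <= K2 * 2 ^ q by rewrite eX; apply: hK2; lia.
have hbq : 2 ^ q <= b ^ q by apply: leq_exp_base.
apply: (@leq_trans (2 * K2 * (A * b ^ q) * (q.+1)`!)).
  rewrite leq_mul2r; apply/orP; right; apply: leq_trans hN _.
  apply: (@leq_trans ((2 * A) * ((q + 2) * X))).
    rewrite mulnA leq_mul2r; apply/orP; right; rewrite addn1 -addn2 mulnC leq_mul2r.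
    by apply/orP; right; lia.
  rewrite [X in _ <= X](_ : _ = 2 * A * (K2 * b ^ q)); last by move: (b ^ q) => y; lia.
  rewrite leq_mul2l; apply/orP; right; apply: leq_trans h _.
  by rewrite leq_mul2l hbq orbT.
by move: (_`!) (b ^ q) (A ^ _) => f y x; nia.
Qed.

(** * The states of the dynamic program are among the counted ones *)

Section Bridge.
Variables (n a m : nat) (jr jt : nat -> nat).
Local Notation P := (psum jr).
Local Notation T := (psum jt).
Local Notation cs := (cstate a jr jt).
Local Notation ts := (tstate jr jt).
Hypothesis ha : a = P n.

Lemma tstate_mono f k i : (ts f k i).1 <= (ts f k i).2.
Proof. by elim: k => //= k IH; case: eqP => _ //=; lia. Qed.

(* A shop whose first coordinate was forgotten behaves as if it had not been. *)
Lemma cstate_tstate f k i : k <= n ->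
  let p := cs f k i in let q := ts f k i in
  [/\ p.2 = q.2, p.1 = q.1 \/ (p.1 <= q.1 /\ q.1 + (a - P k) <= q.2) &
      p.1 = 0 \/ p.2 < p.1 + (a - P k)].
Proof.
elim: k => [|k IH] hk /=; first by split=> //; left.
have [h1 h2 h3] := IH (ltnW hk).
have hP := @psum_le jr _ _ hk; have hM := tstate_mono f k i.
rewrite /trans psumS in hP *; move: h1 h2 h3 hM.
case: (cs f k i) (ts f k i) => p1 p2 [q1 q2] /= h1 h2 h3 hM.
have {}hP : P k + jr k <= a by rewrite ha.
case: eqP => _; rewrite /canon /step /=.
  by case: ifP => /= hc; split; lia.
by case: ifP => /= hc; split; lia.
Qed.

Lemma last_end_cstate f : last_end m (cs f n) = last_end m (ts f n).
Proof. by apply: eq_bigr => i _; have [] := cstate_tstate f i (leqnn n). Qed.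

Lemma sum_upd (g h : nat -> nat) j : j < m ->
  \sum_(i < m) (if nat_of_ord i == j then g i else h i) + h j = g j + \sum_(i < m) h i.
Proof.
move=> hj; rewrite (bigD1 (Ordinal hj)) //= eqxx [in RHS](bigD1 (Ordinal hj)) //=.
rewrite -addnA; congr (_ + _); rewrite addnC; congr (_ + _).
by apply: eq_bigr => i hi; rewrite ifN.
Qed.

(** A further job raises [tau] of its shop by its T-length plus an idle gap, and the gap is at most
    its R-length because [rho <= tau] before. *)
Lemma tstate_sums f k : (forall c, f c < m) ->
  \sum_(i < m) (ts f k i).1 = P k /\
  T k <= \sum_(i < m) (ts f k i).2 <= T k + P k.
Proof.
move=> hf; elim: k => [|k [IH1 IH2]].
  by rewrite /= !sum_nat_const !muln0 /psum !big_ord0.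
have e1 := sum_upd (fun i => (ts f k i).1 + jr k) (fun i => (ts f k i).1) (hf k).
have e2 := sum_upd (fun i => maxn (ts f k i).2 ((ts f k i).1 + jr k) + jt k)
  (fun i => (ts f k i).2) (hf k).
have hM := tstate_mono f k (f k).
rewrite !psumS.
have -> : \sum_(i < m) (ts f k.+1 i).1 =
    \sum_(i < m) (if nat_of_ord i == f k then (ts f k i).1 + jr k else (ts f k i).1).
  by apply: eq_bigr => i _ /=; case: eqP.
have -> : \sum_(i < m) (ts f k.+1 i).2 =
    \sum_(i < m) (if nat_of_ord i == f k then maxn (ts f k i).2 ((ts f k i).1 + jr k) + jt k
                  else (ts f k i).2).
  by apply: eq_bigr => i _ /=; case: eqP.
split; lia.
Qed.

(** For the last clause of [good]: a nonzero [rho] has lead below the remaining R-length, which is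
    impossible for a shop that was once forgotten, so it is the true value and the true values sum
    to [P k]. *)
Lemma good_cstate f k : (forall c, f c < m) -> k <= n ->
  good m (P k) (T k) (a - P k) (mkseq (cs f k) m).
Proof.
move=> hf hk; have [s1 s2] := tstate_sums k hf.
have sum_mk (F : nat * nat -> nat) : \sum_(x <- mkseq (cs f k) m) F x = \sum_(i < m) F (cs f k i).
  by rewrite big_map -(big_mkord xpredT (fun i => F (cs f k i))) /index_iota subn0.
have rel i := cstate_tstate f i hk.
split.
- by rewrite size_mkseq.
- apply/allP => x /mapP [i _ ->]; rewrite /admissible.
  have [h1 h2 h3] := rel i; have h4 := tstate_mono f k i; move: h1 h2 h3 h4.
  case: (cs f k i) (ts f k i) => p1 p2 [q1 q2] /= h1 h2 h3 h4.
  by case: eqP => //= ?; lia.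
- rewrite /fst_sum sum_mk -s1; apply: leq_sum => i _.
  by have [h1 [->|[h2 _]] h3] := rel i.
- rewrite /snd_sum sum_mk (eq_bigr (fun i : 'I_m => (ts f k i).2)) // => i _.
  by have [] := rel i.
- move=> /allP hall; rewrite /fst_sum sum_mk -s1; apply: eq_bigr => i _.
  have hi : cs f k i \in mkseq (cs f k) m by apply: map_f; rewrite mem_iota ltn_ord.
  have [h1 h2 h3] := rel i; move: h1 h2 h3 (hall _ hi).
  case: (cs f k i) (ts f k i) => p1 p2 [q1 q2] /= h1 h2 h3 /eqP; lia.
Qed.
End Bridge.

Lemma layer_cap : exists C0, forall n a b m M (jr jt : nat -> nat),
  0 < m -> 2 <= b -> a <= b -> a = psum jr n -> psum jt n = b -> a + b < M ->
  exists N, N * m`! <= C0 * (maxn 1 a ^ (2 * m).-1 + m`! * maxn 1 a * b ^ m.-1) /\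
  forall k (l : seq nat), k <= n -> uniq l ->
    (forall key, key \in l -> exists2 f, fok m f & key = code M m (cstate a jr jt f k)) ->
    size l <= N.
Proof.
have [C0 hC] := count_states; exists C0 => n a b m M jr jt hm hb hab ha hT hM.
set B := C0 * _; exists (B %/ m`!); split; first exact: leq_divM.
move=> k l hk ul hl; rewrite leq_divRL ?fact_gt0 //.
pose dec key := mkseq (decode M key) m.
have hP := @psum_le jr _ _ hk; have hTk := @psum_le jt _ _ hk.
have sm f : small M m (cstate a jr jt f k) by apply: cstate_small; lia.
have hdec key : key \in l -> exists f, [/\ fok m f, key = code M m (cstate a jr jt f k) &
    dec key = mkseq (cstate a jr jt f k) m].
  move=> /hl [f hf e]; exists f; split=> //.
  by apply/eq_in_map => i; rewrite mem_iota => hi; rewrite e decode_code.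
rewrite -(size_map dec); apply: (hC m a b (psum jr k) (psum jt k) (a - psum jr k)) => //.
- by rewrite subnKC // ha.
- by rewrite -hT.
- rewrite map_inj_in_uniq // => x y /hdec [f [_ -> ->]] /hdec [g [_ -> ->]] e.
  apply: code_eq => i hi.
  by rewrite -(nth_mkseq (0, 0) (cstate a jr jt f k) hi) e nth_mkseq.
- move=> v /mapP [key /hdec [f [hf _ ->]] ->].
  exact: (good_cstate _ ha).
Qed.

(** * Schedules *)

Import Order.TTheory GRing.Theory Num.Theory.

Local Open Scope ring_scope.

Section Intervals.
Variable R : realFieldType.
Implicit Types (s x lo hi c : R) (l : nat).

Lemma disjointP s1 l1 s2 l2 :
  (forall x, ~~ (running s1 l1 x && running s2 l2 x)) <->
  [\/ l1 = 0%N, l2 = 0%N, s1 + l1%:R <= s2 | s2 + l2%:R <= s1].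
Proof.
split=> [h|[->|->|h|h] x].
- case: (posnP l1) => [->|h1]; first exact: Or41.
  case: (posnP l2) => [->|h2]; first exact: Or42.
  have p1 : 0 < l1%:R :> R by rewrite ltr0n.
  have p2 : 0 < l2%:R :> R by rewrite ltr0n.
  case: (leP s1 s2) => h12.
    apply: Or43; rewrite leNgt; apply/negP => h3.
    have := h s2; rewrite /running h12 h3 lexx /=; lra.
  apply: Or44; rewrite leNgt; apply/negP => h3.
  by have := h s1; rewrite /running (ltW h12) h3 lexx /=; lra.
- by rewrite /running; apply/negP; lra.
- by rewrite /running; apply/negP; lra.
- by rewrite /running; apply/negP; lra.
- by rewrite /running; apply/negP; lra.
Qed.

(** Induction on the number of operations, removing one that starts last: the others of positive
    length end before it starts and so fit before it. If the removed operation has length zero it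
    constrains nothing and is simply dropped. *)
Lemma packing (I : finType) (A : {set I}) (s : I -> R) (l : I -> nat) lo hi :
  lo <= hi ->
  (forall j k, j \in A -> k \in A -> j != k ->
     forall x, ~~ (running (s j) (l j) x && running (s k) (l k) x)) ->
  (forall k, k \in A -> lo <= s k /\ s k + (l k)%:R <= hi) ->
  (\sum_(k in A) l k)%:R <= hi - lo.
Proof.
have [N hN] : exists N, (#|A| <= N)%N by exists #|A|.
elim: N A hi hN => [|N IH] A hi hN hlh hd hb.
  move: hN; rewrite leqn0 cards_eq0 => /eqP ->; rewrite big_set0; lra.
case: (set_0Vmem A) => [->|[k0 hk0]]; first by rewrite big_set0; lra.
have [k hk hmax] : exists2 k, k \in A & forall j, j \in A -> s j <= s k.
  have := @arg_maxP _ R I k0 (mem A) s hk0; case=> k hk h.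
  by exists k => // j /h.
have [hlk hkh] := hb _ hk.
have lk0 : 0 <= (l k)%:R :> R by rewrite ler0n.
have card' : (#|A :\ k| <= N)%N by move: hN; rewrite (cardsD1 k) hk.
rewrite (big_setD1 k) //= natrD.
case: (posnP (l k)) => [lk|lk].
  rewrite lk add0r; apply: IH => //.
  - by move=> i j; rewrite !inE => /andP [_ hi'] /andP [_ hj']; apply: hd.
  - by move=> j; rewrite inE => /andP [_ /hb].
have : (\sum_(j in A :\ k) l j)%:R <= s k - lo.
  apply: IH => //.
    by move=> i j; rewrite !inE => /andP [_ hi'] /andP [_ hj']; apply: hd.
  move=> j; rewrite !inE => /andP [jk hj]; have [h1 h2] := hb _ hj; split=> //.
  have := hmax _ hj; have := (disjointP _ _ _ _).1 (hd _ _ hj hk jk).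
  case=> [->|e|//|h] hle; first by rewrite addr0.
    by rewrite e in lk.
  have := ltr0n R (l k); rewrite lk => h3; lra.
lra.
Qed.

End Intervals.

(** * The lower bound for an arbitrary schedule *)

Section LowerBound.
Variables (R : realFieldType) (n m : nat) (r t : 'I_n -> nat) (S : schedule R n m).
Hypothesis hS : feasible r t S.
Local Notation D := (makespan t S).

Lemma makespan_ge0 : 0 <= D.
Proof. exact: bigmax_ge_id. Qed.

Lemma end_le_makespan k : startT S k + (t k)%:R <= D.
Proof.
rewrite /makespan (bigD1 (shop S k)) //= /completion (bigD1 k) //=.
by rewrite !le_max lexx.
Qed.

(* Everything that the R-processor of a shop finishes by time [c], followed by
   everything that its T-processor starts from [c] on, fits within the makespan. *)
Lemma cut_bound (i : 'I_m) (A B : {set 'I_n}) (c : R) :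
  (forall k, k \in A -> shop S k = i /\ startR S k + (r k)%:R <= c) ->
  (forall k, k \in B -> shop S k = i /\ c <= startT S k) ->
  0 <= c -> c <= D -> (\sum_(k in A) r k + \sum_(k in B) t k)%:R <= D.
Proof.
move=> hA hB c0 cD; have [h1 h2 h3 h4] := hS.
have pA : (\sum_(k in A) r k)%:R <= c - 0.
  apply: (packing (s := startR S)) => // [j k /hA [e1 _] /hA [e2 _] jk x|k /hA [_ hk]] //.
  by apply: h3 => //; rewrite e1 e2.
have pB : (\sum_(k in B) t k)%:R <= D - c.
  apply: (packing (s := startT S)) => // [j k /hB [e1 _] /hB [e2 _] jk x|k /hB [_ hk]] //.
    by apply: h4 => //; rewrite e1 e2.
  by split=> //; apply: end_le_makespan.
by rewrite natrD; lra.
Qed.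

Lemma start_le_makespan k : startT S k <= D.
Proof. have := end_le_makespan k; have := ler0n R (t k); lra. Qed.

Variable p : 'I_n -> nat.
Hypothesis inj_p : injective p.
Hypothesis hG1 : forall j k, (p j <= p k)%N -> (r k <= t k)%N -> (r j <= t j)%N /\ (r j <= r k)%N.
Hypothesis hG2 : forall j k, (p j <= p k)%N -> (t j < r j)%N -> (t k < r k)%N /\ (t k <= t j)%N.

(** For any cut [c], a job of this shop contributes at least the smaller of its two lengths to
    [cut_bound], because its R-operation ends by [c] or its T-operation starts from [c] on. If
    [r j <= t j], Johnson's order makes this enough for all jobs before [j] and for the later ones
    with [t < r]. The later ones with [r <= t] must contribute [t], which holds if [c] is the first
    completion of an R-operation among them and [j]; the job [y] attaining it contributes both
    lengths, and [r j <= r y] pays for the second operation of [j]. The other case is the mirror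
    image. *)
Lemma johnson_bound (j : 'I_n) :
  (\sum_(k | (shop S k == shop S j) && (p k <= p j)%N) r k +
   \sum_(k | (shop S k == shop S j) && (p j <= p k)%N) t k)%:R <= D.
Proof.
have [h1 h2 _ _] := hS.
set i := shop S j; pose K := [set k | shop S k == i].
pose e k := startR S k + (r k)%:R.
have e0 k : 0 <= e k by have := h1 k; have := ler0n R (r k); rewrite /e; lra.
(* The job [y] at the cut is the one that contributes both of its operations. *)
have finish (y : 'I_n) (c : R) (A B : {set 'I_n}) (w : 'I_n -> nat) (x : nat) :
    (forall k, k \in A -> shop S k = i /\ e k <= c) ->
    (forall k, k \in B -> shop S k = i /\ c <= startT S k) -> 0 <= c -> c <= D ->
    (forall k, k \in K -> (w k <= r k * (k \in A) + t k * (k \in B))%N) ->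
    y \in A -> y \in B -> (w y + x <= r y + t y)%N ->
    (\sum_(k in K) w k + x)%:R <= D.
  move=> hA hB c0 cD hw yA yB hx; apply: le_trans (cut_bound hA hB c0 cD).
  rewrite ler_nat.
  have yK : y \in K by rewrite inE; have [-> _] := hA _ yA; rewrite eqxx.
  have subA : A \subset K by apply/subsetP => k /hA [e1 _]; rewrite inE e1.
  have subB : B \subset K by apply/subsetP => k /hB [e1 _]; rewrite inE e1.
  have sumE (F : 'I_n -> nat) (C : {set 'I_n}) : C \subset K ->
      (\sum_(k in C) F k = \sum_(k in K) F k * (k \in C))%N.
    move=> sC; rewrite [in RHS](big_setID C) /= (setIidPr sC) [X in (_ = _ + X)%N]big1 ?addn0; last first.
      by move=> k; rewrite inE => /andP [/negbTE -> _]; rewrite muln0.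
    by apply: eq_bigr => k ->; rewrite muln1.
  rewrite (sumE _ A) // (sumE _ B) // -big_split /= (big_setD1 y) //= [X in (_ <= X)%N](big_setD1 y) //=.
  rewrite addnAC; apply: leq_add; first by rewrite yA yB !muln1.
  by apply: leq_sum => k; rewrite inE => /andP [_ /hw].
(* As [p] is injective, [j] is the only job occurring in both sums; [x] carries its second
   operation. *)
have split_sum (w : 'I_n -> nat) (x : nat) : (forall k, k != j -> w k = if (p k <= p j)%N then r k else t k) ->
    (w j + x = r j + t j)%N ->
    (\sum_(k | (shop S k == i) && (p k <= p j)%N) r k +
     \sum_(k | (shop S k == i) && (p j <= p k)%N) t k = \sum_(k in K) w k + x)%N.
  move=> hw hx; have jK : j \in K by rewrite inE.
  rewrite (bigD1 j) ?eqxx ?leqnn //= [X in (_ + X)%N](bigD1 j) ?eqxx ?leqnn //=.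
  rewrite addnACA -hx [in RHS](bigD1 j) //= [in RHS]addnAC; congr addn.
  rewrite [in RHS](bigID (fun k => (p k <= p j)%N)) /=; congr addn; apply: eq_big => k.
  - by rewrite inE; case: (shop S k == i); rewrite //= andbC.
  - by move=> /andP [/andP [_ h] kj]; rewrite hw // h.
  - rewrite inE; case: (shop S k == i) => //=; rewrite andbC; case: eqVneq => //= kj.
    have : p k != p j by apply: contra kj => /eqP/inj_p ->.
    by clear; lia.
  - move=> /andP [/andP [_ h] kj]; rewrite hw //; case: leqP => // h'.
    by case/eqP: kj; apply: inj_p; apply/eqP; rewrite eqn_leq h'.
have inAB k (c : R) : k \in K -> (r k <= t k)%N -> (r k <= r k * (k \in [set k in K | (e k <= c)%R]) +
    t k * (k \in [set k in K | (c <= startT S k)%R]))%N.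
  move=> kK hk; rewrite !inE; move: kK; rewrite inE => -> /=.
  case: (leP (e k) c) => [_|hc]; first by rewrite muln1 leq_addr.
  have hc2 : c <= startT S k by apply: le_trans (ltW hc) (h2 k).
  by rewrite hc2 muln1 muln0.
have inAB2 k (c : R) : k \in K -> (t k < r k)%N -> (t k <= r k * (k \in [set k in K | (e k <= c)%R]) +
    t k * (k \in [set k in K | (c <= startT S k)%R]))%N.
  move=> kK hk; rewrite !inE; move: kK; rewrite inE => -> /=.
  case: (leP (e k) c) => [_|hc]; first by rewrite muln1 (leq_trans (ltnW hk)) ?leq_addr.
  have hc2 : c <= startT S k by apply: le_trans (ltW hc) (h2 k).
  by rewrite hc2 muln1 muln0.
have core (y : 'I_n) (c : R) (w : 'I_n -> nat) (x : nat) :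
    y \in K -> e y <= c -> c <= startT S y -> (w y + x <= r y + t y)%N ->
    (forall k, k \in K -> (w k <= r k * (k \in [set k in K | (e k <= c)%R]) +
       t k * (k \in [set k in K | (c <= startT S k)%R]))%N) ->
    (\sum_(k in K) w k + x)%:R <= D.
  move=> yK y1 y2 hx hw; apply: (finish y c _ _ w x _ _ _ _ hw) => //.
  - by move=> k; rewrite !inE => /andP [/eqP].
  - by move=> k; rewrite !inE => /andP [/eqP].
  - by apply: le_trans y1.
  - by apply: le_trans y2 (start_le_makespan y).
  - by rewrite inE yK.
  - by rewrite inE yK.
pose w x k := if k == j then x else if (p k <= p j)%N then r k else t k.
case: (leqP (r j) (t j)) => hj.
- (* cut at the first completion among the jobs after [j] with [r <= t] *)
  pose Y := [set k in K | (p j <= p k)%N && (r k <= t k)%N].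
  have jY : j \in Y by rewrite !inE eqxx leqnn hj.
  have [y yY ymin] : exists2 y, y \in Y & forall k, k \in Y -> e y <= e k.
    have := @arg_minP _ R _ j (mem Y) e jY; case=> y yY h.
    by exists y => // k /h.
  have := yY; rewrite inE => /and3P [yK yp yrt].
  have [_ hry] := hG1 yp yrt.
  rewrite (split_sum (w (t j)) (r j)).
  + apply: (core y (e y)) => //; first exact: h2.
      rewrite /w; case: eqVneq => [->|yj]; first by rewrite addnC.
      rewrite ifN; first by rewrite addnC leq_add2r.
      by apply: contra yj => hyj; apply/eqP/inj_p/eqP; rewrite eqn_leq hyj.
    move=> k kK; rewrite /w.
    have hB : k \in Y -> (t k <= r k * (k \in [set k in K | (e k <= e y)%R]) +
       t k * (k \in [set k in K | (e y <= startT S k)%R]))%N.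
      move=> kY; rewrite [X in (_ <= _ + _ * nat_of_bool X)%N](_ : _ = true) ?muln1 ?leq_addl //.
      by rewrite inE kK; apply: le_trans (ymin _ kY) (h2 k).
    case: eqVneq => [ekj|kj]; first by rewrite -{1}ekj; apply: hB; rewrite ekj.
    case: (leqP (p k) (p j)) => hkj; first by apply: inAB => //; case: (hG1 hkj hj).
    case: (leqP (r k) (t k)) => hrt; last exact: inAB2.
    by apply: hB; rewrite inE kK (ltnW hkj).
  + by move=> k kj; rewrite /w (negbTE kj).
  + by rewrite /w eqxx addnC.
- (* cut at the last start of a T-operation among the jobs before [j] with [t < r] *)
  pose Y := [set k in K | (p k <= p j)%N && (t k < r k)%N].
  have jY : j \in Y by rewrite !inE eqxx leqnn hj.
  have [y yY ymax] : exists2 y, y \in Y & forall k, k \in Y -> startT S k <= startT S y.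
    have := @arg_maxP _ R _ j (mem Y) (startT S) jY; case=> y yY h.
    by exists y => // k /h.
  have := yY; rewrite inE => /and3P [yK yp yrt].
  have [_ hty] := hG2 yp yrt.
  rewrite (split_sum (w (r j)) (t j)).
  + apply: (core y (startT S y)) => //; first exact: h2.
      rewrite /w; case: eqVneq => [->//|yj].
      by rewrite yp leq_add2l.
    move=> k kK; rewrite /w.
    have hA : k \in Y -> (r k <= r k * (k \in [set k in K | (e k <= startT S y)%R]) +
       t k * (k \in [set k in K | (startT S y <= startT S k)%R]))%N.
      move=> kY; rewrite [X in (_ <= _ * nat_of_bool X + _)%N](_ : _ = true) ?muln1 ?leq_addr //.
      by rewrite inE kK; apply: le_trans (h2 k) (ymax _ kY).
    case: eqVneq => [ekj|kj]; first by rewrite -{1}ekj; apply: hA; rewrite ekj.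
    case: (leqP (p k) (p j)) => hkj; last by apply: inAB2 => //; case: (hG2 (ltnW hkj) hj).
    case: (leqP (r k) (t k)) => hrt; first exact: inAB.
    by apply: hA; rewrite inE kK hkj.
  + by move=> k kj; rewrite /w (negbTE kj).
  + by rewrite /w eqxx.
Qed.
End LowerBound.

(** * The critical job of a shop *)

Section Critical.
Variables (jr jt f : nat -> nat).
Local Notation ts := (tstate jr jt f).
Local Open Scope nat_scope.

Lemma tstate_fst k i : (ts k i).1 = \sum_(c < k | f c == i) jr c.
Proof.
elim: k => [|k IH] /=; first by rewrite big_ord0.
rewrite big_mkcond big_ord_recr -big_mkcond /= eq_sym -IH.
by case: eqP => //= _; rewrite addn0.
Qed.

(** [c] is the last job of the shop whose T-operation starts as soon as its R-operation ends: up to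
    there the R-processor works without a break, from there on the T-processor does. *)
Lemma tstate_critical k i : (ts k i).2 = 0 \/ exists c, [/\ c < k, f c = i &
  (ts k i).2 = \sum_(c' < k | (f c' == i) && (c' <= c)) jr c' +
               \sum_(c' < k | (f c' == i) && (c <= c')) jt c'].
Proof.
elim: k => [|k IH] /=; first by left.
have recr (F : nat -> nat) (p : pred nat) : \sum_(c' < k.+1 | p c') F c' =
    \sum_(c' < k | p c') F c' + (if p k then F k else 0).
  by rewrite big_mkcond big_ord_recr -big_mkcond.
case: eqP => [eik|nik]; last first.
  case: IH => [->|[c [ck fc ->]]]; [by left|right; exists c; split=> //; first by lia].
  rewrite (recr jr (fun c' => (f c' == i) && (c' <= c))).
  rewrite (recr jt (fun c' => (f c' == i) && (c <= c'))) /=.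
  by have -> : (f k == i) = false; [apply/eqP => e; apply: nik|rewrite !addn0].
rewrite /step /=; right.
case: (leqP (ts k i).2 ((ts k i).1 + jr k)) => hle.
  exists k; split=> //.
  rewrite (recr jr (fun c' => (f c' == i) && (c' <= k))) -eik eqxx leqnn /=.
  rewrite (recr jt (fun c' => (f c' == i) && (k <= c'))) -eik eqxx leqnn /=.
  rewrite [X in _ = _ + (X + _)]big_pred0 ?add0n.
    rewrite eik tstate_fst; congr (_ + _ + _); apply: eq_bigl => c'.
    by rewrite (ltnW (ltn_ord c')) andbT.
  by move=> c'; rewrite leqNgt ltn_ord andbF.
case: IH => [e0|[c [ck fc e]]]; first by rewrite e0 in hle.
exists c; split=> //; first by lia.
rewrite (recr jr (fun c' => (f c' == i) && (c' <= c))).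
rewrite (recr jt (fun c' => (f c' == i) && (c <= c'))) /=.
by rewrite -eik eqxx (leqNgt k c) ck (ltnW ck) /= addn0 addnA -e.
Qed.

Lemma tstate_mono_k k k' i : k <= k' -> (ts k i).1 <= (ts k' i).1 /\ (ts k i).2 <= (ts k' i).2.
Proof.
move/subnK => <-; elim: (k' - k) => //= d [IH1 IH2].
by case: eqP => _ //=; lia.
Qed.

Lemma start1_end c : start1 jr jt f c + jr c = (ts c.+1 (f c)).1.
Proof. by rewrite /= eqxx. Qed.

Lemma start2_end c : start2 jr jt f c + jt c = (ts c.+1 (f c)).2.
Proof. by rewrite /= eqxx. Qed.

Lemma endtime_le_last n m : (forall c, f c < m) -> endtime n jr jt f <= last_end m (ts n).
Proof.
move=> hf; apply/bigmax_leqP => c _; rewrite start2_end.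
apply: leq_trans (proj2 (tstate_mono_k (f c) (ltn_ord c))) _.
exact: (leq_bigmax (F := fun i : 'I_m => (ts n i).2) (Ordinal (hf c))).
Qed.

End Critical.

(** * The schedule of an assignment, and the reversal of schedules *)

Section Simulated.
Variables (R : realFieldType) (n m : nat) (r t : 'I_n -> nat) (jr jt f : nat -> nat).
Variable p : 'I_n -> nat.
Hypothesis pn : forall J, (p J < n)%N.
Hypothesis inj_p : injective p.
Hypothesis hr : forall J, jr (p J) = r J.
Hypothesis ht : forall J, jt (p J) = t J.
Hypothesis hf : forall c, (f c < m)%N.

Definition simulated : schedule R n m := Schedule (fun J => Ordinal (hf (p J)))
  (fun J => (start1 jr jt f (p J))%:R) (fun J => (start2 jr jt f (p J))%:R).

Lemma simulated_feasible : feasible r t simulated.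
Proof.
split=> /=.
- by move=> k; rewrite ler0n.
- by move=> k; rewrite -natrD ler_nat -hr /start2 leq_maxr.
- have main j k x : (p j < p k)%N -> f (p j) = f (p k) ->
    ~~ (running ((start1 jr jt f (p j))%:R : R) (r j) x && running (start1 jr jt f (p k))%:R (r k) x).
    move=> hp e; apply/(disjointP _ _ _ _).2: x; apply: Or43.
    rewrite -natrD ler_nat -hr start1_end /start1 -e.
    by case: (tstate_mono_k jr jt f (f (p j)) hp).
  move=> j k x jk [e]; case: (ltngtP (p j) (p k)) => hp.
  + exact: main.
  + by rewrite andbC; apply: main.
  + by move/eqP: jk; case; apply: inj_p.
- have main j k x : (p j < p k)%N -> f (p j) = f (p k) ->
    ~~ (running ((start2 jr jt f (p j))%:R : R) (t j) x && running (start2 jr jt f (p k))%:R (t k) x).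
    move=> hp e; apply/(disjointP _ _ _ _).2: x; apply: Or43.
    rewrite -natrD ler_nat -ht start2_end /start2 -e.
    apply: leq_trans (leq_maxl _ _).
    by case: (tstate_mono_k jr jt f (f (p j)) hp).
  move=> j k x jk [e]; case: (ltngtP (p j) (p k)) => hp.
  + exact: main.
  + by rewrite andbC; apply: main.
  + by move/eqP: jk; case; apply: inj_p.
Qed.

Lemma end_le_endtime J : (start2 jr jt f (p J) + t J <= endtime n jr jt f)%N.
Proof.
rewrite -ht; exact: (leq_bigmax (F := fun c : 'I_n => (start2 jr jt f c + jt c)%N) (Ordinal (pn J))).
Qed.

Lemma makespan_le (S : schedule R n m) (D : R) : 0 <= D ->
  (forall k, startT S k + (t k)%:R <= D) -> makespan t S <= D.
Proof.
by move=> D0 h; apply/bigmax_leP; split=> // i _; apply/bigmax_leP; split.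
Qed.

Lemma simulated_makespan : makespan t simulated <= (endtime n jr jt f)%:R.
Proof.
by apply: makespan_le => [|k /=]; rewrite ?ler0n // -natrD ler_nat end_le_endtime.
Qed.
End Simulated.

Section Reversal.
Variables (R : realFieldType) (n m : nat) (r t : 'I_n -> nat).

Definition reversed (D : R) (S : schedule R n m) : schedule R n m :=
  Schedule (shop S) (fun k => D - (startT S k + (t k)%:R)) (fun k => D - (startR S k + (r k)%:R)).

Lemma reversed_feasible D S : feasible r t S -> (forall k, startT S k + (t k)%:R <= D) ->
  feasible t r (reversed D S).
Proof.
move=> [h1 h2 h3 h4] hD; split=> /=.
- by move=> k; rewrite subr_ge0.
- by move=> k; have := h2 k; lra.
- move=> j k x jk e; apply/(disjointP _ _ _ _).2: x.
  case: ((disjointP _ _ _ _).1 (fun x => h4 j k x jk e)) => [->|->|h|h].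
  + exact: Or41.
  + exact: Or42.
  + by apply: Or44; lra.
  + by apply: Or43; lra.
- move=> j k x jk e; apply/(disjointP _ _ _ _).2: x.
  case: ((disjointP _ _ _ _).1 (fun x => h3 j k x jk e)) => [->|->|h|h].
  + exact: Or41.
  + exact: Or42.
  + by apply: Or44; lra.
  + by apply: Or43; lra.
Qed.

(** The T-operations of the reversed schedule are the former R-operations, so nonnegative start
    times bound their ends by [D]. *)
Lemma reversed_makespan D S : feasible r t S -> 0 <= D -> makespan r (reversed D S) <= D.
Proof. by move=> [h1 _ _ _] D0; apply: makespan_le => //= k; have := h1 k; lra. Qed.
End Reversal.

(** * Optimality of Johnson's order on each shop *)

Definition ext (n : nat) (u : 'I_n -> nat) (k : nat) : nat :=
  if insub k is Some i then u i else 0%N.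

Lemma extE n (u : 'I_n -> nat) (i : 'I_n) : ext u i = u i.
Proof. by rewrite /ext valK. Qed.

Lemma psum_ext n (u : 'I_n -> nat) : psum (ext u) n = (\sum_(k < n) u k)%N.
Proof. by apply: eq_bigr => i _; rewrite extE. Qed.

Section Johnson.
Variables (n : nat) (r t : 'I_n -> nat).
Local Notation rn := (ext r).
Local Notation tn := (ext t).
Local Notation a := (psum rn n).
Local Notation ord := (jorder n a rn tn).
Local Notation o := (nth 0%N ord).
Local Notation key := (jkey a rn tn).

Definition position (J : 'I_n) : nat := index (nat_of_ord J) ord.

Lemma rn_le k : (k < n)%N -> (rn k <= a)%N.
Proof.
move=> hk; rewrite /psum (bigD1 (Ordinal hk)) //=; exact: leq_addr.
Qed.

Lemma mem_jorder k : (k \in ord) = (k < n)%N.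
Proof. by rewrite (perm_mem (perm_jorder tn rn_le)) mem_iota. Qed.

Lemma uniq_jorder : uniq ord.
Proof. by rewrite (perm_uniq (perm_jorder tn rn_le)) iota_uniq. Qed.

Lemma jorder_size : size ord = n.
Proof. exact: size_jorder rn_le. Qed.

Lemma position_lt J : (position J < n)%N.
Proof. by rewrite -[X in (_ < X)%N]jorder_size /position index_mem mem_jorder ltn_ord. Qed.

Lemma nth_position J : o (position J) = J.
Proof. by rewrite /position nth_index // mem_jorder ltn_ord. Qed.

Lemma position_inj : injective position.
Proof. by move=> j k e; apply: val_inj; rewrite /= -nth_position e nth_position. Qed.

Lemma nth_jorder_lt c : (c < n)%N -> (o c < n)%N.
Proof. by move=> hc; rewrite -mem_jorder mem_nth // jorder_size. Qed.

Definition job_at (c : 'I_n) : 'I_n := Ordinal (nth_jorder_lt (ltn_ord c)).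

Lemma position_job_at c : position (job_at c) = c.
Proof. by rewrite /position /= index_uniq // ?uniq_jorder // jorder_size. Qed.

Lemma job_at_inj : injective job_at.
Proof. by move=> c d e; apply: val_inj; rewrite /= -position_job_at e position_job_at. Qed.

Lemma jorder_key J K : (position J <= position K)%N -> (key J <= key K)%N.
Proof.
have hp : pairwise (fun x y => (key x <= key y)%N) ord.
  apply: (pairwise_bsort (r := fun _ _ => true)) => [x y /ltnW //|x y -> //|].
  by apply/(pairwiseP 0%N).
rewrite leq_eqVlt => /orP [/eqP /position_inj -> //|h].
rewrite -(nth_position J) -(nth_position K).
by apply: (pairwiseP 0%N hp) => //; rewrite inE jorder_size position_lt.
Qed.

Lemma jorder_G1 j k : (position j <= position k)%N -> (r k <= t k)%N ->
  (r j <= t j)%N /\ (r j <= r k)%N.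
Proof.
move/jorder_key; have := rn_le (ltn_ord j); have := rn_le (ltn_ord k).
by rewrite /jkey !extE => h1 h2; case: (leqP (r j) (t j)); case: (leqP (r k) (t k)) => *; split; lia.
Qed.

Lemma jorder_G2 j k : (position j <= position k)%N -> (t j < r j)%N ->
  (t k < r k)%N /\ (t k <= t j)%N.
Proof.
move/jorder_key; have := rn_le (ltn_ord j); have := rn_le (ltn_ord k).
by rewrite /jkey !extE => h1 h2; case: (leqP (r j) (t j)); case: (leqP (r k) (t k)) => *; split; lia.
Qed.

Definition at_position (u : nat -> nat) (c : nat) : nat := u (o c).
Local Notation jr := (at_position rn).
Local Notation jt := (at_position tn).

Lemma at_positionE (u : 'I_n -> nat) J : at_position (ext u) (position J) = u J.
Proof. by rewrite /at_position nth_position extE. Qed.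

Lemma psum_at_position (u : 'I_n -> nat) : psum (at_position (ext u)) n = (\sum_(k < n) u k)%N.
Proof.
rewrite [RHS](reindex_inj job_at_inj); apply: eq_bigr => c _.
by rewrite -[in RHS](at_positionE u) position_job_at.
Qed.

Variables (R : realFieldType) (m : nat) (S : schedule R n m).
Hypothesis hS : feasible r t S.

(** The assignment of an arbitrary schedule, indexed by positions in Johnson's order. The value 0
    beyond the last position keeps it below [m], as is required of assignments. *)
Definition shops_of (c : nat) : nat := if insub (o c) is Some J then shop S J : nat else 0%N.

Lemma shops_of_position J : shops_of (position J) = shop S J.
Proof. by rewrite /shops_of nth_position valK. Qed.

Lemma shops_of_lt c : (0 < m)%N -> (shops_of c < m)%N.
Proof. by rewrite /shops_of; case: insub => [J|//]; rewrite ltn_ord. Qed.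

(** The critical job turns the completion time of the shop into exactly the two sums of
    [johnson_bound]. Hence keeping the assignment of a schedule and reordering by Johnson's rule
    never increases the makespan. *)
Lemma shops_of_bound i : ((tstate jr jt shops_of n i).2)%:R <= makespan t S.
Proof.
have [->|[c [hc fc ->]]] := tstate_critical jr jt shops_of n i.
  exact: makespan_ge0.
set J := job_at (Ordinal hc).
have pJ : position J = c by rewrite position_job_at.
have iE : shop S J = i :> nat by rewrite -shops_of_position pJ.
have := johnson_bound hS position_inj jorder_G1 jorder_G2 J.
have eqP' c' : (shop S (job_at c') == shop S J) = (shops_of c' == i).
  by rewrite -val_eqE /= iE -shops_of_position position_job_at.
congr (_%:R <= _); congr addn; rewrite (reindex_inj job_at_inj) /=; apply: eq_big => k.
- by rewrite position_job_at pJ eqP'.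
- by move=> _; rewrite -(at_positionE r) position_job_at.
- by rewrite position_job_at pJ eqP'.
- by move=> _; rewrite -(at_positionE t) position_job_at.
Qed.

Lemma last_end_shops_of : (0 < m)%N -> (last_end m (tstate jr jt shops_of n))%:R <= makespan t S.
Proof.
case: m S hS shops_of_bound => [//|m'] S' hS' hb _; rewrite /last_end.
have [|i ->] := @bigop.eq_bigmax _ (fun i : 'I_m'.+1 => (tstate jr jt shops_of n i).2).
  by rewrite card_ord.
exact: hb.
Qed.

End Johnson.

(** * Instances settled by a single shop *)

Section OneShop.
Variables (n : nat) (r t : 'I_n -> nat).
Local Notation a := (psum (ext r) n).
Local Notation jr := (at_position r t (ext r)).
Local Notation jt := (at_position r t (ext t)).
Variables (R : realFieldType) (m : nat) (S : schedule R n m).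
Hypothesis hS : feasible r t S.
Hypothesis hm : (0 < m)%N.

Lemma eq_tstate ur ut f g k : (forall c, (c < k)%N -> f c = g c) ->
  tstate ur ut f k =1 tstate ur ut g k.
Proof.
elim: k => //= k IH h i; rewrite h // IH // => c hc; apply: h; exact: ltnW.
Qed.

Lemma one_shop_single : m = 1%N ->
  (last_end m (tstate jr jt (fun=> 0%N) n))%:R <= makespan t S.
Proof.
move=> m1; have := last_end_shops_of hS hm; congr (_%:R <= _).
apply: eq_bigr => i _; congr (_.2); apply: eq_tstate => c _.
by have := shops_of_lt r t S c hm; rewrite [X in (_ < X)%N]m1; case: shops_of.
Qed.

(* With at most one unit of work on each side, running everything on one shop in
   Johnson's order is already optimal. *)
Lemma one_shop_tiny : (\sum_k r k <= 1)%N -> (\sum_k t k <= 1)%N ->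
  (last_end m (tstate jr jt (fun=> 0%N) n))%:R <= makespan t S.
Proof.
move=> hr ht.
have D0 := makespan_ge0 t S.
have jobD k : (r k + t k)%:R <= makespan t S.
  have [h1 h2 _ _] := hS; have := end_le_makespan t S k; have := h1 k; have := h2 k.
  by rewrite natrD; lra.
have one k : (r k != 0)%N || (t k != 0)%N -> 1 <= makespan t S.
  by move=> hk; apply: le_trans (jobD k); rewrite ler1n; lia.
rewrite /last_end; have [|i ->] := @bigop.eq_bigmax _ (fun i : 'I_m => (tstate jr jt (fun=> 0%N) n i).2).
  by rewrite card_ord.
have [->//|[c [hc _ ->]]] := tstate_critical jr jt (fun=> 0%N) n i.
have ex (u : 'I_n -> nat) (q : pred nat) :
    (\sum_k u k <= 1)%N -> let X := (\sum_(c' < n | q c') at_position r t (ext u) c')%N in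
    (X <= 1)%N /\ (X != 0%N -> exists2 x, q (position r t x) & u x != 0%N).
  move=> hu X; split.
    apply: leq_trans hu; rewrite -(psum_at_position r t u) /psum /X big_mkcond /=.
    by apply: leq_sum => c' _; case: ifP.
  rewrite /X sum_nat_eq0 negb_forall => /existsP [c']; rewrite negb_imply => /andP [qc hc'].
  exists (job_at r t c'); first by rewrite position_job_at.
  by rewrite -(at_positionE r t u) position_job_at.
have two (u : 'I_n -> nat) x y : (\sum_k u k <= 1)%N -> u x != 0%N -> x != y -> u y = 0%N.
  move=> hu hx xy; move: hu; rewrite (bigD1 x) //= (bigD1 y) 1?eq_sym //=; lia.
have [X1 exX] := ex r (fun c' => (0 == i) && (c' <= c))%N hr.
have [Y1 exY] := ex t (fun c' => (0 == i) && (c <= c'))%N ht.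
move: X1 exX Y1 exY; set X := (\sum_(_ < n | _) _)%N; set Y := (\sum_(_ < n | _) _)%N.
case: X => [|[|//]] _ exX; case: Y => [|[|//]] _ exY //.
- by have [//|y _ ty] := exY; apply: (one y); rewrite ty orbT.
- by have [//|x _ rx] := exX; apply: (one x); rewrite rx.
(* Both sums equal 1. If one job accounts for both, its own length is the bound. Otherwise [x] has
   lengths [(1, 0)], [y] has [(0, 1)], and [x] precedes [y], contrary to Johnson's order. *)
have [//|x /andP [_ qx] rx] := exX; have [//|y /andP [_ qy] ty] := exY.
case: (eqVneq x y) => [exy|xy].
  by apply: le_trans (jobD x); rewrite ler_nat; rewrite exy in rx *; lia.
have ry := two r x y hr rx xy.
have tx : t x = 0%N by apply: (two t y x) => //; rewrite eq_sym.
have [] := @jorder_G2 _ r t x y (leq_trans qx qy); first by rewrite tx lt0n.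
by rewrite ry.
Qed.
End OneShop.

Close Scope ring_scope.

(** * The complete program *)

Lemma nth_flatten_pairs (u v : nat -> nat) s i :
  nth 0 (flatten [seq [:: u k; v k] | k <- s]) (2 * i) =
    (if i < size s then u (nth 0 s i) else 0) /\
  nth 0 (flatten [seq [:: u k; v k] | k <- s]) (2 * i + 1) =
    (if i < size s then v (nth 0 s i) else 0).
Proof.
elim: s i => [|k s IH] [|i]; rewrite ?nth_nil //.
have -> : 2 * i.+1 = (2 * i).+2 by lia.
by have [h1 h2] := IH i; rewrite /= ltnS -h1 -h2.
Qed.

Lemma encode_input_ok n m (r t : 'I_n -> nat) :
  input_ok m n (ext r) (ext t) (nth 0 (encode_input m r t)).
Proof.
have e : [seq [:: r k; t k] | k <- enum 'I_n] = [seq [:: ext r k; ext t k] | k <- iota 0 n].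
  by rewrite -val_enum_ord -map_comp; apply: eq_map => i /=; rewrite !extE.
rewrite /encode_input e; split=> // [k hk|x hx].
  have [h1 h2] := nth_flatten_pairs (ext r) (ext t) (iota 0 n) k.
  rewrite size_iota hk nth_iota // in h1 h2.
  by rewrite !addnS addn0 /=; split=> //; rewrite -h2 addn1.
pose i := (x - 2)./2; have hi : (i < n) = false by apply/negbTE; rewrite -leqNgt /i; lia.
have [h1 h2] := nth_flatten_pairs (ext r) (ext t) (iota 0 n) i.
rewrite size_iota hi in h1 h2.
have [ex|ex] : x = (2 * i).+2 \/ x = (2 * i + 1).+2 by rewrite /i; lia.
  by rewrite ex.
by rewrite ex.
Qed.

(** The dynamic program is skipped for [m = 1], where [cost_factor] is twice [maxn 1 a] and the
    bucket heads, more than [b] of them, would not fit, and for [b <= 1], where [word_base] is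
    polynomial in [n] and [m] and state codes with [m] digits would overflow. The untouched zero
    fields of the job records then put every job on shop 0. *)
Definition assign : cmd :=
  (Op Defs.Sub 20 5 1;; Op Defs.Sub 21 11 1);;
  If 20 (If 21 ((Op Add 13 10 11;; Op Add 13 13 1;; Op Mul 14 13 13;; Op Add 15 5 5);; dp)
           Skip) Skip.

Definition program : cmd :=
  setup;; sums;; copy;; sort_jobs;; assign;; Const 19 0;; simulate;; If 12 reverse_time Skip.

Section Program.
Variables (R : realFieldType) (n m : nat) (r t : 'I_n -> nat) (W A N : nat).
Local Notation sw := (psum (ext t) n < psum (ext r) n).
Definition r_base : 'I_n -> nat := if sw then t else r.
Definition t_base : 'I_n -> nat := if sw then r else t.
Local Notation rb := (ext r_base).
Local Notation tb := (ext t_base).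
Local Notation a := (psum rb n).
Local Notation b := (psum tb n).
Local Notation M := (a + b + 1).
Local Notation jb := (3 * n + 2).
Local Notation sb := (jb + 4 * n).
Local Notation hb := (sb + 2 * m).
Local Notation jr := (at_position r_base t_base rb).
Local Notation jt := (at_position r_base t_base tb).
Hypothesis hm : 0 < m.
Hypothesis hA : hb <= A.
Hypothesis hAW : A < W.
Hypothesis hMW : 4 * M + 4 < W.
Hypothesis hA2 : 1 < m -> 1 < b -> hb + M + 4 * (1 + n * (N * m)) <= A.
Hypothesis hW : 1 < m -> 1 < b -> (M * M) ^ m < W.
Hypothesis hcap : 1 < m -> 1 < b -> forall k (l : seq nat), k <= n -> uniq l ->
  (forall key, key \in l -> exists2 f, fok m f & key = code M m (cstate a jr jt f k)) ->
  size l <= N.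

Lemma r'E k : r' n (ext r) (ext t) k = rb k.
Proof. by rewrite /r' /r_base; case: ifP. Qed.

Lemma t'E k : t' n (ext r) (ext t) k = tb k.
Proof. by rewrite /t' /t_base; case: ifP. Qed.

Lemma base_sums : (if sw then psum (ext t) n else psum (ext r) n) = a /\
  (if sw then psum (ext r) n else psum (ext t) n) = b.
Proof. by rewrite /r_base /t_base; case: ifP. Qed.

Definition optimal_assignment (f : nat -> nat) : Prop :=
  fok m f /\ forall S : schedule R n m, feasible r_base t_base S ->
    ((last_end m (tstate jr jt f n))%:R <= makespan t_base S)%R.

Lemma a_le_b : a <= b.
Proof. by have [<- <-] := base_sums; case: ifP => h; clear -h; lia. Qed.

Definition dp_time := n * (layer_time m N M + 19) + N * (m * 10 + 20) + 19.

Lemma assign_spec s0 : consts_ok m n s0 -> reg s0 10 = a -> reg s0 11 = b ->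
  (forall k, k < n -> [/\ cell s0 (jb + 4 * k) = rb k, cell s0 (jb + 4 * k + 1) = tb k &
     cell s0 (jb + 4 * k + 2) = nth 0 (jorder n a rb tb) k]) ->
  (forall k, k < n -> cell s0 (jb + 4 * k + 3) = 0) ->
  (forall x, sb <= x -> cell s0 x = 0) ->
  wp W A assign s0 (if (1 < m) && (1 < b) then dp_time + 4 else 5) (fun s =>
    [/\ forall x, x < 13 -> reg s x = reg s0 x,
      exists2 f, optimal_assignment f & forall k, k < n -> cell s (jb + 4 * k + 3) = f k &
      forall x, x < hb -> (forall k, k < n -> x != jb + 4 * k + 3) -> cell s x = cell s0 x]).
Proof.
move=> co r10 r11 hj h3 hz; have [[r0 r1 r2 r3 r4] [r5 r6 r7 r8 r9]] := co.
set Tm := if _ then _ else _.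
have hTm : 5 <= Tm by rewrite /Tm /dp_time; case: ifP => _ //; clear; lia.
apply: (wp_seq (T1 := 2) (T2 := Tm - 2)); first by clear -hTm; lia.
apply: wp_sl => //=; split=> //; split=> //; rewrite r5 r11 r1.
set s1 := set_reg _ _ _.
have q20 : reg s1 20 = m - 1 by [].
have q21 : reg s1 21 = b - 1 by [].
have q x : x < 20 -> reg s1 x = reg s0 x by move=> hx /=; skip_reg.
have qc : cell s1 = cell s0 by [].
move: s1 q20 q21 q qc => s1 q20 q21 q qc.
have trivial_case : (forall S : schedule R n m, feasible r_base t_base S ->
    ((last_end m (tstate jr jt (fun=> 0%N) n))%:R <= makespan t_base S)%R) ->
    wp W A Skip s1 1 (fun s =>
    [/\ forall x, x < 13 -> reg s x = reg s0 x,
      exists2 f, optimal_assignment f & forall k, k < n -> cell s (jb + 4 * k + 3) = f k &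
      forall x, x < hb -> (forall k, k < n -> x != jb + 4 * k + 3) -> cell s x = cell s0 x]).
  move=> h; apply: wp_sl => //=; split.
  - by move=> x hx; apply: q; clear -hx; lia.
  - by exists (fun=> 0); [split|move=> k hk; rewrite qc h3].
  - by rewrite qc.
apply: (wp_le (T' := (Tm - 3).+1)); first by clear -hTm; lia.
apply: wp_if => hm1; last first.
  apply: wp_le (trivial_case _); first by clear -hTm; lia.
  by move=> S hS; apply: one_shop_single => //; clear -hm1 q20 hm; lia.
apply: (wp_le (T' := (Tm - 4).+1)); first by clear -hTm; lia.
have m1 : 1 < m by clear -hm1 q20 hm; lia.
apply: wp_if => hb1; last first.
  apply: wp_le (trivial_case _); first by clear -hTm; lia.
  have hab := a_le_b.
  by move=> S hS; apply: one_shop_tiny => //; rewrite -psum_ext; clear -hb1 q21 hab; lia.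
have b1 : 1 < b by clear -hb1 q21; lia.
have -> : Tm - 4 = dp_time by rewrite /Tm m1 b1 addnK.
have hab := a_le_b.
have hA3 := hA2 m1 b1; have hW3 := hW m1 b1; have hcap3 := hcap m1 b1.
apply: (wp_seq (T1 := 4) (T2 := dp_time - 4)); first by rewrite /dp_time; clear; lia.
have hMM : M * M < W.
  apply: leq_ltn_trans hW3; rewrite -{1}[M * M]expn1 leq_pexp2l //.
  by rewrite muln_gt0 !addn1.
apply: wp_sl => //=; rewrite !(q 10) // !(q 11) // !(q 1) // !(q 5) // r10 r11 r1 r5.
split; first by clear -hMW; lia.
split; first by clear -hMW; lia.
split=> //; split; first by clear -hA hAW; lia.
set s2 := set_reg _ _ _.
have p13 : reg s2 13 = M by [].
have p14 : reg s2 14 = M * M by [].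
have p15 : reg s2 15 = m + m by [].
have p x : x < 13 -> reg s2 x = reg s0 x.
  by move=> hx /=; skip_reg; apply: q; clear -hx; lia.
have pc : cell s2 = cell s0 by [].
move: s2 p13 p14 p15 p pc => s2 p13 p14 p15 p pc.
have env : dp_env m n M jb hb jr jt (nth 0 (jorder n a rb tb)) s2.
  split; first by rewrite !p.
  split; first by rewrite !p.
  split; first by rewrite p13 p14 p15 addnn -mul2n.
  move=> k hk; rewrite pc; have [e1 e2 e3] := hj _ hk.
  by have [e4 e5 _] := hj _ (nth_jorder_lt r_base t_base hk).
have e10 : reg s2 10 = a by rewrite p.
have e3 : reg s2 3 = 3 by rewrite p.
have z2 x : hb <= x -> cell s2 x = 0.
  by move=> hx; rewrite pc hz //; clear -hx; lia.
have PJr : psum jr n = a by rewrite psum_at_position psum_ext.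
have PJt : psum jt n = b by rewrite psum_at_position psum_ext.
have M1 : 1 < M by clear -b1; lia.
have MPT : psum jr n + psum jt n < M by rewrite PJr PJt addn1.
have ord_lt k : k < n -> nth 0 (jorder n a rb tb) k < n by apply: nth_jorder_lt.
have W4 : 4 * M < W by clear -hMW; lia.
have DP := @dp_spec W A m n a N M jb hb (hb + M) jr jt (nth 0 (jorder n a rb tb))
  M1 MPT (esym PJr) hW3 W4 hAW hm erefl _ hA3 ord_lt hcap3 s2 env e10 e3 z2.
apply: (wp_le (T' := n * (layer_time m N M + 19) + N * (m * 10 + 20) + 15)).
  by rewrite /dp_time; clear; lia.
apply: wp_conseq (DP _); last by clear; lia.
move=> s3 [g1 [f [f1 f2 f3]] g2]; split.
- by move=> x hx; rewrite g1 ?p //; clear -hx; lia.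
- exists f => //; split=> // S hS.
  have := f2 _ (fun c => shops_of_lt r_base t_base S c hm).
  rewrite !(last_end_cstate _ (n := n)) // => hle.
  by apply: le_trans (last_end_shops_of hS hm); rewrite ler_nat.
- by move=> x hx hx'; rewrite g2 // pc.
Qed.

Definition program_time := 83 * n + (2 * a + 2) * (n * 21 + 7) +
  (if (1 < m) && (1 < b) then dp_time + 4 else 5) + 38.

Lemma psum_ge (u : nat -> nat) k : k < n -> u k <= psum u n.
Proof. by move=> hk; rewrite /psum (bigD1 (Ordinal hk)) //= leq_addr. Qed.

Lemma base_total : psum (ext r) n + psum (ext t) n = a + b.
Proof. by have [<- <-] := base_sums; case: ifP => _ //; rewrite addnC. Qed.

Lemma bounded_init : bounded W (init_state (encode_input m r t)).
Proof.
have [h0 h1 h2 h3] := encode_input_ok m r t; have hab := base_total.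
split=> x /=; first by clear -hAW; lia.
case: (ltnP x 2) => hx.
  case: x hx => [|[|//]] _; rewrite ?h0 ?h1; clear -hA hAW hm; lia.
case: (ltnP x (2 * n + 2)) => hx2; last by rewrite h3 //; clear -hAW; lia.
pose k := (x - 2)./2; have hk : k < n by rewrite /k; clear -hx hx2; lia.
have [e1 e2] := h2 _ hk.
have p1 := psum_ge (ext r) hk; have p2 := psum_ge (ext t) hk.
have [->|->] : x = 2 * k + 2 \/ x = 2 * k + 3 by rewrite /k; clear -hx hx2; lia.
  by rewrite e1; clear -p1 hab hMW; lia.
by rewrite e2; clear -p2 hab hMW; lia.
Qed.

Lemma program_spec : wp W A program (init_state (encode_input m r t)) program_time (fun s =>
  exists S : schedule R n m, encodes_schedule (cell s) S /\ optimal r t S).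
Proof.
have inp := encode_input_ok m r t; have htot := base_total; have hab := a_le_b.
set s0 := init_state _; rewrite /program_time.
have [TA eTA] : exists TA, TA = if (1 < m) && (1 < b) then dp_time + 4 else 5 by eexists.
rewrite -eTA.
have RW : psum (ext r) n < W by clear -htot hMW; lia.
have TW : psum (ext t) n < W by clear -htot hMW; lia.
have W4 : 4 < W by clear -hMW; lia.
apply: (wp_seq (T1 := 12) (T2 := 83 * n + (2 * a + 2) * (n * 21 + 7) + TA + 26)).
  by clear; lia.
have S1 := setup_spec hAW hA RW TW hm (_ : forall x, reg s0 x = 0) inp W4.
apply: wp_conseq (S1 _); last by [].
move=> s1 [c1 [m1 z1]].
have inp1 : input_ok m n (ext r) (ext t) (cell s1) by rewrite m1.
apply: (wp_seq (T1 := n * 11 + 8) (T2 := 72 * n + (2 * a + 2) * (n * 21 + 7) + TA + 18)).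
  by clear; lia.
have S2 := sums_spec hAW hA RW TW hm c1 inp1 (z1 10 isT) (z1 11 isT).
apply: wp_conseq S2 => s2 [q2 m2 a2 b2 w2].
have [ea eb] := base_sums; rewrite ea in a2; rewrite eb in b2.
have c2 : consts_ok m n s2.
  by case: c1 => [[? ? ? ? ?] [? ? ? ? ?]]; split; split; rewrite q2.
have inp2 : input_ok m n (ext r) (ext t) (cell s2) by rewrite m2.
apply: (wp_seq (T1 := n * 18 + 3) (T2 := 54 * n + (2 * a + 2) * (n * 21 + 7) + TA + 15)).
  by clear; lia.
have S3 := copy_spec hAW hA RW TW hm c2 inp2 w2.
apply: wp_conseq S3 => s3 [q3 j3 z3].
have c3 : consts_ok m n s3.
  by case: c2 => [[? ? ? ? ?] [? ? ? ? ?]]; split; split; rewrite q3.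
have {}j3 k : k < n -> cell s3 (jb + 4 * k) = rb k /\ cell s3 (jb + 4 * k + 1) = tb k.
  by move=> /j3; rewrite r'E t'E.
have ra k : k < n -> rb k <= a by apply: psum_ge.
apply: (wp_seq (T1 := (2 * a + 2) * (n * 21 + 7) + 7) (T2 := 54 * n + TA + 8)).
  by clear; lia.
have R3 : [/\ reg s3 0 = 0, reg s3 1 = 1, reg s3 2 = 2, reg s3 4 = 4 & reg s3 10 = a].
  by case: c3 => [[? ? ? ? ?] _]; split=> //; rewrite q3.
have [_ [e35 e36 e37 e38 e39]] := c3.
have jA : jb + 4 * n + 2 <= A by clear -hA hm; lia.
have aW : 2 * a + 2 < W by clear -hMW; lia.
have jW : jb + 2 < W by clear -jA hAW; lia.
have S4 := sort_spec ra hAW jA aW R3 e36 e37 j3 jW.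
apply: wp_conseq S4 => s4 [q4 o4 h4].
have c4 : consts_ok m n s4.
  by case: c3 => [[? ? ? ? ?] [? ? ? ? ?]]; split; split; rewrite q4.
have j4 k : k < n -> [/\ cell s4 (jb + 4 * k) = rb k, cell s4 (jb + 4 * k + 1) = tb k &
     cell s4 (jb + 4 * k + 2) = nth 0 (jorder n a rb tb) k].
  move=> hk; have [e1 e2] := j3 _ hk.
  rewrite o4 // !h4 //; move=> k' hk'; apply/eqP; clear; lia.
have z4 k : k < n -> cell s4 (jb + 4 * k + 3) = 0.
  move=> hk; rewrite h4; last by move=> k' hk'; apply/eqP; clear; lia.
  by apply: z3; [clear; lia|move=> k' hk'; split; apply/eqP; clear; lia].
have zz4 x : sb <= x -> cell s4 x = 0.
  move=> hx; rewrite h4; last by move=> k' hk'; apply/eqP; clear -hx hk'; lia.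
  by apply: z3; [clear -hx; lia|move=> k' hk'; split; apply/eqP; clear -hx hk'; lia].
have e410 : reg s4 10 = a by rewrite q4 // q3.
have e411 : reg s4 11 = b by rewrite q4 // q3.
apply: (wp_seq (T1 := TA) (T2 := 54 * n + 8)); first by clear; lia.
have AS := assign_spec c4 e410 e411 j4 z4 zz4; rewrite -eTA in AS.
apply: wp_conseq AS => s5 [q5 [f [fm fopt] f5] h5].
have c5 : consts_ok m n s5.
  by case: c4 => [[? ? ? ? ?] [? ? ? ? ?]]; split; split; rewrite q5.
have e512 : (reg s5 12 != 0) = sw by rewrite q5 // q4 // q3 // w2.
apply: (wp_seq (T1 := 1) (T2 := 54 * n + 7)); first by clear; lia.
apply: wp_sl => //=; split; first by clear -W4; lia.
set s6 := set_reg _ _ _.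
have q6 x : x < 19 -> reg s6 x = reg s5 x by move=> hx /=; skip_reg.
have q619 : reg s6 19 = 0 by [].
have m6 : cell s6 = cell s5 by [].
move: s6 q6 q619 m6 => s6 q6 q619 m6.
have c6 : consts_ok m n s6.
  by case: c5 => [[? ? ? ? ?] [? ? ? ? ?]]; split; split; rewrite q6.
pose ord := nth 0 (jorder n a rb tb).
have ord_lt k : k < n -> ord k < n by apply: nth_jorder_lt.
have ord_inj k k' : k < n -> k' < n -> ord k = ord k' -> k = k'.
  move=> hk hk' /eqP; rewrite nth_uniq ?jorder_size ?uniq_jorder // => /eqP; exact.
have j6 k : k < n -> cell s6 (jb + 4 * k) = rb k /\ cell s6 (jb + 4 * k + 1) = tb k.
  move=> hk; rewrite m6; have [e1 e2 _] := j4 _ hk.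
  rewrite !h5 //; [by clear -hk; lia|by move=> k' hk'; apply/eqP; clear; lia|
    by clear -hk; lia|by move=> k' hk'; apply/eqP; clear; lia].
have o6 k : k < n -> cell s6 (jb + 4 * k + 2) = ord k /\ cell s6 (jb + 4 * k + 3) = f k.
  move=> hk; rewrite m6 f5 //; have [_ _ e3] := j4 _ hk; split=> //.
  by rewrite h5 //; [by clear -hk; lia|by move=> k' hk'; apply/eqP; clear; lia].
have zz6 x : sb <= x < hb -> cell s6 x = 0.
  move=> hx; rewrite m6 h5 ?zz4 //; [by clear -hx; lia|by clear -hx; lia|].
  by move=> k' hk'; apply/eqP; clear -hx hk'; lia.
have PJr : psum jr n = a by rewrite psum_at_position psum_ext.
have PJt : psum jt n = b by rewrite psum_at_position psum_ext.
have PW : psum jr n + psum jt n < W by rewrite PJr PJt; clear -hMW; lia.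
apply: (wp_seq (T1 := n * 34 + 3) (T2 := n * 20 + 4)); first by clear; lia.
have SS := @simulate_spec W A m n jb sb rb tb ord f erefl erefl hAW hA PW fm ord_lt ord_inj
  s6 c6 q619 j6 o6 zz6.
apply: wp_conseq SS => s7 [q7 d7 h7 k7].
have c7 : consts_ok m n s7.
  by case: c6 => [[? ? ? ? ?] [? ? ? ? ?]]; split; split; rewrite q7.
pose p := position r_base t_base.
pose sR J := start1 jr jt f (p J); pose sT J := start2 jr jt f (p J).
have out7 (J : 'I_n) : [/\ cell s7 (3 * J) = f (p J), cell s7 (3 * J + 1) = sR J &
    cell s7 (3 * J + 2) = sT J].
  by have := h7 _ (position_lt r_base t_base J); rewrite /ord nth_position.
pose S0 := simulated R jr jt p fm.
have pr J : jr (p J) = r_base J by rewrite /at_position nth_position extE.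
have pt J : jt (p J) = t_base J by rewrite /at_position nth_position extE.
have S0ok : feasible r_base t_base S0.
  exact: (simulated_feasible R (@position_inj n r_base t_base) pr pt fm).
have S0ms : (makespan t_base S0 <= (endtime n jr jt f)%:R)%R.
  exact: (simulated_makespan R jr (position_lt r_base t_base) pt fm).
have endopt (S : schedule R n m) : feasible r_base t_base S ->
    ((endtime n jr jt f)%:R <= makespan t_base S)%R.
  move=> hS; apply: le_trans (fopt S hS); rewrite ler_nat; exact: endtime_le_last.
have e712 : (reg s7 12 != 0) = sw by rewrite q7 // q6.
apply: (wp_le (T' := (n * 20 + 3).+1)); first by clear; lia.
apply: wp_if => h12; last first.
  have hs : sw = false by rewrite -e712 h12.
  apply: wp_sl; first by rewrite addnC.
  have [er et] : r_base = r /\ t_base = t by rewrite /r_base /t_base hs.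
  exists S0; split.
    by move=> J; have [-> -> ->] := out7 J.
  rewrite er et in S0ok S0ms endopt *; split=> // S hS.
  exact: le_trans S0ms (endopt _ hS).
have hs : sw by rewrite -e712.
have [er et] : r_base = t /\ t_base = r by rewrite /r_base /t_base hs.
have DW : endtime n jr jt f < W by apply: leq_ltn_trans PW; apply: endtime_le.
have j7 k : k < n -> cell s7 (jb + 4 * k) = rb k /\ cell s7 (jb + 4 * k + 1) = tb k.
  by move=> hk; have [e1 e2] := j6 _ hk; rewrite !k7 //; clear -hk; lia.
have o7 k : k < n -> cell s7 (3 * k + 1) = ext sR k /\ cell s7 (3 * k + 2) = ext sT k.
  by move=> hk; have [_ e1 e2] := out7 (Ordinal hk); rewrite -[k]/(nat_of_ord (Ordinal hk)) !extE.
have endle J : sT J + t_base J <= endtime n jr jt f.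
  exact: (end_le_endtime jr f (position_lt r_base t_base) pt).
have ends J : sR J + r_base J <= endtime n jr jt f.
  apply: leq_trans (leq_trans _ (leq_addr (t_base J) (sT J))) (endle J).
  by rewrite -pr /sT /start2 leq_maxr.
have D7 k : k < n -> ext sR k + rb k <= endtime n jr jt f /\ ext sT k + tb k <= endtime n jr jt f.
  by move=> hk; rewrite -[k]/(nat_of_ord (Ordinal hk)) !extE.
have RS := reverse_spec (r := rb) (t := tb) (ord := ord) (f := f) erefl erefl hAW hA PW
  fm ord_lt ord_inj
  c7 d7 DW j7 o7 D7.
apply: wp_conseq RS => s8 h8.
pose D : R := ((endtime n jr jt f)%:R)%R.
have S0end k : (startT S0 k + (t_base k)%:R <= D)%R.
  by rewrite /= -natrD ler_nat; apply: endle.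
exists (reversed r_base t_base D S0); split.
  move=> J; have [e1 e2 e3] := h8 _ (ltn_ord J); have [f1 _ _] := out7 J.
  rewrite !extE in e2 e3; split=> /=.
  - by rewrite e1 f1.
  - by rewrite e2 natrB ?natrD //; apply: endle.
  - by rewrite e3 natrB ?natrD //; apply: ends.
have Rok := reversed_feasible S0ok S0end.
have Rms := reversed_makespan S0ok (ler0n R (endtime n jr jt f)).
move: (reversed _ _ _ _) Rok Rms => X; rewrite er et in endopt * => Rok Rms.
split=> // S hS; apply: le_trans Rms _.
(* A competitor for [r] and [t] is reversed at its own makespan; the result is a competitor for the
   exchanged lengths with no larger makespan, to which [endopt] applies. *)
have hSe := end_le_makespan t S.
apply: le_trans (endopt _ (reversed_feasible hS hSe)) _.
exact: reversed_makespan hS (makespan_ge0 t S).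
Qed.
End Program.

(** * Arithmetic of the time, space and word bounds *)

Section Arithmetic.
Local Open Scope nat_scope.

Lemma short_time_le n a : 83 * n + (2 * a + 2) * (n * 21 + 7) + 43 <= 300 * (maxn 1 n * maxn 1 a).
Proof.
have h1 : n <= maxn 1 n by lia.
have h2 : a <= maxn 1 a by lia.
have h3 : 1 <= maxn 1 n by lia.
have h4 : 1 <= maxn 1 a by lia.
move: (maxn 1 n) (maxn 1 a) h1 h2 h3 h4 => u v h1 h2 h3 h4.
have e1 : (2 * a + 2) * (n * 21 + 7) <= (4 * v) * (28 * u) by apply: leq_mul; lia.
have e2 : u <= u * v by rewrite leq_pmulr.
have e3 : 1 <= u * v by rewrite muln_gt0 h3.
rewrite (_ : 4 * v * (28 * u) = 112 * (u * v)) in e1; lia.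
Qed.

Lemma dp_time_le n m N M b : 1 < m -> 1 <= b -> M <= 3 * b ->
  n * (layer_time m N M + 19) + N * (m * 10 + 20) + 19 + 4 <= 300 * (maxn 1 n * (m * m) * (1 + N + b)).
Proof.
move=> hm hb hM; rewrite /layer_time.
have h1 : n <= maxn 1 n by lia.
have h3 : 1 <= maxn 1 n by lia.
move: (maxn 1 n) h1 h3 => u h1 h3.
have m1 : m <= m * m by rewrite leq_pmulr //; lia.
have m2 : 1 <= m * m by lia.
have e1 : N * (m * (m * 30 + 20) + 20) <= 70 * (N * (m * m)).
  rewrite [X in _ <= X]mulnCA leq_mul2l; apply/orP; right; nia.
have e2 : 2 * m * (17 * (N * m) + 12 * M + 9) <= 34 * (N * (m * m)) + 90 * (m * m * b).
  have : 2 * m * (12 * M + 9) <= 2 * m * (45 * b) by rewrite leq_mul2l; apply/orP; right; lia.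
  have : m * b <= m * m * b by rewrite leq_mul2r m1 orbT.
  nia.
have e3 : 13 * (N * m) <= 13 * (N * (m * m)) by rewrite !leq_mul2l m1 !orbT.
have e4 : N * (m * 10 + 20) <= 30 * (N * (m * m)).
  rewrite [X in _ <= X]mulnCA leq_mul2l; apply/orP; right; lia.
set Z := m * m * (1 + N + b).
have z1 : N * (m * m) + m * m * b + m * m = Z by rewrite /Z; lia.
have main : N * (m * (m * 30 + 20) + 20) + 2 * m * (17 * (N * m) + 12 * M + 9) +
    13 * (N * m) + 21 + 19 <= 180 * Z by lia.
apply: (@leq_trans (u * (180 * Z) + 60 * Z)).
  rewrite -addnA -addnA; apply: leq_add; first exact: leq_mul.
  by lia.
rewrite -mulnA -/Z; have : Z <= u * Z by rewrite leq_pmull.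
lia.
Qed.

(** For [b >= 2] one has [2 * b + 1 <= b ^ 3], so a code is at most [b ^ (6 * m)], and
    [m <= 2 * m.-1] for [m >= 2]. The point is to reach a power of [b ^ m.-1], which [cost_factor]
    dominates; this is the origin of the exponent 12. *)
Lemma word_nat_le M m b : 1 < m -> 1 < b -> M <= 2 * b + 1 -> (M * M) ^ m <= (b ^ m.-1) ^ 12.
Proof.
move=> hm hb hM.
have hM3 : M <= b ^ 3 by apply: leq_trans hM _; rewrite !expnS expn0 muln1; nia.
apply: (@leq_trans ((b ^ 6) ^ m)).
  have : M * M <= b ^ 6 by rewrite -[6]/(3 + 3) expnD; apply: leq_mul.
  by case: (m) => // m'; rewrite leq_exp2r.
by rewrite -!expnM leq_exp2l //; lia.
Qed.
End Arithmetic.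

Local Open Scope ring_scope.

Section Cost.
Variables m a b : nat.
Hypothesis hm : (0 < m)%N.
Local Notation A1 := (maxn 1 a).
Local Notation B1 := (maxn 1 b).
Local Notation c := (cost_factor m a b).

Lemma cost_ge_prod : (A1 * B1 ^ m.-1)%:R <= c.
Proof.
rewrite /cost_factor natrM natrX lerDr divr_ge0 ?ler0n //.
by rewrite exprn_ge0 ?ler0n.
Qed.

Lemma cost_ge_A1 : A1%:R <= c.
Proof.
apply: le_trans cost_ge_prod; rewrite ler_nat leq_pmulr // expn_gt0; apply/orP; left; lia.
Qed.

Lemma cost_ge1 : 1 <= c.
Proof. by apply: le_trans cost_ge_A1; rewrite ler1n leq_maxl. Qed.

Lemma cost_ge_pow : (B1 ^ m.-1)%:R <= c.
Proof. by apply: le_trans cost_ge_prod; rewrite ler_nat leq_pmull // leq_maxl. Qed.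

Lemma cost_ge_b : (1 < m)%N -> b%:R <= c.
Proof.
move=> m1; apply: le_trans cost_ge_pow; rewrite ler_nat.
apply: leq_trans (leq_maxr 1 b) _; case: m m1 => [|[|m']] //= _.
by rewrite expnS leq_pmulr // expn_gt0; apply/orP; left; lia.
Qed.

Lemma cost_ge_cap N C0 : (0 < b)%N ->
  (N * m`! <= C0 * (A1 ^ (2 * m).-1 + m`! * A1 * b ^ m.-1))%N -> N%:R <= C0%:R * c.
Proof.
move=> hb; have -> : (b = B1)%N by lia.
move=> h; rewrite /cost_factor (_ : maxn 1 B1 = B1); last by lia.
have f0 : 0 < (m`!)%:R :> rat by rewrite ltr0n fact_gt0.
rewrite -(ler_pM2r f0) -natrM; apply: le_trans (_ : (C0 * (A1 ^ (2 * m).-1 + m`! * A1 * B1 ^ m.-1))%:R <= _).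
  by rewrite ler_nat.
rewrite le_eqVlt; apply/orP; left; apply/eqP.
have -> : forall x y : nat, (C0 * (x + m`! * A1 * y))%:R =
    C0%:R * (x%:R / (m`!)%:R + A1%:R * y%:R) * (m`!)%:R :> rat.
  move=> x y; rewrite natrM natrD !natrM -[RHS]mulrA mulrDl divfK ?gt_eqF //.
  by congr (_ * (_ + _)); rewrite [RHS]mulrC mulrA.
by rewrite !natrX.
Qed.
End Cost.

Lemma natr_scale (k u y C : nat) (c : rat) : y%:R <= C%:R * c ->
  (k * (u * y))%:R <= (k * C)%:R * (u%:R * c).
Proof.
move=> h; rewrite !natrM -[X in _ <= X]mulrA ler_wpM2l ?ler0n //.
by rewrite [X in _ <= X]mulrCA ler_wpM2l ?ler0n.
Qed.

Lemma base_Tmin n (r t : 'I_n -> nat) :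
  psum (ext (r_base r t)) n = Tmin r t /\ psum (ext (t_base r t)) n = Tmax r t.
Proof.
have [<- <-] := base_sums r t; rewrite /Tmin /Tmax -!psum_ext.
by case: ltnP => h; lia.
Qed.

Theorem theorem4p1 (R : realFieldType) :
  exists (p : cmd) (C : nat),
    forall (m n : nat) (r t : 'I_n -> nat), (1 <= m)%N ->
    let a := Tmin r t in
    let b := Tmax r t in
    exists (W : nat) (s : state) (tm sp : nat) (S : schedule R n m),
      [/\ exec W p (init_state (encode_input m r t)) s tm sp,
          W%:R <= word_base n m a b ^+ C,
          tm%:R <= C%:R * time_bound n m a b,
          sp%:R <= C%:R * space_bound n m a b
        & encodes_schedule (cell s) S /\ optimal r t S].
Proof.
have [C0 hC0] := layer_cap.
(* One number for three purposes: it must be at least [600 * (C0 + 2)] for the time, [30 * (C0 + 2)]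
   for the space, and [30 * (C0 + 2) + 9 + 12] as the exponent of [word_base]. *)
exists program, (1000 * (C0 + 2) + 100)%N => m n r t hm a b.
have [ea eb] := base_Tmin r t.
have hab : (a <= b)%N by rewrite /a /b -ea -eb a_le_b.
pose M := (a + b + 1)%N.
pose big := ((1 < m) && (1 < b))%N.
have [N [hN hcap]] : exists N, (N%:R <= C0%:R * cost_factor m a b) /\
    ((1 < m)%N -> (1 < b)%N -> forall k (l : seq nat), (k <= n)%N -> uniq l ->
    (forall key, key \in l -> exists2 f, fok m f & key = code M m
       (cstate a (at_position (r_base r t) (t_base r t) (ext (r_base r t)))
                 (at_position (r_base r t) (t_base r t) (ext (t_base r t))) f k)) ->
    (size l <= N)%N).
  case: (boolP big) => [/andP [m1 b1]|hbig]; last first.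
    exists 0%N; split; last by move=> m1 b1; move: hbig; rewrite /big m1 b1.
    by rewrite mulr_ge0 // ?ler0n // (le_trans ler01) // cost_ge1.
  have [|||N [hN hcap]] := hC0 n a b m M
    (at_position (r_base r t) (t_base r t) (ext (r_base r t)))
    (at_position (r_base r t) (t_base r t) (ext (t_base r t))) hm b1 hab.
  - by rewrite psum_at_position -psum_ext ea.
  - by rewrite psum_at_position -psum_ext eb.
  - by rewrite /M addn1.
  exists N; split; first by apply: cost_ge_cap => //; apply: ltnW.
  by move=> _ _; apply: hcap.
(* Both vanish when the dynamic program is skipped, so that [b] enters the estimate only for
   [m > 1], where [cost_factor] is at least [b]. *)
pose N' := if big then N else 0%N; pose b' := if big then b else 0%N.
pose A := (3 * n + 2 + 4 * n + 2 * m + (if big then M + 4 * (1 + n * (N * m)) else 0))%N.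
pose W := (A + 4 * M + 5 + (if big then (M * M) ^ m else 0))%N.
have hA : (3 * n + 2 + 4 * n + 2 * m <= A)%N by rewrite leq_addr.
have hAW : (A < W)%N by rewrite /W; lia.
have hMW : (4 * M + 4 < W)%N by rewrite /W; lia.
have hA2 : (1 < m -> 1 < b -> 3 * n + 2 + 4 * n + 2 * m + M + 4 * (1 + n * (N * m)) <= A)%N.
  by move=> m1 b1; rewrite /A /big m1 b1 /= addnA.
have hW : (1 < m -> 1 < b -> (M * M) ^ m < W)%N.
  by move=> m1 b1; rewrite /W /big m1 b1 /=; lia.
have spec := @program_spec R n m r t W A N hm hA hAW; rewrite ea eb in spec.
have binit : bounded W (init_state (encode_input m r t)).
  by apply: (bounded_init hm hA hAW); rewrite ea eb.
have [s [tm [sp [hex _ htm hsp [S hS]]]]] := spec hMW hA2 hW hcap binit.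
pose n1 := maxn 1 n; pose A1 := maxn 1 a; pose Y := (A1 + N' + b')%N.
set c := cost_factor m a b in hN.
have n1n : (n <= n1)%N by rewrite leq_maxr.
have n1p : (1 <= n1)%N by rewrite leq_maxl.
have A1p : (1 <= A1)%N by rewrite leq_maxl.
have c1 : 1 <= c by apply: cost_ge1.
have hY : Y%:R <= (C0 + 2)%:R * c.
  have h1 : A1%:R <= c by apply: cost_ge_A1.
  have h2 : N'%:R <= C0%:R * c.
    by rewrite /N'; case: ifP => // _; rewrite mulr_ge0 ?ler0n // (le_trans ler01).
  have h3 : b'%:R <= c.
    rewrite /b'; case: ifP => [/andP [m1 _]|_]; last by apply: le_trans c1; rewrite ler01.
    exact: cost_ge_b.
  by rewrite !natrD; lra.
have tmY : (tm <= 600 * (n1 * (m * m) * Y))%N.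
  apply: leq_trans htm _; rewrite /program_time /dp_time ea eb -/big -/M.
  have h1 := short_time_le n a; rewrite -/n1 -/A1 in h1.
  have h2 : (n1 * A1 <= n1 * (m * m) * Y)%N.
    by apply: leq_mul; [rewrite leq_pmulr // muln_gt0 hm|rewrite /Y -addnA leq_addr].
  case: (boolP big) => hbig; last by clear -h1 h2; lia.
  have /andP [m1 b1] := hbig.
  have M3 : (M <= 3 * b)%N by rewrite /M; clear -hab b1; lia.
  have h3 := dp_time_le n N m1 (ltnW b1) M3; rewrite -/n1 in h3.
  have h4 : (n1 * (m * m) * (1 + N + b) <= n1 * (m * m) * Y)%N.
    rewrite leq_mul2l; apply/orP; right; rewrite /Y /N' /b' hbig; clear -A1p; lia.
  by clear -h1 h2 h3 h4; lia.
have AY : (A <= 30 * (n1 * m * Y))%N.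
  have h0 : (n1 * m <= n1 * m * Y)%N by rewrite leq_pmulr // /Y -addnA addn_gt0 A1p.
  have h1 : (n1 <= n1 * m)%N by rewrite leq_pmulr.
  have h2 : (m <= n1 * m)%N by rewrite leq_pmull.
  rewrite /A; case: (boolP big) => hbig; last by clear -h0 h1 h2 n1n n1p; lia.
  have h3 : (n * (N * m) <= n1 * m * Y)%N.
    rewrite [(N * m)%N]mulnC mulnA; apply: leq_mul; first by rewrite leq_mul2r n1n orbT.
    by rewrite /Y /N' hbig; clear; lia.
  have h4 : (M <= 3 * (n1 * m * Y))%N.
    have : (b <= Y)%N by rewrite /Y /b' hbig leq_addl.
    have : (Y <= n1 * m * Y)%N by rewrite leq_pmull // muln_gt0 n1p.
    have /andP [_ b1] := hbig.
    by rewrite /M; clear -hab b1; lia.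
  by clear -h0 h1 h2 h3 h4 n1n n1p; lia.
pose K := (1000 * (C0 + 2) + 100)%N.
have n1R : 0 <= n1%:R :> rat by rewrite ler0n.
have mR : 0 <= m%:R :> rat by rewrite ler0n.
have tbE : time_bound n m a b = (n1 * (m * m))%:R * c.
  by rewrite /time_bound -/c !natrM expr2.
have sbE : space_bound n m a b = (n1 * m)%:R * c by rewrite /space_bound -/c natrM.
have tmb : tm%:R <= (600 * (C0 + 2))%:R * time_bound n m a b.
  apply: le_trans (_ : (600 * (n1 * (m * m) * Y))%:R <= _); first by rewrite ler_nat.
  by rewrite tbE; apply: natr_scale.
have spb : A%:R <= (30 * (C0 + 2))%:R * space_bound n m a b.
  apply: le_trans (_ : (30 * (n1 * m * Y))%:R <= _); first by rewrite ler_nat.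
  by rewrite sbE; apply: natr_scale.
have tb_ge0 : 0 <= time_bound n m a b.
  by rewrite /time_bound -/c !mulr_ge0 ?exprn_ge0 ?ler0n // (le_trans ler01).
have m1R : 1 <= m%:R :> rat by rewrite ler1n.
have sb_ge0 : 0 <= space_bound n m a b.
  by rewrite /space_bound -/c !mulr_ge0 ?ler0n // (le_trans ler01).
have sb_tb : space_bound n m a b <= time_bound n m a b.
  rewrite /space_bound /time_bound -/c ler_wpM2r ?(le_trans ler01) //.
  by rewrite ler_wpM2l ?ler0n // expr2 ler_peMl.
have c_tb : c <= time_bound n m a b.
  rewrite /time_bound -/c ler_peMl ?(le_trans ler01) // -natrX -natrM ler1n.
  by rewrite muln_gt0 expn_gt0 n1p hm.
set w := word_base n m a b.
have w2 : 2 + b%:R <= w by rewrite /w /word_base; lra.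
have wt : time_bound n m a b <= w.
  by rewrite /w /word_base; have := ler0n rat b; lra.
have w1 : 1 <= w by have := ler0n rat b; lra.
exists W, s, tm, sp, S; split=> //; last 2 first.
- apply: le_trans tmb _; rewrite ler_wpM2r // ler_nat -/K /K; clear; lia.
- apply: le_trans (_ : A%:R <= _); first by rewrite ler_nat.
  by apply: le_trans spb _; rewrite ler_wpM2r // ler_nat; clear; lia.
rewrite -/w -/K.
have h12 : w <= w ^+ 12 by rewrite -{1}[w]expr1 ler_weXn2l.
have hpow : (if big then (M * M) ^ m else 0)%N%:R <= w ^+ 12.
  case: (boolP big) => [/andP [m1 b1]|_]; last by rewrite exprn_ge0 // (le_trans ler01).
  have M2 : (M <= 2 * b + 1)%N by rewrite /M; clear -hab; lia.
  apply: le_trans (_ : ((b ^ m.-1) ^ 12)%:R <= _).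
    by rewrite ler_nat; apply: word_nat_le.
  rewrite natrX lerXn2r ?nnegrE ?ler0n ?(le_trans ler01) //.
  apply: le_trans (le_trans c_tb wt).
  apply: le_trans (_ : (maxn 1 b ^ m.-1)%:R <= _); last exact: cost_ge_pow.
  by rewrite ler_nat leq_exp_base // leq_maxr.
have hWw : W%:R <= (30 * (C0 + 2) + 9)%:R * w ^+ 12.
  have hA3 : A%:R <= (30 * (C0 + 2))%:R * w ^+ 12.
    apply: le_trans spb _; rewrite ler_wpM2l ?ler0n //.
    by apply: le_trans h12; apply: le_trans wt.
  have hM4 : (4 * M + 5)%:R <= 8%:R * w ^+ 12 :> rat.
    apply: le_trans (_ : 8%:R * w <= _); last by rewrite ler_wpM2l ?ler0n.
    apply: le_trans (_ : (8 * (2 + b))%:R <= _).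
      by rewrite ler_nat /M; clear -hab; lia.
    by rewrite natrM natrD ler_wpM2l ?ler0n.
  rewrite /W natrD -addnA natrD [X in _ <= X * _]natrD mulrDl.
  have e9 : 9%:R * w ^+ 12 = 8%:R * w ^+ 12 + w ^+ 12 by rewrite -[9%N]/(8 + 1)%N natrD mulrDl mul1r.
  by rewrite e9 addrA; apply: lerD => //; apply: lerD.
apply: le_trans hWw _.
(* The constant factor is turned into a power of [w], using [k <= 2 ^ k] and [2 <= w], because the
   word limit is to be a pure power of [word_base]. *)
have hK2 : (30 * (C0 + 2) + 9)%:R <= w ^+ (30 * (C0 + 2) + 9).
  apply: le_trans (_ : (2 ^ (30 * (C0 + 2) + 9))%:R <= _).
    by rewrite ler_nat ltnW // ltn_expl.
  rewrite natrX lerXn2r ?nnegrE ?ler0n ?(le_trans ler01) //.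
  by have := ler0n rat b; lra.
apply: le_trans (_ : w ^+ (30 * (C0 + 2) + 9) * w ^+ 12 <= _).
  by rewrite ler_wpM2r // exprn_ge0 // (le_trans ler01).
rewrite -exprD ler_weXn2l // /K; clear; lia.
Qed.
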